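(* (1) Surjectivity. The map $\mathcal S$ is a bijection from a neighborhood of $0$ in $M_n(\mathbb C_\infty)$ onto a neighborhood of $\omega I_n$ in $M_n(\mathbb C_\infty)$ (consisting of Siegel matrices). In particular, the lattice map $M\mapsto L(M)$ is surjective near the lattice $L(M(0))$, i.e. all (isomorphism classes of) lattices in some neighborhood of $L(M(0))$ are of the form $L(M(A))$. (2) Injectivity. For any integer $m\ge 0$ there exists a neighborhood $U_m$ of $0$ in $M_n(\mathbb C_\infty)$ (contained in the domain of $\mathcal S$) with the following property. Let $A_1,A_2\in U_m$. If there exists $\gamma\in G_0$ such that all entries of $\gamma$ and of $\gamma^{-1}$ have degree $\le m$ as polynomials in $\theta$ and $\gamma(\mathcal S(A_1))=\mathcal S(A_2)$, then the t-motives $M(A_1)$ and $M(A_2)$ are isomorphic.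
   Context: Fields. $q$ is a power of an odd prime, $\theta$ is transcendental over $\mathbb F_q$, $\mathbb C_\infty$ is the completion of an algebraic closure of $\mathbb F_q((1/\theta))$, and $\mathrm{ord}$ is its valuation with $\mathrm{ord}(\theta)=-1$. For a matrix $A=(a_{ij})$ over $\mathbb C_\infty$, $\mathrm{ord}(A)=\min \mathrm{ord}(a_{ij})$ (this defines the topology) and $A^{(k)}=(a_{ij}^{q^k})$. Put $\theta_{ij}=\theta^{q^i}-\theta^{q^j}$. Fix $n\ge1$ and $\omega\in\mathbb F_{q^2}\setminus\mathbb F_q$ with $\omega^2\in\mathbb F_q$. t-motives. $\mathbb C_\infty[T,\tau]$ is the ring of non-commutative polynomials with $Ta=aT$, $T\tau=\tau T$, $\tau a=a^q\tau$ ($a\in\mathbb C_\infty$). For $A\in M_n(\mathbb C_\infty)$, $M(A)$ is the left $\mathbb C_\infty[T,\tau]$-module which is free over $\mathbb C_\infty\{\tau\}$ with basis $e_*=(e_1,\dots,e_n)^t$ and $Te_*=\theta e_*+A\tau e_*+\tau^2e_*$ (a t-motive of dimension $n$ and rank $2n$). Isomorphism of t-motives means isomorphism of $\mathbb C_\infty[T,\tau]$-modules. Lattice of $M(A)$. $\mathrm{Exp}_A(X)=\sum_{i\ge0}C_i(A)X^{(i)}$ for $X\in\mathbb C_\infty^n$ (columns), where $C_{-1}=0$, $C_0=I_n$, $C_\nu=\theta_{\nu0}^{-1}\left(AC_{\nu-1}^{(1)}+C_{\nu-2}^{(2)}\right)$ for $\nu\ge1$. $M(A)$ is uniformizable if $\mathrm{Exp}_A:\mathbb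 C_\infty^n\to\mathbb C_\infty^n$ is surjective; then $L(M(A))=\ker \mathrm{Exp}_A$, a lattice of rank $2n$ in $\mathbb C_\infty^n$. A lattice of rank $r$ in $V=\mathbb C_\infty^n$ is a free $\mathbb F_q[\theta]$-submodule of rank $r$ generating $V$ over $\mathbb C_\infty$ and whose $\mathbb F_q((1/\theta))$-span has dimension $r$ over $\mathbb F_q((1/\theta))$. Lattices are considered up to $\mathbb C_\infty$-linear automorphisms of $V$. Siegel matrices. If $g_1,\dots,g_{2n}$ is an $\mathbb F_q[\theta]$-basis of a lattice $L$ of rank $2n$ such that $g_1,\dots,g_n$ is a $\mathbb C_\infty$-basis of $V$, its Siegel matrix is $S=(s_{ij})\in M_n(\mathbb C_\infty)$ with $g_{n+i}=\sum_{j=1}^ns_{ij}g_j$. A Siegel matrix determines its lattice up to isomorphism; the set of lattices has the quotient topology from the set of Siegel matrices. For $Z\in GL_{2n}(\mathbb F_q[\theta])$ with $n\times n$ blocks $Z_{ij}$ ($i,j=1,2$), $Z(S_1)=S_2$ means $S_1=(Z_{12}^t+Z_{22}^tS_2)(Z_{11}^t+Z_{21}^tS_2)^{-1}$ (when defined). $G_0\subset GL_{2n}(\mathbb F_q[\theta])$ is the stabilizer of $\omega I_n$, which is a Siegel matrix of $L(M(0))$. The map $\mathcal S$. Let $y_0$ be a fixed nonzero root of largest $\mathrm{ord}$ of $\sum_{i\ge0}z^{q^{2i}}/(\theta_{2i,2i-2}\theta_{2i,2i-4}\cdots\theta_{2i,0})$ (the $i=0$ term being $z$); $\mathrm{ord}(y_0)=-q^2/(q^2-1)$.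 For $A$ with $\mathrm{ord}(A)>q/(q^2-1)$ and $i=1,\dots,n$, let $Y_i$ (resp. $Y_i'$) be the column with $y_0$ (resp. $\omega y_0$) in place $i$ and $0$ elsewhere, and let $X_i=Y_i+\Delta_i$, $X_i'=Y'_i+\Delta_i'$ be the unique zeros of $\mathrm{Exp}_A$ with $\mathrm{ord}(\Delta_i)>0$, $\mathrm{ord}(\Delta_i')>0$. Then $X_1,\dots,X_n,X'_1,\dots,X_n'$ is an $\mathbb F_q[\theta]$-basis of $L(M(A))$, and $\mathcal S(A)$ is its Siegel matrix, i.e. $\mathcal S(A)=(X')^t(X^t)^{-1}$ where $X$, $X'$ are the $n\times n$ matrices with columns $X_i$, $X_i'$. *)

(* Defs.v *)
From HB Require Import structures.
From mathcomp Require Import all_boot all_order all_algebra all_field.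
From mathcomp Require Import boolp classical_sets functions reals constructive_ereal.

Set Implicit Arguments.
Unset Strict Implicit.
Unset Printing Implicit Defensive.

Import Order.TTheory GRing.Theory Num.Theory.

Local Open Scope classical_set_scope.
Local Open Scope ring_scope.

Definition val_cvg (R : realType) (V : zmodType) (v : V -> \bar R)
    (u : nat -> V) (l : V) : Prop :=
  forall c : R, exists N : nat, forall k, (N <= k)%N -> (c%:E < v (u k - l)%R)%E.

Definition val_cauchy (R : realType) (V : zmodType) (v : V -> \bar R)
    (u : nat -> V) : Prop :=
  forall c : R, exists N : nat, forall i j, (N <= i)%N -> (N <= j)%N ->
    (c%:E < v (u i - u j)%R)%E.

(* The subfield F((1/theta)) of C: the sums of the convergent series
   \sum_(i >= 0) c_i theta ^ (N - i) with c_i in F. *)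
Definition laurent (F : finFieldType) (R : realType) (C : closedFieldType)
    (iota : {rmorphism F -> C}) (theta : C) (ord : C -> \bar R) : set C :=
  [set x | exists (N : nat) (c : nat -> F),
     val_cvg ord (fun k => \sum_(i < k) iota (c i) * (theta ^+ N / theta ^+ i)) x].

(* The valued field C_oo over the constant field F = F_q.  C is algebraically
   closed, so that the elements of C algebraic over F((1/theta)) form an
   algebraic closure of F((1/theta)); since C is complete and this algebraic
   closure is dense in it, C is its completion.  These properties determine C
   up to isomorphism of valued fields over F(theta). *)
Record cinf (F : finFieldType) (R : realType) := Cinf {
  cfield :> closedFieldType;
  const : {rmorphism F -> cfield};
  theta : cfield;
  ord : cfield -> \bar R;
  ord0 : ord 0 = +oo%E;
  ord_fin : forall x, x != 0 -> ord x \is a fin_num;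
  ordM : forall x y, ord (x * y) = (ord x + ord y)%E;
  ordD : forall x y, (Order.min (ord x) (ord y) <= ord (x + y)%R)%E;
  ord_theta : ord theta = (-1)%:E;
  cinf_complete : forall u, val_cauchy ord u -> exists l, val_cvg ord u l;
  cinf_dense : forall (x : cfield) (c : R), exists y : cfield,
    (c%:E < ord (x - y)%R)%E /\
    exists p : {poly cfield},
      [/\ p != 0, forall i, laurent const theta ord p`_i & root p y] }.


Section Cinfinity.
Context (F : finFieldType) (R : realType) (C : cinf F R).

Definition q_of : nat := #|F|.
Local Notation q := q_of.

(* theta_{ij} *)
Definition thetad (i j : nat) : C := theta C ^+ (q ^ i) - theta C ^+ (q ^ j).

Definition evtheta (p : {poly F}) : C := (map_poly (const C) p).[theta C].

(* F_q[theta] and F_q((1/theta)), as subsets of C_oo. *)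
Definition ring_A : set C := range evtheta.
Definition field_K : set C := laurent (const C) (theta C) (@ord F R C).

Definition mxord m n (A : 'M[C]_(m, n)) : \bar R :=
  \big[Order.min/+oo%E]_(i < m) \big[Order.min/+oo%E]_(j < n) ord (A i j).

Definition mxnbhs m n (A : 'M[C]_(m, n)) (U : set 'M[C]_(m, n)) : Prop :=
  exists c : R, forall B, (c%:E < mxord (B - A)%R)%E -> U B.

(* A^(k) *)
Definition twist m n (k : nat) (A : 'M[C]_(m, n)) : 'M[C]_(m, n) :=
  map_mx (fun x => x ^+ (q ^ k)) A.

(** t-motives *)

(* A left module over C[T, tau] is a C-vector space with a C-linear operator T
   and a q-semilinear operator tau that commute. *)
Record tmodule := TModule {
  tcarrier :> lmodType C;
  actT : {linear tcarrier -> tcarrier};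
  acttau : {additive tcarrier -> tcarrier};
  acttauZ : forall (a : C) x, acttau (a *: x) = a ^+ q *: acttau x;
  actT_tau : forall x, actT (acttau x) = acttau (actT x) }.

Definition tmodule_iso (M1 M2 : tmodule) : Prop :=
  exists f : {linear M1 -> M2},
    [/\ bijective f, forall x, f (actT M1 x) = actT M2 (f x)
      & forall x, f (acttau M1 x) = acttau M2 (f x)].

(* The free C{tau}-module with basis e_1, ..., e_n.  An element of C{tau} is
   represented by the polynomial with the same coefficients, written on the
   left: \sum_k a_k 'X^k stands for \sum_k a_k tau^k, and the row p stands for
   \sum_i p_i e_i.  The product of {poly C} is not that of C{tau}, but the two
   agree for left multiplication by constants and right multiplication by tau. *)
Definition taufree (n : nat) : Type := 'rV[{poly C}]_n.

HB.instance Definition _ n := GRing.Zmodule.on (taufree n).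

Section TauFree.
Context (n : nat).

Definition taufree_scale (a : C) (x : taufree n) : taufree n := a%:P *: (x : 'rV__).

Lemma taufree_scaleA a b x :
  taufree_scale a (taufree_scale b x) = taufree_scale (a * b) x.
Proof. by rewrite /taufree_scale scalerA polyCM. Qed.
Lemma taufree_scale1 : left_id 1 taufree_scale.
Proof. by move=> x; rewrite /taufree_scale scale1r. Qed.
Lemma taufree_scaleDr : right_distributive taufree_scale +%R.
Proof. by move=> a x y; rewrite /taufree_scale scalerDr. Qed.
Lemma taufree_scaleDl x : {morph taufree_scale^~ x : a b / a + b}.
Proof. by move=> a b; rewrite /taufree_scale polyCD scalerDl. Qed.

HB.instance Definition _ := GRing.Zmodule_isLmodule.Build C (taufree n)
  taufree_scaleA taufree_scale1 taufree_scaleDr taufree_scaleDl.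

End TauFree.

(* The products tau * p and p * a in C{tau}, for a in C. *)
Definition taumul (p : {poly C}) : {poly C} := map_poly (fun c => c ^+ q) p * 'X.
Definition mulconst (p : {poly C}) (a : C) : {poly C} :=
  \poly_(k < size p) (p`_k * a ^+ (q ^ k)).

Lemma q_gt0 : (0 < q)%N.
Proof. by apply/card_gt0P; exists 0. Qed.

Lemma frobD (x y : C) : (x + y) ^+ q = x ^+ q + y ^+ q.
Proof.
have [p p_pr pF] := finPcharP F.
have pC : p \in [pchar C] by rewrite (fmorph_pchar (const C)).
apply: exprDn_pchar; rewrite (eq_pnat _ (pcharf_eq pC)) /q_of.
by rewrite (card_pprimeChar pF) pnatX pnat_id.
Qed.

Lemma coef_mulconst p a k : (mulconst p a)`_k = p`_k * a ^+ (q ^ k).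
Proof. by rewrite coef_poly; case: ltnP => // h; rewrite nth_default ?mul0r. Qed.

Lemma coef_taumul p k : (taumul p)`_k = if k is k'.+1 then p`_k' ^+ q else 0.
Proof.
rewrite coefMX; case: k => //= k.
by rewrite coef_map_id0 // expr0n; case: q q_gt0.
Qed.

Definition taufree_tau n (x : taufree n) : taufree n :=
  map_mx taumul (x : 'rV[{poly C}]_n).

(* T (\sum_i p_i e_i) = \sum_i p_i (theta e_i + \sum_j A_ij tau e_j + tau^2 e_i) *)
Definition taufree_T n (A : 'M[C]_n) (x : taufree n) : taufree n :=
  \row_j (mulconst (x 0 j) (theta C)
          + (\sum_i mulconst (x 0 i) (A i j)) * 'X + x 0 j * 'X^2).

Lemma frobB (x y : C) : (x - y) ^+ q = x ^+ q - y ^+ q.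
Proof. by apply: (addIr (y ^+ q)); rewrite -frobD !subrK. Qed.

Lemma taufree_tau_additive n : zmod_morphism (@taufree_tau n).
Proof.
move=> x y; apply/rowP=> j; apply/polyP=> k.
rewrite !mxE coefB !coef_taumul; case: k => [|k]; first by rewrite subr0.
by rewrite coefB frobB.
Qed.

HB.instance Definition _ n :=
  GRing.isZmodMorphism.Build (taufree n) (taufree n) (@taufree_tau n)
    (@taufree_tau_additive n).

Lemma taufree_tauZ n (a : C) (x : taufree n) :
  taufree_tau (a *: x) = a ^+ q *: taufree_tau x.
Proof.
apply/rowP=> j; apply/polyP=> k.
rewrite !mxE coefCM !coef_taumul; case: k => [|k]; first by rewrite mulr0.
by rewrite coefCM exprMn.
Qed.

Lemma mulconst_linear a : linear (mulconst^~ a).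
Proof.
move=> c p p'; apply/polyP=> k.
by rewrite !(coef_mulconst, coefD, coefZ) mulrDl mulrA.
Qed.

Lemma taufree_T_linear n A : linear (@taufree_T n A).
Proof.
move=> c x y; apply/rowP=> j; rewrite !mxE !mul_polyC mulconst_linear.
under eq_bigr do rewrite !mxE mul_polyC mulconst_linear.
rewrite big_split -scaler_sumr /= !mulrDl !scalerDr !scalerAl.
by rewrite [RHS]addrACA; congr (_ + _); exact: addrACA.
Qed.

HB.instance Definition _ n A :=
  GRing.isLinear.Build C (taufree n) (taufree n) _ (@taufree_T n A)
    (@taufree_T_linear n A).

Lemma taumul_mulconst p a : taumul (mulconst p a) = mulconst (taumul p) a.
Proof.
apply/polyP=> k; rewrite coef_mulconst !coef_taumul.
case: k => [|k]; first by rewrite mul0r.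
by rewrite coef_mulconst exprMn -exprM expnSr.
Qed.

Lemma taumulD (p p' : {poly C}) : taumul (p + p') = taumul p + taumul p'.
Proof.
apply/polyP=> -[|k]; rewrite coefD !coef_taumul ?addr0 //.
by rewrite coefD frobD.
Qed.

Lemma taumulMX p : taumul (p * 'X) = taumul p * 'X.
Proof.
apply/polyP=> k; rewrite coef_taumul [RHS]coefMX.
case: k => [|k] //=; rewrite coef_taumul coefMX; case: k => [|k] //=.
by rewrite expr0n; case: q q_gt0.
Qed.

Lemma taumul0 : taumul 0 = 0.
Proof. by rewrite /taumul map_poly0 mul0r. Qed.

Lemma taumulXn m : taumul 'X^m = 'X^(m.+1).
Proof.
elim: m => [|m IHm]; last by rewrite exprSr taumulMX IHm -exprSr.
apply/polyP=> k; rewrite coef_taumul coefXn; case: k => // k.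
by rewrite coef1 eqSS; case: eqP; rewrite ?expr1n // expr0n; case: q q_gt0.
Qed.

Lemma mulconst1 a : mulconst 1 a = a%:P.
Proof.
by apply/polyP=> -[|k]; rewrite coef_mulconst coef1 coefC /= ?mul0r // mul1r expr1.
Qed.

Lemma mulconst0 a : mulconst 0 a = 0.
Proof. by apply/polyP=> k; rewrite coef_mulconst coef0 mul0r. Qed.

Lemma taufree_T_tau n (A : 'M[C]_n) x :
  taufree_T A (taufree_tau x) = taufree_tau (taufree_T A x).
Proof.
apply/rowP=> j; rewrite !mxE !taumulD taumul_mulconst !taumulMX.
rewrite (big_morph _ taumulD taumul0) expr2 !mulrA !taumulMX.
by congr (_ + _ * 'X + _); apply: eq_bigr => i _; rewrite mxE taumul_mulconst.
Qed.

(* The t-motive M(A) *)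
Definition tmotive n (A : 'M[C]_n) : tmodule :=
  TModule (actT := @taufree_T n A) (@taufree_tauZ n) (@taufree_T_tau n A).

Definition tbasis n (i : 'I_n) : taufree n := delta_mx 0 i.

Lemma tmotive_free n (A : 'M[C]_n) N (c : 'I_n -> nat -> C) :
  \sum_i \sum_(k < N) c i k *: iter k (acttau (tmotive A)) (tbasis i)
  = (\row_i \poly_(k < N) c i k : 'rV_n).
Proof.
have iterE i k : iter k (acttau (tmotive A)) (tbasis i) = 'X^k *: (tbasis i : 'rV_n).
  elim: k => [|k IHk]; first by rewrite expr0 scale1r.
  rewrite iterS IHk; apply/rowP=> j; rewrite !mxE /=.
  by case: eqP => _; rewrite ?mulr1 ?mulr0 ?taumul0 // taumulXn.
rewrite [RHS]row_sum_delta; apply: eq_bigr => i _.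
rewrite mxE poly_def scaler_suml; apply: eq_bigr => k _.
by rewrite iterE; apply/rowP=> j; rewrite !mxE mulrA mul_polyC.
Qed.

Lemma tmotive_T n (A : 'M[C]_n) i :
  actT (tmotive A) (tbasis i) =
  theta C *: tbasis i + \sum_j A i j *: acttau (tmotive A) (tbasis j)
  + acttau (tmotive A) (acttau (tmotive A) (tbasis i)).
Proof.
have tE j : acttau (tmotive A) (tbasis j) = 'X *: (tbasis j : 'rV_n).
  apply/rowP=> l; rewrite !mxE /=; case: eqP => _; last by rewrite mulr0 taumul0.
  by rewrite -['X]expr1 -taumulXn expr0 mulr1.
apply/rowP=> j; rewrite !mxE summxE eqxx /=.
rewrite (bigD1 i) //= big1 ?addr0 => [|l li]; last first.
  by rewrite !mxE (negbTE li) andbF mulconst0.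
rewrite !mxE !eqxx /= mulconst1.
rewrite (bigD1 j) //= big1 ?addr0 => [|l lj]; last first.
  by rewrite tE !mxE eq_sym (negbTE lj) andbF !mulr0.
rewrite tE !mxE !eqxx /= mulr1 !mul_polyC.
case: eqP => _ /=; last by rewrite mulconst0 mul0r !taumul0 scaler0.
by rewrite mulconst1 mul1r -[1%:R]/('X^0) !taumulXn expr0 alg_polyC.
Qed.

(** Exp_A and uniformizability *)

Fixpoint expcoef n (A : 'M[C]_n) (nu : nat) : 'M[C]_n :=
  if nu is nu1.+1 then
    (thetad nu 0)^-1 *:
      (A *m twist 1 (expcoef A nu1)
       + if nu1 is nu2.+1 then twist 2 (expcoef A nu2) else 0)
  else 1%:M.

(* Exp_A(X) = Y *)
Definition Exp_eq n (A : 'M[C]_n) (X Y : 'cV[C]_n) : Prop :=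
  val_cvg (@mxord n 1) (fun k => \sum_(i < k) expcoef A i *m twist i X) Y.

Definition uniformizable n (A : 'M[C]_n) : Prop := forall Y, exists X, Exp_eq A X Y.

(* L(M(A)), for M(A) uniformizable *)
Definition tmotive_lattice n (A : 'M[C]_n) : set 'cV[C]_n := [set X | Exp_eq A X 0].

(** Lattices and Siegel matrices *)

(* b is an S-linearly independent family whose S-span is W. *)
Definition basis_over n (S : set C) r (b : 'I_r -> 'cV[C]_n) (W : set 'cV[C]_n) : Prop :=
  (forall v, W v <->
     exists2 c : 'I_r -> C, (forall i, S (c i)) & v = \sum_i c i *: b i) /\
  (forall c : 'I_r -> C, (forall i, S (c i)) -> \sum_i c i *: b i = 0 ->
     forall i, c i = 0).

Definition span_over n (S : set C) (W : set 'cV[C]_n) : set 'cV[C]_n :=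
  [set v | exists k (w : 'I_k -> 'cV[C]_n) (c : 'I_k -> C),
     [/\ forall i, W (w i), forall i, S (c i) & v = \sum_i c i *: w i]].

Definition is_lattice n (r : nat) (L : set 'cV[C]_n) : Prop :=
  [/\ exists g : 'I_r -> 'cV[C]_n, basis_over ring_A g L,
      span_over setT L = setT
    & exists b : 'I_r -> 'cV[C]_n, basis_over field_K b (span_over field_K L)].

Definition lattice_iso n (L1 L2 : set 'cV[C]_n) : Prop :=
  exists2 P : 'M[C]_n, P \in unitmx & L2 = [set P *m v | v in L1].

Definition siegel_of n (L : set 'cV[C]_n) (S : 'M[C]_n) : Prop :=
  exists g : 'I_(n + n) -> 'cV[C]_n,
    [/\ basis_over ring_A g L,
        basis_over setT (fun i => g (lshift n i)) setT
      & forall i, g (rshift n i) = \sum_j S i j *: g (lshift n j)].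

Definition siegel_matrices n : set 'M[C]_n :=
  [set S | exists2 L, is_lattice (n + n) L & siegel_of L S].

(* W, a set of lattices of rank 2n closed under isomorphism, is open in the
   quotient topology: the set of the Siegel matrices of the lattices in W is
   open in the set of all Siegel matrices. *)
Definition lattice_open n (W : set (set 'cV[C]_n)) : Prop :=
  [/\ forall L, W L -> is_lattice (n + n) L,
      forall L1 L2, W L1 -> lattice_iso L1 L2 -> W L2
    & forall L S, W L -> siegel_of L S ->
        mxnbhs S [set S' | siegel_matrices S' -> exists2 L', W L' & siegel_of L' S']].

(* Z(S1) = S2 *)
Definition siegel_act n (Z : 'M[{poly F}]_(n + n)) (S1 S2 : 'M[C]_n) : Prop :=
  let ev (B : 'M[{poly F}]_n) : 'M[C]_n := map_mx evtheta B^T in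
  let den := ev (ulsubmx Z) + ev (dlsubmx Z) *m S2 in
  den \in unitmx /\
  S1 = (ev (ursubmx Z) + ev (drsubmx Z) *m S2) *m invmx den.

(* G_0 *)
Definition stab_omega n (omega : C) : set 'M[{poly F}]_(n + n) :=
  [set Z | Z \in unitmx /\ siegel_act Z omega%:M omega%:M].

(** The map calS *)

Definition root_series (z : C) : Prop :=
  val_cvg (@ord F R C)
    (fun k => \sum_(i < k)
       z ^+ (q ^ (2 * i)) / \prod_(j < i) thetad (2 * i) (2 * j)) 0.

Definition is_y0 (y : C) : Prop :=
  [/\ y != 0, root_series y
    & forall z, z != 0 -> root_series z -> (ord z <= ord y)%E].

Definition calS_dom n : set 'M[C]_n :=
  [set A | ((q%:R / (q%:R ^+ 2 - 1))%:E < mxord A)%E].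

(* The unique zero of Exp_A of the form Y + Delta with ord Delta > 0 (for A in
   calS_dom and Y one of the Y_i, Y'_i). *)
Definition zero_near n (A : 'M[C]_n) (Y : 'cV[C]_n) : 'cV[C]_n :=
  xget 0 [set X | Exp_eq A X 0 /\ (0%:E < mxord (X - Y)%R)%E].

(* The matrix whose i-th column is the zero of Exp_A near y e_i *)
Definition zeros_near n (A : 'M[C]_n) (y : C) : 'M[C]_n :=
  \matrix_(i, j) zero_near A (y *: delta_mx j 0) i 0.

Definition calS n (omega y0 : C) (A : 'M[C]_n) : 'M[C]_n :=
  (zeros_near A (omega * y0))^T *m invmx (zeros_near A y0)^T.

End Cinfinity.

(* Main.v *)
(** Write T_A Y = theta Y + A Y^(1) + Y^(2).  Exp_A is the additive series with
linear term the identity and Exp_A (theta X) = T_A (Exp_A X); it is an isometry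
of the open ball ord X > - q^2 / (q^2 - 1), which contains no period but 0.
From this, and from solving T_0 Y = Z entrywise in the algebraically closed
field, Exp_A is surjective when A is small; since T_A has no torsion besides the
points near F_(q^2)^n y_1, with y_1^(q^2 - 1) = - theta, descent by theta shows
that the X_i and X'_i span the kernel of Exp_A.

For (1), write sigma A = X^-1 X', the transpose of S A.  As C_1 = A / theta_10
and omega^q = - omega, the first-order part of sigma A - omega is kappa A with
kappa = 2 omega y_0^(q - 1) / theta_10, and the remainder is a contraction
relative to it; so sigma is a bijection between two balls.  A change of basis of
the lattice acts continuously on Siegel matrices, whence the open set of lattices.

For (2), gamma yields P in GL_n with P L(M(A_2)) = L(M(A_1)).  There is a unique
formal series Phi = sum Phi_k tau^k with Phi_0 = P and Phi T_(A_2) = T_(A_1) Phi,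
and Phi (Exp_(A_2) X) = Exp_(A_1) (P X) on a ball.  Hence Phi sends the
theta-torsion of A_2 to that of A_1; telescoping Phi T_(A_2) = T_(A_1) Phi at the
torsion points gives Phi_k y_1^(q^(k + 2)) -> 0, a growth that the recursion allows
only if Phi_k = 0 for all large k.  So Phi is an isomorphism of t-motives, with
inverse the series attached to P^-1. *)

(* Two rates govern the estimates: with rho = 1 / (q^2 - 1) and xi = 1 + rho = q^2 rho, the shortest
   periods have order - xi and the theta-torsion has order - rho. The bounds on Phi_k make Phi Y
   converge for ord Y > - 1. This range contains the torsion but not the periods, so that the
   periods X are used through Exp (X / theta). At order - rho the boundary terms of the telescoped
   identity are not negligible a priori, and that is where the information comes from: two torsion
   points, near eta = y_0 / theta and omega eta, separate Phi_k from Phi_(k+1) because omega^q = -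
   omega, and give ord Phi_k - xi q^k -> oo. The rate xi is the fixed point of x -> q^2 (x - 1), the
   effect of one backward step of the recursion, so an arbitrarily large surplus over xi q^k
   survives on the way back. The radius 1 for A leaves room throughout: q >= 3 gives q rho <= 3/8,
   and q rho is both the loss in passing from A to its periods and the gain of each step of the
   contraction. *)
From HB Require Import structures.
Require Import Defs.
From mathcomp Require Import all_boot all_order all_algebra finfield.
From mathcomp Require Import boolp classical_sets functions reals constructive_ereal.
From mathcomp Require Import ring lra zify.

Set Implicit Arguments.
Unset Strict Implicit.
Unset Printing Implicit Defensive.

Import Order.TTheory GRing.Theory Num.Theory.
Local Open Scope classical_set_scope.
Local Open Scope ring_scope.

(** * Valuations *)

Section Valuation.
Context (F : finFieldType) (R : realType) (C : cinf F R).
Local Notation q := (q_of F).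
Implicit Types (x y z : C) (r s : R).

(** Orders are handled through real lower bounds, so that most estimates end in linear arithmetic
    over R instead of the extended reals. *)
Definition oge r x : Prop := (r%:E <= ord x)%E.

Lemma ord_fine x : x != 0 -> exists r, ord x = r%:E.
Proof. by move/ord_fin/fin_numP; case: (ord x) => [r _|[]|[]] //; exists r. Qed.

Lemma oge0 r : oge r (0 : C).
Proof. by rewrite /oge Defs.ord0 leey. Qed.

Lemma oge_le r s x : s <= r -> oge r x -> oge s x.
Proof. by move=> sr; apply: le_trans; rewrite lee_fin. Qed.

Lemma ogeD r x y : oge r x -> oge r y -> oge r (x + y).
Proof. by move=> hx hy; apply: le_trans (ordD x y); rewrite le_min hx. Qed.

Lemma ord_one : ord (1 : C) = 0%E.
Proof.
have [r e] := ord_fine (oner_neq0 C).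
have := ordM (1 : C) 1; rewrite mulr1 e -EFinD => -[h].
by congr EFin; lra.
Qed.

Lemma ord_root1 x n : (0 < n)%N -> x ^+ n = 1 -> ord x = 0%E.
Proof.
move=> n0 h; have x0 : x != 0.
  by apply: contra_eq_neq h => ->; rewrite expr0n gtn_eqF // eq_sym oner_neq0.
have [r e] := ord_fine x0.
have ordX m : ord (x ^+ m) = (m%:R * r)%:E.
  elim: m => [|m IH]; first by rewrite expr0 mul0r ord_one.
  by rewrite exprS ordM IH e -EFinD -natr1; congr EFin; ring.
have := ordX n; rewrite h ord_one => -[] /esym/eqP.
by rewrite mulf_eq0 pnatr_eq0 gtn_eqF //= e => /eqP ->.
Qed.

Lemma ordN x : ord (- x) = ord x.
Proof.
by rewrite -mulN1r ordM (@ord_root1 (-1) 2) ?add0e // expr2 mulrNN mulr1.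
Qed.

Lemma ogeN r x : oge r (- x) <-> oge r x.
Proof. by rewrite /oge ordN. Qed.

Lemma ogeB r x y : oge r x -> oge r y -> oge r (x - y).
Proof. by move=> hx /ogeN hy; apply: ogeD. Qed.

Lemma ogeBC r x y : oge r (x - y) -> oge r (y - x).
Proof. by move/ogeN; rewrite opprB. Qed.

Lemma ogeM r s x y : oge r x -> oge s y -> oge (r + s) (x * y).
Proof. by move=> hx hy; rewrite /oge ordM EFinD; apply: leeD. Qed.

Lemma ogeX r x n : oge r x -> oge (n%:R * r) (x ^+ n).
Proof.
move=> h; elim: n => [|n IH]; first by rewrite mul0r expr0 /oge ord_one.
by rewrite exprS -natr1 mulrDl mul1r addrC; apply: ogeM.
Qed.

Lemma ordX x n r : ord x = r%:E -> ord (x ^+ n) = (n%:R * r)%:E.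
Proof.
move=> e; elim: n => [|m IH]; first by rewrite expr0 mul0r ord_one.
by rewrite exprS ordM IH e -EFinD -natr1; congr EFin; ring.
Qed.

Lemma ord_oge x r s : ord x = r%:E -> oge s x -> s <= r.
Proof. by rewrite /oge => ->; rewrite lee_fin. Qed.

Lemma oge_ord x r : ord x = r%:E -> oge r x.
Proof. by rewrite /oge => ->. Qed.

Lemma ord_neq0 x r : ord x = r%:E -> x != 0.
Proof. by apply: contra_eq_neq => ->; rewrite Defs.ord0. Qed.

Lemma ordV x r : ord x = r%:E -> ord x^-1 = (- r)%:E.
Proof.
move=> e; have x0 := ord_neq0 e.
have [s es] := ord_fine (invr_neq0 x0).
have := ordM x x^-1; rewrite divff // ord_one e es -EFinD => -[h].
by congr EFin; lra.
Qed.

Lemma oge_div x y r s : ord y = s%:E -> oge r x -> oge (r - s) (y^-1 * x).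
Proof.
by move=> /ordV/oge_ord hy hx; rewrite addrC; apply: ogeM.
Qed.

Lemma oge_mulK x y r s : ord y = s%:E -> oge r (y * x) -> oge (r - s) x.
Proof.
by move=> e /(oge_div e); rewrite mulKf // (ord_neq0 e).
Qed.

Lemma oge_oo x : (forall c, exists2 r, c <= r & oge r x) -> x = 0.
Proof.
move=> h; apply/eqP/negPn/negP => /ord_fine[r e].
by have [s hs /(ord_oge e)] := h (r + 1); lra.
Qed.

(** Equality case of the ultrametric inequality: were ord y > r, both terms of x = y - (y - x) would
    have order above r. *)
Lemma ord_near x y r s : ord x = r%:E -> r < s -> oge s (y - x) -> ord y = r%:E.
Proof.
move=> e rs h.
have hy : oge r y.
  by rewrite -(subrK x y); apply: ogeD (oge_ord e); apply: oge_le h; apply: ltW.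
apply/eqP; rewrite eq_le hy andbT leNgt; apply/negP => lt.
have [y0|/ord_fine[t et]] := eqVneq y 0.
  by move/ogeBC: h; rewrite y0 subr0 => /(ord_oge e); rewrite leNgt rs.
move: lt; rewrite et lte_fin => rt.
have : oge (Num.min s t) x.
  rewrite -[x](subKr y) ; apply: ogeB.
    by apply: oge_le (oge_ord et); rewrite ge_min lexx orbT.
  by apply: oge_le h; rewrite ge_min lexx.
by move/(ord_oge e); rewrite ge_min leNgt rs leNgt rt.
Qed.

Lemma oge_cases x : x = 0 \/ exists2 r, ord x = r%:E & oge r x.
Proof.
have [->|/ord_fine[r e]] := eqVneq x 0; first by left.
by right; exists r => //; apply: oge_ord.
Qed.

Lemma oge_sum r I (s : seq I) (P : pred I) (f : I -> C) :
  (forall i, P i -> oge r (f i)) -> oge r (\sum_(i <- s | P i) f i).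
Proof.
by move=> h; elim/big_ind: _ => //; [apply: oge0 | move=> x y; apply: ogeD].
Qed.

Lemma ord_const (a : F) : a != 0 -> ord (const C a) = 0%E.
Proof.
move=> a0; apply: (@ord_root1 _ q.-1).
  by rewrite -subn1 subn_gt0 finNzRing_gt1.
rewrite -rmorphXn /= -(rmorph1 (const C)); congr (const C _).
by apply: (mulfI a0); rewrite -exprS prednK ?expf_card ?mulr1 // q_gt0.
Qed.

Lemma const_frob (a : F) k : const C a ^+ (q ^ k) = const C a.
Proof.
rewrite -rmorphXn /=; congr (const C _).
by elim: k => [|k IH]; rewrite ?expr1 // expnSr exprM IH expf_card.
Qed.

Lemma oge_const (a : F) : oge 0 (const C a).
Proof.
have [->|a0] := eqVneq a 0; first by rewrite rmorph0; apply: oge0.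
by apply: oge_ord; apply: ord_const.
Qed.

(** Packaged as a ring morphism, so that [twist] inherits the rules of [map_mx]. *)
Definition frob k x := x ^+ (q ^ k).

Lemma frob_additive k : zmod_morphism (frob k).
Proof.
move=> x y; rewrite /frob; elim: k => [|k IH]; first by rewrite !expr1.
by rewrite expnSr !exprM IH frobB.
Qed.
Lemma frob_monoid k : monoid_morphism (frob k).
Proof. by split=> [|x y]; rewrite /frob ?expr1n ?exprMn. Qed.
HB.instance Definition _ k := GRing.isZmodMorphism.Build C C (frob k) (frob_additive k).
HB.instance Definition _ k := GRing.isMonoidMorphism.Build C C (frob k) (frob_monoid k).

Lemma frobE k x : frob k x = x ^+ (q ^ k). Proof. by []. Qed.
Lemma frob_frob j k x : frob j (frob k x) = frob (j + k) x.
Proof. by rewrite /frob -exprM -expnD addnC. Qed.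

End Valuation.

(** * Numerical constants attached to q *)

Section Constants.
Context (F : finFieldType) (R : realType).
Hypothesis (hq : odd #|F|).
Local Notation q := (q_of F).

Definition qreal : R := q%:R.
(* The nonzero solutions of y^(q^2) + theta y = 0 have order - tors_val. *)
Definition tors_val : R := (qreal ^+ 2 - 1)^-1.
Local Notation rho := tors_val.

Lemma q_ge3 : (3 <= q)%N.
Proof.
have := finNzRing_gt1 F; rewrite -/q leq_eqVlt => /orP[/eqP e|//].
by move: hq; rewrite -/q -e.
Qed.

Lemma qreal_ge3 : 3 <= qreal.
Proof. by rewrite /qreal ler_nat q_ge3. Qed.

(** At ord y = - rho the terms y^(q^2) and theta y have equal order; most cancellations below come
    from this identity. *)
Lemma qreal_rho : qreal ^+ 2 * rho = 1 + rho.
Proof.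
have Q3 := qreal_ge3.
have h : qreal ^+ 2 - 1 != 0 by apply: lt0r_neq0; nra.
by rewrite /rho; field.
Qed.

Lemma rho_gt0 : 0 < rho.
Proof. by rewrite invr_gt0; have := qreal_ge3; nra. Qed.

Lemma rho_le : 8 * rho <= 1.
Proof.
have h1 := qreal_ge3; have h2 := qreal_rho; have h3 := rho_gt0.
have h5 : 0 <= (qreal ^+ 2 - 9) * rho by rewrite mulr_ge0 //; [nra|lra].
by move: h5; rewrite mulrBl; lra.
Qed.

(** Sharp at q = 3, like [rho_le]. It leaves q rho well below 1, the order assumed of A later on. *)
Lemma qrho_le : 8 * (qreal * rho) <= 3.
Proof.
have h1 := qreal_ge3; have h2 := qreal_rho; have h3 := rho_gt0; have h4 := rho_le.
have h5 : 0 <= (qreal - 3) * (qreal * rho) by rewrite !mulr_ge0 //; lra.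
have : qreal * (qreal * rho) = 1 + rho by rewrite mulrA -expr2.
by move: h5; rewrite mulrBl; lra.
Qed.

Lemma qrho_gt : 3 * rho <= qreal * rho.
Proof. by have := qreal_ge3; have := rho_gt0; nra. Qed.

Lemma qrealX_ge1 k : 1 <= qreal ^+ k.
Proof. by apply: exprn_ege1; have := qreal_ge3; lra. Qed.

Lemma qrealX_ge k : (0 < k)%N -> qreal <= qreal ^+ k.
Proof.
by move=> k0; have := qreal_ge3 => h; rewrite -[leLHS]expr1 ler_weXn2l //; lra.
Qed.

Lemma qrealX_ge2 k : (1 < k)%N -> qreal ^+ 2 <= qreal ^+ k.
Proof. by move=> k0; have := qreal_ge3 => h; rewrite ler_weXn2l //; lra. Qed.

Lemma natr_qk k : (q ^ k)%:R = qreal ^+ k :> R.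
Proof. by rewrite natrX. Qed.

Lemma qrealX_ge_nat k : k%:R <= qreal ^+ k.
Proof.
by rewrite -natr_qk ler_nat ltnW // ltn_expl //; have := q_ge3; lia.
Qed.

Lemma nat_unbounded (c : R) : exists N : nat, forall k : nat, (N <= k)%N -> c <= k%:R.
Proof.
exists (Num.bound `|c|) => k hk.
apply: le_trans (ler_norm c) _; apply: le_trans (ltW (archi_boundP (normr_ge0 c))) _.
by rewrite ler_nat.
Qed.

End Constants.

(** * Matrices over a valued field *)

Section Mge.
Context (F : finFieldType) (R : realType) (C : cinf F R).
Local Notation q := (q_of F).
Local Notation Q := (qreal F R).
Implicit Types (c r s : R).

Definition mge m n r (A : 'M[C]_(m, n)) : Prop := forall i j, oge r (A i j).

Section Alg.
Context (m n : nat).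
Implicit Types (A B : 'M[C]_(m, n)).

Lemma mge0 r : mge r (0 : 'M[C]_(m, n)).
Proof. by move=> i j; rewrite mxE; apply: oge0. Qed.

Lemma mge_le r s A : s <= r -> mge r A -> mge s A.
Proof. by move=> sr h i j; apply: oge_le (h i j). Qed.

Lemma mgeD r A B : mge r A -> mge r B -> mge r (A + B).
Proof. by move=> hA hB i j; rewrite mxE; apply: ogeD. Qed.

Lemma mgeN r A : mge r (- A) <-> mge r A.
Proof. by split=> h i j; have := h i j; rewrite mxE => /ogeN. Qed.

Lemma mgeB r A B : mge r A -> mge r B -> mge r (A - B).
Proof. by move=> hA /mgeN; apply: mgeD. Qed.

Lemma mgeBC r A B : mge r (A - B) -> mge r (B - A).
Proof. by move/mgeN; rewrite opprB. Qed.

Lemma mge_trans r A B D : mge r (A - B) -> mge r (B - D) -> mge r (A - D).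
Proof. by move=> h1 h2; rewrite -(subrKA B); apply: mgeD. Qed.

Lemma mge_near r A B : mge r (A - B) -> mge r B -> mge r A.
Proof. by move=> h1 h2; rewrite -(subrK B A); apply: mgeD. Qed.

Lemma mgeZ r s (a : C) A : oge r a -> mge s A -> mge (r + s) (a *: A).
Proof. by move=> ha hA i j; rewrite mxE; apply: ogeM. Qed.

Lemma mgeZ_div r s (a : C) A : ord a = s%:E -> mge r A -> mge (r - s) (a^-1 *: A).
Proof. by move=> ha hA i j; rewrite mxE; apply: oge_div. Qed.

Lemma mge_sum r I (t : seq I) (P : pred I) (f : I -> 'M[C]_(m, n)) :
  (forall i, P i -> mge r (f i)) -> mge r (\sum_(i <- t | P i) f i).
Proof.
by move=> h; elim/big_ind: _ => //; [apply: mge0 | move=> x y; apply: mgeD].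
Qed.

Lemma mge_oo A : (forall c, exists2 r, c <= r & mge r A) -> A = 0.
Proof.
move=> h; apply/matrixP=> i j; rewrite mxE; apply: oge_oo => c.
by have [r cr hr] := h c; exists r.
Qed.

Lemma mge_ex A : exists r, mge r A.
Proof.
suff [r h] : exists r, forall p : 'I_m * 'I_n, p \in enum predT -> oge r (A p.1 p.2).
  by exists r => i j; apply: (h (i, j)); rewrite mem_enum.
elim: (enum _) => [|p s [r h]]; first by exists 0.
have [t ht] : exists t, oge t (A p.1 p.2).
  by have [->|[t _ ht]] := oge_cases (A p.1 p.2); [exists 0; apply: oge0|exists t].
exists (Num.min r t) => p'; rewrite inE => /predU1P[->|/h].
  by apply: oge_le ht; rewrite ge_min lexx orbT.
by apply: oge_le; rewrite ge_min lexx.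
Qed.

(** Bridge from neighborhoods, stated with [mxord], to real bounds. When the order is infinite, any
    real above c serves as r. *)
Lemma lt_mxordP c A : (c%:E < mxord A)%E <-> exists2 r, c < r & mge r A.
Proof.
have leP r : (r%:E <= mxord A)%E <-> mge r A.
  split=> [/bigmin_geP[_ h] i j|h].
    by have /bigmin_geP[_ h'] := h i isT; apply: h'.
  apply/bigmin_geP; split=> [|i _]; first by rewrite leey.
  by apply/bigmin_geP; split=> [|j _]; [rewrite leey|apply: h].
split=> [h|[r cr /leP h]]; last by apply: lt_le_trans h; rewrite lte_fin.
case e: (mxord A) h => [r||] //; first rewrite lte_fin => cr.
  by exists r => //; apply/leP; rewrite e.
by move=> _; exists (c + 1); [lra|apply/leP; rewrite e leey].
Qed.

(** Used to prove that a matrix vanishes, or has large order: an estimate read at the entry of least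
    order contradicts minimality. *)
Lemma mge_attained A : A != 0 -> exists r i j, mge r A /\ ord (A i j) = r%:E.
Proof.
move=> A0.
have [r [i [j e]]] : exists r i j, mxord A = r%:E /\ ord (A i j) = r%:E.
  have /existsP[i /existsP[j Aij]] : [exists i, [exists j, A i j != 0]].
    apply: contraNT A0; rewrite negb_exists => /forallP h.
    apply/eqP/matrixP=> i j; rewrite mxE; apply/eqP.
    by have := h i; rewrite negb_exists => /forallP/(_ j)/negPn.
  have [i' _ ei'] := eq_bigmin (x := +oo%E) i predT
     (fun i => \big[Order.min/+oo%E]_(j < n) ord (A i j)) isT (fun _ _ => leey _).
  have [j' _ ej'] := eq_bigmin (x := +oo%E) j predT
     (fun j => ord (A i' j)) isT (fun _ _ => leey _).
  have e : mxord A = ord (A i' j') by rewrite /mxord ei' ej'.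
  have [A'0|/ord_fine[r er]] := eqVneq (A i' j') 0; last first.
    by exists r, i', j'; rewrite e.
  have [s es] := ord_fine Aij.
  have : (mxord A <= ord (A i j))%E.
    by apply: le_trans (bigmin_le _ i _) (bigmin_le _ j _).
  by rewrite e A'0 Defs.ord0 es.
exists r, i, j; split; last by case: e.
move=> i' j'; rewrite /oge -e.1.
by apply: le_trans (bigmin_le _ i' _) (bigmin_le _ j' _).
Qed.

End Alg.

Lemma mge_mul m n p r s (A : 'M[C]_(m, n)) (B : 'M_(n, p)) :
  mge r A -> mge s B -> mge (r + s) (A *m B).
Proof.
by move=> hA hB i j; rewrite mxE; apply: oge_sum => k _; apply: ogeM.
Qed.

Lemma mge_tr m n r (A : 'M[C]_(m, n)) : mge r A^T <-> mge r A.
Proof. by split=> h i j; have := h j i; rewrite mxE. Qed.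

Lemma mge_scalar n r (a : C) : oge r a -> mge r (a%:M : 'M_n).
Proof.
by move=> ha i j; rewrite mxE; case: eqP => _; [rewrite mulr1n|rewrite mulr0n; apply: oge0].
Qed.

Lemma mge1 n : mge 0 (1%:M : 'M[C]_n).
Proof. by apply: mge_scalar; rewrite /oge ord_one. Qed.

Lemma mge_row_mx m n p r (A : 'M[C]_(m, n)) (B : 'M_(m, p)) :
  mge r (row_mx A B) <-> mge r A /\ mge r B.
Proof.
split=> [h|[hA hB] i j]; last by rewrite mxE; case: fintype.split.
by split=> i j; [have := h i (lshift p j)|have := h i (rshift n j)]; rewrite (row_mxEl, row_mxEr).
Qed.

Section Twist.

Lemma twistE m n k (A : 'M[C]_(m, n)) : twist k A = map_mx (frob k) A.
Proof. by []. Qed.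

Lemma mge_twist m n k r (A : 'M[C]_(m, n)) : mge r A -> mge (Q ^+ k * r) (twist k A).
Proof. by move=> h i j; rewrite mxE -natr_qk; apply: ogeX. Qed.

Lemma twistD m n k (A B : 'M[C]_(m, n)) : twist k (A + B) = twist k A + twist k B.
Proof. by rewrite twistE map_mxD. Qed.
Lemma twistB m n k (A B : 'M[C]_(m, n)) : twist k (A - B) = twist k A - twist k B.
Proof. by rewrite twistE map_mxB. Qed.
Lemma twist0 m n k : twist k (0 : 'M[C]_(m, n)) = 0.
Proof. by rewrite twistE map_mx0. Qed.
Lemma twistM m n p k (A : 'M[C]_(m, n)) (B : 'M_(n, p)) :
  twist k (A *m B) = twist k A *m twist k B.
Proof. by rewrite twistE map_mxM. Qed.
Lemma twistZ m n k a (A : 'M[C]_(m, n)) : twist k (a *: A) = a ^+ (q ^ k) *: twist k A.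
Proof. by rewrite twistE map_mxZ. Qed.
Lemma twist_scalar n k (a : C) : twist k (a%:M : 'M_n) = (a ^+ (q ^ k))%:M.
Proof. by rewrite twistE map_scalar_mx. Qed.
Lemma twist1 n k : twist k (1%:M : 'M[C]_n) = 1%:M.
Proof. by rewrite twist_scalar expr1n. Qed.
Lemma twist_0 m n (A : 'M[C]_(m, n)) : twist 0 A = A.
Proof. by apply/matrixP=> i j; rewrite mxE expr1. Qed.
Lemma twist_twist m n j k (A : 'M[C]_(m, n)) : twist j (twist k A) = twist (j + k) A.
Proof. by apply/matrixP=> a b; rewrite !mxE -!frobE frob_frob. Qed.
Lemma twist_const m n k (A : 'M[F]_(m, n)) :
  twist k (map_mx (const C) A) = map_mx (const C) A.
Proof. by apply/matrixP=> a b; rewrite !mxE const_frob. Qed.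
End Twist.
End Mge.

(** * Null sequences and convergent series of matrices *)

Section Limits.
Context (F : finFieldType) (R : realType) (C : cinf F R).
Local Notation q := (q_of F).
Local Notation Q := (qreal F R).
Implicit Types (c r s : R).

Definition small m n (u : nat -> 'M[C]_(m, n)) : Prop :=
  forall c, exists N, forall k, (N <= k)%N -> mge c (u k).

Definition vcvg m n (u : nat -> 'M[C]_(m, n)) (l : 'M_(m, n)) : Prop :=
  small (fun k => u k - l).

(** The value is 0 for a divergent series; [msumP] gives convergence as soon as the terms tend to
    0. *)
Definition msum m n (u : nat -> 'M[C]_(m, n)) : 'M_(m, n) :=
  xget 0 [set l | vcvg (fun k => \sum_(i < k) u i) l].

Lemma small_sub m n (u v : nat -> 'M[C]_(m, n)) :
  (forall k r, mge r (u k) -> mge r (v k)) -> small u -> small v.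
Proof. by move=> h hu c; have [N hN] := hu c; exists N => k /hN; apply: h. Qed.

Lemma eq_small m n (u v : nat -> 'M[C]_(m, n)) : u =1 v -> small u -> small v.
Proof. by move=> e; apply: small_sub => k r; rewrite e. Qed.

Lemma eq_vcvg m n (u v : nat -> 'M[C]_(m, n)) l : u =1 v -> vcvg u l -> vcvg v l.
Proof. by move=> e; apply: eq_small => k; rewrite e. Qed.

Section Basics.
Context (m n : nat).
Implicit Types (u v : nat -> 'M[C]_(m, n)) (l : 'M[C]_(m, n)).

Lemma smallD u v : small u -> small v -> small (fun k => u k + v k).
Proof.
move=> hu hv c; have [N1 h1] := hu c; have [N2 h2] := hv c.
exists (maxn N1 N2) => k; rewrite geq_max => /andP[k1 k2].
by apply: mgeD; [apply: h1|apply: h2].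
Qed.

Lemma smallN u : small u -> small (fun k => - u k).
Proof. by apply: small_sub => k r /mgeN. Qed.

Lemma small_shift j u : small (fun k => u (k + j)%N) <-> small u.
Proof.
split=> h c; have [N hN] := h c; last by exists N => k hk; apply: hN; lia.
exists (N + j)%N => k hk; rewrite -(@subnK j k); last lia.
by apply: hN; lia.
Qed.

Lemma small_const l : small (fun=> l) -> l = 0.
Proof.
by move=> h; apply: mge_oo => c; have [N /(_ N (leqnn N))] := h c; exists c.
Qed.

Lemma vcvg_unique u l l' : vcvg u l -> vcvg u l' -> l = l'.
Proof.
move=> h h'; apply/eqP; rewrite -subr_eq0; apply/eqP/small_const.
by apply: eq_small (smallD (smallN h) h') => k; rewrite opprB subrKA.
Qed.

Lemma vcvg_const l : vcvg (fun=> l) l.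
Proof. by move=> c; exists 0%N => k _; rewrite subrr; apply: mge0. Qed.

Lemma vcvgD u v l l' : vcvg u l -> vcvg v l' -> vcvg (fun k => u k + v k) (l + l').
Proof. by move=> h h'; apply: eq_small (smallD h h') => k; rewrite opprD addrACA. Qed.

Lemma vcvgN u l : vcvg u l -> vcvg (fun k => - u k) (- l).
Proof. by move=> h; apply: eq_small (smallN h) => k; rewrite opprD. Qed.

Lemma vcvg_shift j u l : vcvg (fun k => u (k + j)%N) l <-> vcvg u l.
Proof. exact: (small_shift j (fun k => u k - l)). Qed.

Lemma vcvg_small u l v : vcvg u l -> small v -> vcvg (fun k => u k + v k) l.
Proof. by move=> h h'; apply: eq_small (smallD h h') => k; rewrite addrAC. Qed.

Lemma vcvg_ge u l c N : vcvg u l -> (forall k, (N <= k)%N -> mge c (u k)) -> mge c l.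
Proof.
move=> h hu; have [N' hN'] := h c.
have := hN' (maxn N N') (leq_maxr _ _) => /mgeBC/mge_near; apply.
by apply: hu; apply: leq_maxl.
Qed.

Lemma small_mul p p' (a : 'M[C]_(p, m)) (b : 'M[C]_(n, p')) u :
  small u -> small (fun k => a *m u k *m b).
Proof.
have [r ha] := mge_ex a; have [s hb] := mge_ex b.
move=> hu c; have [N hN] := hu (c - r - s); exists N => k /hN h.
by apply: mge_le (mge_mul (mge_mul ha h) hb); lra.
Qed.

Lemma vcvg_mul p p' (a : 'M[C]_(p, m)) (b : 'M[C]_(n, p')) u l :
  vcvg u l -> vcvg (fun k => a *m u k *m b) (a *m l *m b).
Proof.
by move/(small_mul a b); apply: eq_small => k; rewrite mulmxBr mulmxBl.
Qed.

Lemma smallZ (a : C) u : small u -> small (fun k => a *: u k).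
Proof.
move/(small_mul a%:M 1%:M); apply: eq_small => k.
by rewrite mulmx1 mul_scalar_mx.
Qed.

Lemma vcvgZ (a : C) u l : vcvg u l -> vcvg (fun k => a *: u k) (a *: l).
Proof. by move/(smallZ a); apply: eq_small => k; rewrite scalerBr. Qed.

Lemma small_twist (hq : odd #|F|) j u : small u -> small (fun k => twist j (u k)).
Proof.
(* Multiplication by q^j raises nonnegative orders only, hence the maximum with 0. *)
move=> hu c; have [N hN] := hu (Num.max c 0); exists N => k /hN.
move/(mge_twist j); apply: mge_le.
have [|] := leP c 0; last by have := qrealX_ge1 R hq j; nra.
by rewrite mulr0.
Qed.

Lemma vcvg_twist (hq : odd #|F|) j u l : vcvg u l -> vcvg (fun k => twist j (u k)) (twist j l).
Proof. by move/(small_twist hq j); apply: eq_small => k; rewrite twistB. Qed.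

Lemma vcvgP u l : vcvg u l <-> val_cvg (@mxord F R C m n) u l.
Proof.
split=> h c.
  have [N hN] := h (c + 1); exists N => k /hN hk.
  by apply/lt_mxordP; exists (c + 1) => //; lra.
have [N hN] := h c; exists N => k /hN/lt_mxordP[r cr].
by apply: mge_le; lra.
Qed.

(** By the ultrametric inequality, null terms make the partial sums a Cauchy sequence; completeness
    of C is applied entry by entry. *)
Lemma small_cvg u : small u -> exists l, vcvg (fun k => \sum_(i < k) u i) l.
Proof.
move=> hu.
have hd c : exists N, forall i j, (N <= i)%N -> (i <= j)%N ->
    mge c (\sum_(k < j) u k - \sum_(k < i) u k).
  have [N hN] := hu c; exists N => i j hi ij.
  rewrite -!(big_mkord predT u) (big_cat_nat (leq0n i) ij) /=.
  rewrite addrAC subrr add0r big_nat_cond; apply: mge_sum => k /andP[/andP[ik _] _].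
  by apply: hN; apply: leq_trans ik.
have /choice[l hl] (p : 'I_m * 'I_n) : exists l : C,
    val_cvg (@ord F R C) (fun k => (\sum_(i < k) u i) p.1 p.2) l.
  apply: cinf_complete => c; have [N hN] := hd (c + 1); exists N => i j hi hj.
  apply: (@lt_le_trans _ _ (c + 1)%:E); first by rewrite lte_fin; lra.
  have [ij|/ltnW ji] := leqP i j.
    by have := mgeBC (hN i j hi ij) p.1 p.2; rewrite !mxE.
  by have := hN j i hj ji p.1 p.2; rewrite !mxE.
exists (\matrix_(i, j) l (i, j)) => c; have [N hN] := hd c; exists N => k hk i j.
have [N' hN'] := hl (i, j) c.
have /hN' := leq_maxr k N'; have /(hN _ _ hk) := leq_maxl k N'.
move=> /mgeBC/(_ i j) h1 /ltW h2.
rewrite !mxE -(subrKA ((\sum_(i < maxn k N') u i) i j)); apply: ogeD => //.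
by move: h1; rewrite !mxE.
Qed.

Lemma msumP u : small u -> vcvg (fun k => \sum_(i < k) u i) (msum u).
Proof. by move/small_cvg => h; apply: (xgetPex 0 h). Qed.

Lemma msum_eq u l : vcvg (fun k => \sum_(i < k) u i) l -> msum u = l.
Proof. by move=> h; apply: xget_unique => // y hy; apply: vcvg_unique hy h. Qed.

Lemma msumD u v : small u -> small v -> msum (fun k => u k + v k) = msum u + msum v.
Proof.
move=> /msumP hu /msumP hv; apply: msum_eq; apply: eq_vcvg (vcvgD hu hv) => k.
by rewrite big_split.
Qed.

Lemma msum_ge u c : small u -> (forall k, mge c (u k)) -> mge c (msum u).
Proof.
by move=> /msumP hu h; apply: (vcvg_ge (N := 0) hu) => k _; apply: mge_sum.
Qed.

Lemma msum_recl u : small u -> msum u = u 0%N + msum (fun k => u k.+1).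
Proof.
move=> hu; apply: msum_eq; apply/(vcvg_shift 1).
have hu' : small (fun k => u k.+1).
  by apply: eq_small ((small_shift 1 u).2 hu) => k; rewrite addn1.
apply: eq_vcvg (vcvgD (vcvg_const (u 0%N)) (msumP hu')) => k.
by rewrite addn1 big_ord_recl; congr (_ + _); apply: eq_bigr.
Qed.

Lemma eq_msum u v : u =1 v -> msum u = msum v.
Proof. by move=> /funext ->. Qed.

End Basics.

Lemma msum_mul m n p p' (a : 'M[C]_(p, m)) (b : 'M[C]_(n, p')) u :
  small u -> msum (fun k => a *m u k *m b) = a *m msum u *m b.
Proof.
move=> /msumP/(vcvg_mul a b) hu; apply: msum_eq; apply: eq_vcvg hu => k.
by rewrite mulmx_sumr mulmx_suml.
Qed.

End Limits.

(** * The exponential of M(A) *)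

Section Exponential.
Context (F : finFieldType) (R : realType) (C : cinf F R).
Hypothesis (hq : odd #|F|).
Local Notation q := (q_of F).
Local Notation Q := (qreal F R).
Local Notation rho := (tors_val F R).
Local Notation theta := (theta C).
Implicit Types (c r s x : R).

(* The shortest periods have order - per_val = - q^2 / (q^2 - 1). *)
Definition per_val : R := 1 + rho.
Local Notation xi := per_val.

Lemma ord_thetad k : ord (thetad C k.+1 0) = (- Q ^+ k.+1)%:E.
Proof.
have e : ord (theta ^+ (q ^ k.+1)) = (- Q ^+ k.+1)%:E.
  by rewrite (ordX _ (ord_theta C)) natr_qk mulrN1.
apply: (ord_near e (s := -1)).
  by have := qrealX_ge R hq (ltn0Sn k); have := qreal_ge3 R hq; lra.
rewrite /thetad expn0 expr1 addrAC subrr add0r ogeN.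
by apply: oge_ord; rewrite ord_theta.
Qed.

Lemma thetad_neq0 k : thetad C k.+1 0 != 0.
Proof. exact: ord_neq0 (ord_thetad k). Qed.

Section Coef.
Context (n : nat).
Implicit Types (A : 'M[C]_n).

Lemma expcoef1 A : expcoef A 1 = (thetad C 1 0)^-1 *: A.
Proof. by rewrite /= addr0 twist1 mulmx1. Qed.

Lemma expcoefSS A k : expcoef A k.+2 =
  (thetad C k.+2 0)^-1 *: (A *m twist 1 (expcoef A k.+1) + twist 2 (expcoef A k)).
Proof. by []. Qed.

(** Dividing by theta_(k,0) gains q^k, and C_(k-2)^(2) has collected this gain once every two
    indices, whence q^k times k/2 rounded up. The recursion has order two, so the induction carries
    two consecutive indices. *)
Lemma expcoef_ge A k : mge 0 A -> mge (Q ^+ k * (uphalf k)%:R) (expcoef A k).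
Proof.
move=> hA; have Q3 := qreal_ge3 R hq.
suff [] : mge (Q ^+ k * (uphalf k)%:R) (expcoef A k) /\
          mge (Q ^+ k.+1 * (uphalf k.+1)%:R) (expcoef A k.+1) by [].
elim: k => [|k [IH0 IH1]].
  split; first by rewrite mulr0; apply: mge1.
  rewrite expcoef1; apply: mge_le (mgeZ_div (ord_thetad 0) hA).
  by rewrite mulr1; lra.
split=> //; rewrite expcoefSS.
have e : (uphalf k.+2)%:R = (uphalf k)%:R + 1 :> R by rewrite natr1.
have le : (uphalf k)%:R <= (uphalf k.+1)%:R :> R by rewrite ler_nat; lia.
have Qk : 0 < Q ^+ k by rewrite exprn_gt0 //; lra.
have bnd : mge (Q ^+ k.+2 * (uphalf k)%:R)
    (A *m twist 1 (expcoef A k.+1) + twist 2 (expcoef A k)).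
  apply: mgeD; last first.
    by apply: mge_le (mge_twist 2 IH0); rewrite mulrA -exprD.
  apply: mge_le (mge_mul hA (mge_twist 1 IH1)).
  by rewrite add0r mulrA -exprD ler_pM2l // exprn_gt0 //; lra.
apply: mge_le (mgeZ_div (ord_thetad _) bnd).
by rewrite e mulrDr mulr1 opprK.
Qed.

(** The summand h is kept intact, outside the factor q^k, so that the bound is linear in A1 - A2.
    For k >= 2 the factor 1 + k/2, rounded down, is at least 2 > xi, and these terms keep order h
    even at ord X = - xi. *)
Lemma expcoef_diff_ge A1 A2 h k : 0 <= h -> mge 0 A1 -> mge 0 A2 -> mge h (A1 - A2) ->
  mge (h + Q ^+ k * (1 + k./2%:R)) (expcoef A1 k - expcoef A2 k).
Proof.
move=> h0 hA1 hA2 hA; have Q3 := qreal_ge3 R hq.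
pose D k := expcoef A1 k - expcoef A2 k; rewrite -/(D k).
suff [] : mge (h + Q ^+ k * (1 + k./2%:R)) (D k) /\
          mge (h + Q ^+ k.+1 * (1 + k.+1./2%:R)) (D k.+1) by [].
elim: k => [|k [IH0 IH1]].
  split; first by rewrite /D subrr; apply: mge0.
  rewrite /D !expcoef1 -scalerBr; apply: mge_le (mgeZ_div (ord_thetad 0) hA).
  by rewrite /= expr1; lra.
split=> //.
have Qk := qrealX_ge1 R hq k.
have e : D k.+2 = (thetad C k.+2 0)^-1 *: ((A1 - A2) *m twist 1 (expcoef A1 k.+1)
    + A2 *m twist 1 (D k.+1) + twist 2 (D k)).
  rewrite /D !expcoefSS -scalerBr !twistB mulmxBl mulmxBr; congr (_ *: _).
  by rewrite subrKA opprD addrACA.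
have e' : k.+2./2%:R = k./2%:R + 1 :> R by rewrite natr1.
have le : k./2%:R <= k.+1./2%:R :> R by rewrite ler_nat; lia.
have k0 : 0 <= k./2%:R :> R by [].
have eu : (uphalf k.+1)%:R = 1 + k./2%:R :> R by rewrite /= -natr1 addrC.
have bnd : mge (h + Q ^+ k.+2 * (1 + k./2%:R)) ((A1 - A2) *m twist 1 (expcoef A1 k.+1)
    + A2 *m twist 1 (D k.+1) + twist 2 (D k)).
  apply: mgeD; first apply: mgeD.
  - apply: mge_le (mge_mul hA (mge_twist 1 (expcoef_ge k.+1 hA1))).
    by rewrite mulrA -exprD eu.
  - apply: mge_le (mge_mul hA2 (mge_twist 1 IH1)).
    rewrite add0r [leRHS]mulrDr [X in _ <= _ + X]mulrA -exprD; apply: lerD.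
      by rewrite expr1; nra.
    by rewrite ler_pM2l ?exprn_gt0; lra.
  - apply: mge_le (mge_twist 2 IH0).
    rewrite [leRHS]mulrDr [X in _ <= _ + X]mulrA -exprD; apply: lerD => //.
    by have := qrealX_ge1 R hq 2; nra.
rewrite e; apply: mge_le (mgeZ_div (ord_thetad _) bnd).
by rewrite e' opprK; lra.
Qed.

End Coef.

Lemma geometric_unbounded x c : exists N : nat, forall k : nat, (N <= k)%N ->
  c <= Q ^+ k * ((uphalf k)%:R + x).
Proof.
have [N hN] := nat_unbounded (2 * (`|c| + `|x|)); exists N => k /hN h.
have hu : k%:R <= 2 * (uphalf k)%:R :> R by rewrite -natrM ler_nat; lia.
have := ler_norm c; have := ler_norm (- x); rewrite normrN => h1 h2.
have h3 : `|c| <= (uphalf k)%:R + x by lra.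
have := qrealX_ge1 R hq k; have := normr_ge0 c; nra.
Qed.

Section Exp.
Context (n : nat).
Implicit Types (A : 'M[C]_n).

(** Everything is defined on n x p matrices, column by column, so that a whole matrix of periods is
    treated at once. *)
Definition expterm A p (X : 'M[C]_(n, p)) k := expcoef A k *m twist k X.

Definition Exp A p (X : 'M[C]_(n, p)) := msum (expterm A X).

Definition actTmx A p (Y : 'M[C]_(n, p)) := theta *: Y + A *m twist 1 Y + twist 2 Y.

Lemma expterm_ge A p (X : 'M[C]_(n, p)) x k : mge 0 A -> mge x X ->
  mge (Q ^+ k * ((uphalf k)%:R + x)) (expterm A X k).
Proof.
by move=> hA hX; rewrite mulrDr; apply: mge_mul (expcoef_ge k hA) (mge_twist k hX).
Qed.

Lemma exptermZ A p (X : 'M[C]_(n, p)) (a : C) k :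
  expterm A (a *: X) k = a ^+ (q ^ k) *: expterm A X k.
Proof. by rewrite /expterm twistZ scalemxAr. Qed.

Lemma expterm_theta1 A p (X : 'M[C]_(n, p)) :
  expterm A (theta *: X) 1 = theta *: expterm A X 1 + A *m twist 1 (expterm A X 0).
Proof.
apply/eqP; rewrite exptermZ addrC -subr_eq -scalerBl; apply/eqP.
have -> : theta ^+ (q ^ 1) - theta = thetad C 1 0 by rewrite /thetad expn0 expr1.
rewrite /expterm expcoef1 scalemxAl scalerA divff ?thetad_neq0 // scale1r.
by rewrite /= mul1mx twist_0.
Qed.

Lemma expterm_thetaSS A p (X : 'M[C]_(n, p)) k :
  expterm A (theta *: X) k.+2 = theta *: expterm A X k.+2
    + A *m twist 1 (expterm A X k.+1) + twist 2 (expterm A X k).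
Proof.
apply/eqP; rewrite exptermZ -addrA addrC -subr_eq -scalerBl; apply/eqP.
have -> : theta ^+ (q ^ k.+2) - theta = thetad C k.+2 0.
  by rewrite /thetad expn0 expr1.
rewrite /expterm expcoefSS scalemxAl scalerA divff ?thetad_neq0 // scale1r.
by rewrite mulmxDl !twistM !twist_twist mulmxA.
Qed.

Section FixA.
Context (A : 'M[C]_n) (hA : mge 0 A) (p : nat).
Implicit Types (X Y Z : 'M[C]_(n, p)).

Lemma small_expterm X : small (expterm A X).
Proof.
have [x hx] := mge_ex X => c; have [N hN] := geometric_unbounded x c.
by exists N => k /hN h; apply: mge_le h (expterm_ge k hA hx).
Qed.

Lemma ExpP X : vcvg (fun k => \sum_(i < k) expterm A X i) (Exp A X).
Proof. by apply: msumP; apply: small_expterm. Qed.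

Lemma Exp_unique X Y : vcvg (fun k => \sum_(i < k) expterm A X i) Y -> Exp A X = Y.
Proof. exact: msum_eq. Qed.

Lemma ExpD X Y : Exp A (X + Y) = Exp A X + Exp A Y.
Proof.
rewrite /Exp -msumD; try exact: small_expterm.
by apply: eq_msum => k; rewrite /expterm twistD mulmxDr.
Qed.

Lemma Exp0 : Exp A (0 : 'M_(n, p)) = 0.
Proof. by apply: (addIr (Exp A (0 : 'M_(n, p)))); rewrite -ExpD !add0r. Qed.

Lemma ExpN X : Exp A (- X) = - Exp A X.
Proof. by apply: (addIr (Exp A X)); rewrite -ExpD !addNr Exp0. Qed.

Lemma ExpB X Y : Exp A (X - Y) = Exp A X - Exp A Y.
Proof. by rewrite ExpD ExpN. Qed.

Lemma Exp_mulF p' X (B : 'M[F]_(p, p')) :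
  Exp A (X *m map_mx (const C) B) = Exp A X *m map_mx (const C) B.
Proof.
rewrite /Exp -[RHS]mul1mx mulmxA -msum_mul; last exact: small_expterm.
by apply: eq_msum => k; rewrite /expterm twistM twist_const mulmxA mul1mx.
Qed.

Lemma Exp_theta X : Exp A (theta *: X) = actTmx A (Exp A X).
Proof.
pose S X k := \sum_(i < k) expterm A X i.
(* The partial sums have lengths k + 2, k + 1 and k, because tau and tau^2 shift the index; with
   these lengths the identity is exact at every k. *)
have hS X' j : vcvg (fun k => S X' (k + j)%N) (Exp A X') by apply/vcvg_shift/ExpP.
apply: vcvg_unique (hS (theta *: X) 2) _.
have h1 := vcvgZ theta (hS X 2).
have h2 := vcvg_mul A 1%:M (vcvg_twist hq 1 (hS X 1%N)).
have h3 := vcvg_twist hq 2 (hS X 0%N).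
move: (vcvgD (vcvgD h1 h2) h3); rewrite mulmx1 -/(actTmx _ _); apply: eq_vcvg => k.
rewrite mulmx1 addn1 addn0 addn2; elim: k => [|k IH].
  rewrite /S !big_ord_recl !big_ord0 /= !addr0 twist0 addr0.
  by rewrite expterm_theta1 exptermZ expn0 expr1 scalerDr addrA.
have E Y j : S Y j.+1 = S Y j + expterm A Y j by rewrite /S big_ord_recr.
have e0 : theta *: S X k.+3 = theta *: S X k.+2 + theta *: expterm A X k.+2.
  by rewrite E scalerDr.
have e1 : A *m twist 1 (S X k.+2) =
    A *m twist 1 (S X k.+1) + A *m twist 1 (expterm A X k.+1).
  by rewrite E twistD mulmxDr.
have e2 : twist 2 (S X k.+1) = twist 2 (S X k) + twist 2 (expterm A X k).
  by rewrite E twistD.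
rewrite e0 e1 e2 (E (theta *: X)) -IH expterm_thetaSS.
by rewrite [X in X + _ = _]addrACA [LHS]addrACA.
Qed.

(** The term of index 2 fixes the radius: its order is at least q^2 (1 + x) = q^2 (x + xi) - xi,
    hence at least x + (x + xi), with equality at x = - xi. The boundary value is allowed because
    the shortest periods lie there. *)
Lemma Exp_iso X x : - xi <= x -> mge x X -> mge (x + (x + xi)) (Exp A X - X).
Proof.
move=> xx hX; rewrite /Exp msum_recl; last exact: small_expterm.
have -> : expterm A X 0 = X by rewrite /expterm twist_0 mul1mx.
rewrite [X in mge _ X]addrC addKr; apply: msum_ge.
  apply: eq_small ((small_shift 1 (expterm A X)).2 (small_expterm X)) => k.
  by rewrite addn1.
move=> k; apply: mge_le (expterm_ge k.+1 hA hX).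
have Q3 := qreal_ge3 R hq; have h1 := qreal_rho R hq; have h2 := qrho_le R hq.
have h3 := rho_le R hq; rewrite /xi in xx *.
case: k => [|[|k]]; first by rewrite expr1 /=; nra.
  have h4 : 0 <= (Q ^+ 2 - 2) * (x + (1 + rho)) by rewrite mulr_ge0 //; [nra|lra].
  by rewrite /=; nra.
set u := (uphalf k.+3)%:R.
have hu : 2 <= u by rewrite /u ler_nat /=; lia.
have h4 : 0 <= (Q ^+ 2 - 2) * (x + (1 + rho)) by rewrite mulr_ge0 //; [nra|lra].
have h5 : 0 <= (Q ^+ k.+3 - Q ^+ 2) * (u + x).
  by rewrite mulr_ge0 // ?subr_ge0 ?qrealX_ge2 //; lra.
have h6 : 0 <= Q ^+ 2 * (u - 1) by rewrite mulr_ge0 //; nra.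
nra.
Qed.

Lemma Exp_ge X x : - xi <= x -> mge x X -> mge x (Exp A X).
Proof.
move=> xx hX; apply: (mge_near (B := X)) => //.
by apply: mge_le (Exp_iso xx hX); lra.
Qed.

Lemma Exp_inj X x : - xi < x -> mge x X -> Exp A X = 0 -> X = 0.
Proof.
move=> xx hX e; apply/eqP/negPn/negP => /mge_attained[r [i [j [hr erij]]]].
have rx : x <= r by apply: ord_oge erij (hX i j).
have := Exp_iso (ltW (lt_le_trans xx rx)) hr; rewrite e sub0r => /mgeN/(_ i j).
by move/(ord_oge erij); lra.
Qed.

Lemma vcvg_Exp (u : nat -> 'M[C]_(n, p)) l :
  vcvg u l -> vcvg (fun k => Exp A (u k)) (Exp A l).
Proof.
move=> h c; have [N hN] := h (Num.max c 0); exists N => k /hN.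
rewrite -ExpB => /(Exp_ge _) hE; apply: mge_le (hE _); first by rewrite le_max lexx.
have := rho_gt0 R hq; rewrite /xi => r0.
by apply: le_trans (_ : 0 <= _); [lra|rewrite le_max lexx orbT].
Qed.

(** The residuals r_(k+1) = r_k - Exp_A r_k gain z + xi at each step. Their sum is the solution,
    since Exp_A of the k-th partial sum is Z - r_k. *)
Lemma Exp_solve Z z : - xi < z -> mge z Z -> exists2 X, mge z X & Exp A X = Z.
Proof.
move=> zz hZ; pose r k := iter k (fun Z => Z - Exp A Z) Z.
have hr k : mge (z + k%:R * (z + xi)) (r k).
  elim: k => [|k IH]; first by rewrite mul0r addr0.
  have k0 : 0 <= k%:R * (z + xi) by rewrite mulr_ge0 //; lra.
  rewrite /r iterS -/(r k); apply/mgeBC.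
  by apply: mge_le (Exp_iso _ IH); rewrite -?natr1; lra.
have hs : small r.
  move=> c; have [N hN] := nat_unbounded ((c - z) / (z + xi)).
  exists N => k /hN h; apply: mge_le (hr k).
  by move: h; rewrite ler_pdivrMr; lra.
exists (msum r).
  apply: msum_ge => // k; apply: mge_le (hr k).
  by rewrite lerDl mulr_ge0 //; lra.
apply: vcvg_unique (vcvg_Exp (msumP hs)) _.
move=> c; have [N hN] := hs c; exists N => k /hN.
rewrite -mgeN; congr mge; elim: k => [|k IH].
  by rewrite big_ord0 Exp0 sub0r.
have -> : r k.+1 = r k - Exp A (r k) by [].
by rewrite big_ord_recr ExpD addrAC -IH opprB addrC.
Qed.

End FixA.

(** Linearization in A: the terms of index 0 cancel, those of index 1 give exactly the subtracted
    expression, and the rest has order h on the whole closed ball ord X >= - xi. *)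
Lemma Exp_diff A1 A2 p (X : 'M[C]_(n, p)) h : 0 <= h -> mge 0 A1 -> mge 0 A2 ->
  mge h (A1 - A2) -> mge (- xi) X ->
  mge h (Exp A1 X - Exp A2 X - (thetad C 1 0)^-1 *: ((A1 - A2) *m twist 1 X)).
Proof.
move=> h0 hA1 hA2 hA hX.
pose d k := expterm A1 X k - expterm A2 X k.
have d0 : d 0%N = 0 by rewrite /d subrr.
have d1 : d 1%N = (thetad C 1 0)^-1 *: ((A1 - A2) *m twist 1 X).
  by rewrite /d /expterm !expcoef1 -mulmxBl -scalerBr scalemxAl.
have dS k : \sum_(i < k.+2) d i - d 1%N = \sum_(i < k) d i.+2.
  by rewrite 2!big_ord_recl d0 add0r addrC addKr; apply: eq_bigr.
have := vcvgD (vcvgD (ExpP hA1 X) (vcvgN (ExpP hA2 X))) (vcvg_const (- d 1%N)).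
rewrite -d1 => /(vcvg_ge (N := 2)); apply=> -[|[|k]] // _.
rewrite -sumrB dS; apply: mge_sum => i _.
rewrite /d /expterm -mulmxBl.
apply: mge_le (mge_mul (expcoef_diff_ge _ h0 hA1 hA2 hA) (mge_twist _ hX)).
rewrite -addrA lerDl -mulrDr; apply: mulr_ge0.
  by apply: le_trans (qrealX_ge1 R hq _).
have := rho_le R hq; rewrite /xi /= => h1.
have : (1 <= i./2.+1%:R :> R) by rewrite (ler_nat R 1).
by lra.
Qed.

Lemma Exp_eqP A (X Y : 'cV[C]_n) : mge 0 A -> Exp_eq A X Y <-> Exp A X = Y.
Proof.
move=> hA; rewrite /Exp_eq -vcvgP; split=> [/Exp_unique //|<-].
exact: ExpP.
Qed.
End Exp.
End Exponential.

(** * Surjectivity of Exp_A, and the scalar exponential for A = 0 *)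

Section Zeros.
Context (F : finFieldType) (R : realType) (C : cinf F R).
Hypothesis (hq : odd #|F|).
Local Notation q := (q_of F).
Local Notation Q := (qreal F R).
Local Notation rho := (tors_val F R).
Local Notation xi := (per_val F R).
Local Notation theta := (theta C).
Implicit Types (c r s h : R).

Lemma closed_root_size (p : {poly C}) : (1 < size p)%N -> exists x, p.[x] = 0.
Proof.
move=> hp; have /closed_rootP[x /rootP hx] : size p != 1%N by lia.
by exists x.
Qed.

Lemma q2_gt1 : (1 < q ^ 2)%N.
Proof. by have := q_ge3 hq; rewrite expnS expn1; nia. Qed.

(** Newton polygon: if ord y < r / q^2 <= - rho, then y^(q^2) dominates theta y, and z would have
    order q^2 ord y < r. *)
Lemma torsion_root_ge (z : C) r : oge r z -> r <= - xi ->
  exists2 y, oge (r / Q ^+ 2) y & y ^+ (q ^ 2) + theta * y = z.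
Proof.
move=> hz hr; have q2 := q2_gt1.
have [|y hy] := @closed_root_size ('X^(q ^ 2) + (theta *: 'X - z%:P)).
  have h2 : (size (theta *: 'X - z%:P)%R <= 2)%N.
    rewrite (leq_trans (size_polyD _ _)) // geq_max size_polyN.
    rewrite (leq_trans (size_scale_leq _ _)) ?size_polyX //=.
    by rewrite (leq_trans (size_polyC_leq1 _)).
  by rewrite size_polyDl size_polyXn; lia.
have {}hy : y ^+ (q ^ 2) + theta * y = z.
  by apply/eqP; rewrite -subr_eq0; apply/eqP; rewrite -hy !hornerE.
exists y => //.
have [->|[s es _]] := oge_cases y; first exact: oge0.
have Q3 := qreal_ge3 R hq; have eQ := qreal_rho R hq; have r0 := rho_gt0 R hq.
have Q2 : 9 <= Q ^+ 2 by nra.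
apply: oge_le (oge_ord es); rewrite ler_pdivrMr; last by lra.
rewrite leNgt; apply/negP => lt.
have e1 : ord (y ^+ (q ^ 2)) = (Q ^+ 2 * s)%:E by rewrite (ordX _ es) natr_qk.
have e2 : oge (s - 1) (theta * y).
  by apply: oge_le (ogeM (oge_ord (ord_theta C)) (oge_ord es)); lra.
have e3 : Q ^+ 2 * s < s - 1.
  have hs : s < - rho.
    by rewrite -(ltr_pM2r (x := Q ^+ 2)); rewrite /per_val in hr; lra.
  have : 0 < (Q ^+ 2 - 1) * (- rho - s) by rewrite mulr_gt0 //; lra.
  by lra.
have e4 : ord z = (Q ^+ 2 * s)%:E.
  by apply: ord_near e1 e3 _; rewrite -hy addrAC subrr add0r.
by have := ord_oge e4 hz; lra.
Qed.

(* If T_0 Y = Z, then Z = T_A Y - A Y^(1), where Y and A Y^(1) are both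
   strictly closer to 0 than Z: induction on the size of Z. *)
Lemma Exp_surj n (A : 'M[C]_n) p (Z : 'M[C]_(n, p)) : mge 0 A -> exists X, Exp A X = Z.
Proof.
move=> hA; have Q3 := qreal_ge3 R hq; have r0 := rho_gt0 R hq; have r1 := rho_le R hq.
suff H N : forall Z : 'M[C]_(n, p), mge (- N.+1%:R) Z -> exists X, Exp A X = Z.
  have [r hr] := mge_ex Z; have [N hN] := nat_unbounded (- r).
  by apply: (H N); apply: mge_le hr; have := hN N.+1 (leqnSn N); lra.
elim: N => [|N IH] {}Z hZ.
  (* Order - 1 is inside the isometry ball, because xi > 1. *)
  by have [|X _ hX] := Exp_solve hq hA _ hZ; [rewrite /per_val; lra|exists X].
have N1 : 1 <= N.+1%:R :> R by rewrite (ler_nat R 1).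
set r : R := - N.+2%:R in hZ.
have er : r = - N.+1%:R - 1 by rewrite /r -[in LHS]natr1; lra.
have hr : r <= - xi by rewrite /per_val; lra.
have /choice[g hg] (ij : 'I_n * 'I_p) :
    exists y, oge (r / Q ^+ 2) y /\ y ^+ (q ^ 2) + theta * y = Z ij.1 ij.2.
  by have [y h1 h2] := torsion_root_ge (hZ ij.1 ij.2) hr; exists y.
pose Y := \matrix_(i, j) g (i, j).
have hY : mge (r / Q ^+ 2) Y by move=> i j; rewrite mxE; case: (hg (i, j)).
have eZ : Z = actTmx A Y - A *m twist 1 Y.
  rewrite /actTmx addrAC addrK.
  apply/matrixP=> i j; rewrite !mxE.
  by have [_ <-] := hg (i, j); rewrite addrC.
have [X1 e1] : exists X, Exp A X = Y.
  apply: IH; apply: mge_le hY; have Q2 : 9 <= Q ^+ 2 by nra.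
  by rewrite er ler_pdivlMr; nra.
have [X2 e2] : exists X, Exp A X = A *m twist 1 Y.
  apply: IH; apply: mge_le (mge_mul hA (mge_twist 1 hY)).
  have Q0 : Q != 0 by apply: lt0r_neq0; lra.
  have -> : 0 + Q ^+ 1 * (r / Q ^+ 2) = r / Q by field.
  by rewrite er ler_pdivlMr; nra.
by exists (theta *: X1 - X2); rewrite (ExpB hq) // (Exp_theta hq) // e1 e2 -eZ.
Qed.

Lemma small_entry m n (u : nat -> 'M[C]_(m, n)) :
  (forall i j c, exists N, forall k, (N <= k)%N -> oge c (u k i j)) -> small u.
Proof.
move=> h c; have /choice[N hN] (p : 'I_m * 'I_n) :
    exists N, forall k, (N <= k)%N -> oge c (u k p.1 p.2) by apply: h.
exists (\max_p N p)%N => k hk i j; apply: (hN (i, j)).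
by apply: leq_trans hk; apply: leq_bigmax.
Qed.

(** For A = 0 all C_k are scalar matrices, and they vanish for odd k, so that Exp_0 reduces to the
    one-variable series [exp1]. *)
Definition ecoef k : C := expcoef (0 : 'M[C]_1) k 0 0.

Lemma expcoef0 n k : expcoef (0 : 'M[C]_n) k = (ecoef k)%:M.
Proof.
have H m : expcoef (0 : 'M[C]_m) 0 = 1%:M /\ expcoef (0 : 'M[C]_m) 1 = 0.
  by rewrite expcoef1 scaler0.
have HS m j : expcoef (0 : 'M[C]_m) j.+2 = (thetad C j.+2 0)^-1 *: twist 2 (expcoef 0 j).
  by rewrite expcoefSS mul0mx add0r.
suff [] : expcoef (0 : 'M[C]_n) k = (ecoef k)%:M /\
          expcoef (0 : 'M[C]_n) k.+1 = (ecoef k.+1)%:M by [].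
elim: k => [|k [IH IH1]].
  by rewrite /ecoef !(H n).1 !(H n).2 !(H 1%N).1 !(H 1%N).2 !mxE eqxx raddf0.
split=> //; rewrite HS IH twist_scalar /ecoef HS !mxE.
by rewrite scale_scalar_mx.
Qed.

Lemma ecoef0 : ecoef 0 = 1. Proof. by rewrite /ecoef mxE. Qed.
Lemma ecoef1 : ecoef 1 = 0. Proof. by rewrite /ecoef expcoef1 scaler0 mxE. Qed.
Lemma ecoefSS k : ecoef k.+2 = (thetad C k.+2 0)^-1 * ecoef k ^+ (q ^ 2).
Proof. by rewrite /ecoef expcoefSS mul0mx add0r !mxE. Qed.

Lemma ecoef_odd k : ecoef k.*2.+1 = 0.
Proof.
elim: k => [|k IH]; first exact: ecoef1.
by rewrite doubleS ecoefSS IH expr0n expn_eq0; have := q_ge3 hq; case: q => // *; rewrite mulr0.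
Qed.

Lemma thetad_frob k i j : thetad C i j ^+ (q ^ k) = thetad C (i + k) (j + k).
Proof. by rewrite /thetad -frobE rmorphB /= /frob -!exprM -!expnD. Qed.

Lemma ecoef_even k : ecoef k.*2 = (\prod_(j < k) thetad C (2 * k) (2 * j))^-1.
Proof.
elim: k => [|k IH]; first by rewrite big_ord0 invr1 ecoef0.
rewrite doubleS ecoefSS IH -frobE fmorphV rmorph_prod -invfM; congr (_^-1).
rewrite big_ord_recl; congr (_ * _); first by rewrite mul2n doubleS muln0.
apply: eq_bigr => i _; rewrite [LHS]thetad_frob; congr thetad; last by rewrite /= /bump; lia.
by lia.
Qed.

Definition exp1 (x : C) : C := Exp (0 : 'M[C]_1) x%:M 0 0.

Lemma Exp_scalar0 (x : C) : Exp (0 : 'M[C]_1) x%:M = (exp1 x)%:M.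
Proof. exact: mx11_scalar. Qed.

Let Z1 : mge 0 (0 : 'M[C]_1). Proof. exact: mge0. Qed.

Lemma Exp_0 n p (X : 'M[C]_(n, p)) : Exp 0 X = map_mx exp1 X.
Proof.
apply: Exp_unique; apply: small_entry => i j c.
have [N hN] := ExpP hq Z1 (X i j)%:M c.
exists N => k /hN/(_ 0 0); rewrite !mxE !summxE; congr oge; congr (_ - _).
apply: eq_bigr => l _; rewrite /expterm !expcoef0 !mul_scalar_mx !mxE.
by rewrite eqxx mulr1n.
Qed.

Lemma root_seriesP (z : C) : root_series z <-> exp1 z = 0.
Proof.
pose u k : 'M[C]_1 := (\sum_(i < k) z ^+ (q ^ (2 * i)) /
   \prod_(j < i) thetad C (2 * i) (2 * j))%:M.
have hu : vcvg u (exp1 z)%:M.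
  rewrite -Exp_scalar0 => c.
  have [N hN] := ExpP hq Z1 z%:M c.
  (* Since the odd coefficients vanish, k terms of the given series are 2k terms of the
     exponential. *)
  exists N => k hk; have := hN k.*2; rewrite -addnn => /(_ (leq_trans hk (leq_addr _ _))).
  congr (mge _ (_ - _)); rewrite addnn {hk} /u; elim: k => [|k IH].
    by rewrite !big_ord0 raddf0.
  rewrite doubleS !big_ord_recr /= IH raddfD /= -addrA; congr (_ + _).
  rewrite /expterm !expcoef0 ecoef_odd ecoef_even mul_scalar_mx raddf0 mul0mx addr0.
  by rewrite twist_scalar scale_scalar_mx mulrC mul2n.
have h0 : root_series z <-> vcvg u 0.
  split=> h c.
    have [N hN] := h c; exists N => k /hN; rewrite subr0 => hk i j.
    by rewrite /u !ord1 !mxE eqxx mulr1n subr0; apply: ltW.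
  have [N hN] := h (c + 1); exists N => k /hN/(_ 0 0); rewrite !mxE eqxx mulr1n !subr0.
  by apply: lt_le_trans; rewrite lte_fin; lra.
rewrite h0; split=> [/(vcvg_unique hu)/matrixP/(_ 0 0)|e]; first by rewrite !mxE.
by move: hu; rewrite e raddf0.
Qed.

Lemma exp1_theta (x : C) : exp1 (theta * x) = theta * exp1 x + exp1 x ^+ (q ^ 2).
Proof.
rewrite {1}/exp1 -scale_scalar_mx (Exp_theta hq) ?Exp_scalar0; last exact: mge0.
by rewrite /actTmx mul0mx addr0 !mxE eqxx mulr1n.
Qed.

Lemma exp1_inj x r : - xi < r -> oge r x -> exp1 x = 0 -> x = 0.
Proof.
move=> hr hx e; have := Exp_scalar0 x; rewrite e raddf0 => /(Exp_inj hq Z1 hr).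
move=> /(_ (mge_scalar hx))/matrixP/(_ 0 0).
by rewrite !mxE eqxx mulr1n.
Qed.

(** Injectivity on the open ball gives ord y <= - xi. For the converse a root is constructed: if
    y1^(q^2 - 1) = - theta and exp1 x = y1, then theta x is a nonzero root of order at least - xi,
    and y has the largest order. *)
Lemma ord_y0 (y : C) : is_y0 y -> ord y = (- xi)%:E /\ exp1 y = 0.
Proof.
move=> [y_neq0 /root_seriesP ey ymax]; split=> //.
have Q3 := qreal_ge3 R hq; have eQ := qreal_rho R hq; have r0 := rho_gt0 R hq.
have [s es] := ord_fine y_neq0.
have sle : s <= - xi.
  rewrite leNgt; apply/negP => lt; move/eqP: y_neq0; apply.
  exact: exp1_inj lt (oge_ord es) ey.
have q2 := q2_gt1.
have [|y1 hy1] := @closed_root_size ('X^((q ^ 2).-1) - (- theta)%:P).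
  by rewrite size_XnsubC; lia.
have {}hy1 : y1 ^+ (q ^ 2).-1 = - theta.
  by move: hy1; rewrite !hornerE => /eqP; rewrite addr_eq0 opprK => /eqP ->; rewrite ?opprK.
have y1_neq0 : y1 != 0.
  apply: contra_eq_neq hy1 => ->; rewrite expr0n gtn_eqF; last lia.
  by rewrite eq_sym oppr_eq0 (ord_neq0 (ord_theta C)).
have [t et] := ord_fine y1_neq0.
have et' : t = - rho.
  have := ordX (q ^ 2).-1 et; rewrite hy1 ordN ord_theta => -[].
  rewrite -subn1 natrB ?expn_gt0; last by have := q_ge3 hq; lia.
  rewrite natr_qk => h; have h' : (Q ^+ 2 - 1) * (t + rho) = 0 by lra.
  move/eqP: h'; rewrite mulf_eq0 => /orP[/eqP|/eqP]; last lra.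
  have Q2 : 9 <= Q ^+ 2 by nra.
  by lra.
have [|X hX eX] := Exp_solve hq Z1 _ (mge_scalar (oge_ord et)).
  by rewrite /per_val; lra.
rewrite (mx11_scalar X) in eX hX.
set x := X 0 0 in eX hX.
have ex : exp1 x = y1.
  by move: eX; rewrite Exp_scalar0 => /matrixP/(_ 0 0); rewrite !mxE eqxx !mulr1n.
have x_neq0 : x != 0.
  by apply: contra_neq y1_neq0 => x0; rewrite -ex x0 /exp1 raddf0 (Exp0 hq) ?mxE //; apply: mge0.
have := ymax (theta * x); rewrite mulf_neq0 ?(ord_neq0 (ord_theta C)) // => /(_ isT).
have e0 : exp1 (theta * x) = 0.
  rewrite exp1_theta ex -(prednK (ltnW q2)) exprSr hy1; ring.
move=> /(_ ((root_seriesP _).2 e0)); rewrite es => hle.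
have : oge (- xi) (theta * x).
  have := hX 0 0; rewrite mxE eqxx mulr1n => hx.
  apply: oge_le (ogeM (oge_ord (ord_theta C)) hx).
  by rewrite et' /per_val; lra.
move=> /le_trans/(_ hle); rewrite lee_fin => sge.
by congr EFin; apply/le_anti; rewrite sle sge.
Qed.

End Zeros.

(** * The constant omega *)

Section Omega.
Context (F : finFieldType) (R : realType) (C : cinf F R).
Hypothesis (hq : odd #|F|).
Local Notation q := (q_of F).
Local Notation Q := (qreal F R).
Local Notation rho := (tors_val F R).
Local Notation xi := (per_val F R).
Local Notation theta := (theta C).
Implicit Types (r s h : R).

Context (omega : C).
Hypotheses (homega : omega ^+ (#|F| ^ 2) = omega)
  (homegaF : forall a : F, const C a != omega)
  (homega2 : exists a : F, omega ^+ 2 = const C a).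

Lemma ord_q2 (x : C) : x != 0 -> x ^+ (q ^ 2) = x -> ord x = 0%E.
Proof.
move=> x0 hx; have q2 := q2_gt1 hq; apply: (@ord_root1 _ _ _ _ (q ^ 2).-1); first lia.
by apply: (mulfI x0); rewrite -exprS prednK ?mulr1 // ltnW.
Qed.

Lemma omega_neq0 : omega != 0.
Proof. by have := homegaF 0; rewrite rmorph0 eq_sym. Qed.

Lemma ord_omega : ord omega = 0%E.
Proof. by apply: ord_q2 => //; exact: omega_neq0. Qed.

(** As omega^2 lies in F, omega^q is omega or - omega; the first would make omega a root of X^q - X,
    all of whose roots are in F. *)
Lemma omega_frob : omega ^+ q = - omega.
Proof.
have [a ea] := homega2.
have : (omega ^+ q - omega) * (omega ^+ q + omega) = 0.
  rewrite -subr_sqr -exprM mulnC exprM ea -[q]expn1 const_frob subrr //.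
move/eqP; rewrite mulf_eq0 subr_eq0 addr_eq0 => /orP[/eqP h|/eqP //].
have := congr1 (fun p => (map_poly (const C) p).[omega]) (finField_genPoly F).
rewrite /= rmorphB /= map_polyXn map_polyX !hornerE -/q h subrr.
rewrite rmorph_prod horner_prod => /esym/eqP/prodf_eq0[x _].
rewrite rmorphB /= map_polyX map_polyC /= !hornerE subr_eq0 => /eqP e.
by have := homegaF x; rewrite e eqxx.
Qed.

Lemma omega_frob_even k : omega ^+ (q ^ k.*2) = omega.
Proof.
elim: k => [|k IH]; first by rewrite expr1.
by rewrite doubleS -addn2 expnD exprM IH homega.
Qed.

(** The field F_(q^2), realized inside C as F_q + omega F_q. *)
Definition cst2 (c d : F) : C := const C c + omega * const C d.

Lemma cst2_frob2 (c d : F) : cst2 c d ^+ (q ^ 2) = cst2 c d.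
Proof.
rewrite -frobE rmorphD rmorphM /= !/(frob _ _) !const_frob.
by rewrite (omega_frob_even 1).
Qed.

Lemma cst2_eq0 (c d : F) : cst2 c d = 0 -> c = 0 /\ d = 0.
Proof.
rewrite /cst2; have [->|d0 e] := eqVneq d 0.
  by rewrite rmorph0 mulr0 addr0 => /eqP; rewrite fmorph_eq0 => /eqP.
have := homegaF (- (c / d)); rewrite rmorphN fmorph_div.
have d0' : const C d != 0 by rewrite fmorph_eq0.
move/eqP => []; apply: (mulIf d0'); rewrite mulNr mulfVK //.
by apply/eqP; rewrite eq_sym -addr_eq0 addrC e.
Qed.

Lemma ord_cst2 (c d : F) : (c != 0) || (d != 0) -> ord (cst2 c d) = 0%E.
Proof.
move=> cd; apply: ord_q2; last exact: cst2_frob2.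
by apply: contraTneq cd => /cst2_eq0[-> ->]; rewrite eqxx.
Qed.

Lemma oge_cst2 (c d : F) : oge 0 (cst2 c d).
Proof.
have [/ord_cst2/oge_ord //|] := boolP ((c != 0) || (d != 0)).
rewrite negb_or !negbK => /andP[/eqP -> /eqP ->].
by rewrite /cst2 !rmorph0 mulr0 addr0; apply: oge0.
Qed.

Lemma genPoly_cst2 :
  'X^(q ^ 2) - 'X = \prod_(p : F * F) ('X - (cst2 p.1 p.2)%:P) :> {poly C}.
Proof.
pose rs := [seq cst2 p.1 p.2 | p <- enum ({: F * F})].
have hu : uniq rs.
  rewrite map_inj_uniq ?enum_uniq // => -[c d] [c' d'] /= e.
  have : cst2 (c - c') (d - d') = 0.
    apply/eqP; rewrite /cst2 !rmorphB mulrBr addrACA -opprD subr_eq0; apply/eqP.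
    exact: e.
  by case/cst2_eq0 => /eqP; rewrite subr_eq0 => /eqP -> /eqP; rewrite subr_eq0 => /eqP ->.
have hs : size rs = (q ^ 2)%N.
  by rewrite size_map -cardE card_prod -mulnn.
have hp : size ('X^(q ^ 2) - 'X : {poly C}) = (q ^ 2).+1.
  by rewrite size_polyDl size_polyXn // size_polyN size_polyX ltnS; exact: q2_gt1.
have hl : lead_coef ('X^(q ^ 2) - 'X : {poly C}) = 1.
  rewrite lead_coefDl ?lead_coefXn // size_polyN size_polyX size_polyXn ltnS.
  exact: q2_gt1.
rewrite [LHS](all_roots_prod_XsubC (rs := rs)) ?hs //.
- by rewrite hl scale1r big_map big_enum.
- apply/allP => x /mapP[p _ ->]; apply/rootP.
  by rewrite !hornerE cst2_frob2 subrr.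
- by rewrite uniq_rootsE.
Qed.

(** v^(q^2) - v is the product of v - e over the elements e of F_(q^2); if its order is positive, so
    is that of some factor. *)
Lemma near_cst2 (v : C) s : 0 < s -> oge s (v ^+ (q ^ 2) - v) ->
  exists c d, exists2 t, 0 < t & oge t (v - cst2 c d).
Proof.
move=> s0 hv; apply: contrapT => H.
have : exists2 r, r <= 0 & ord (v ^+ (q ^ 2) - v) = r%:E.
  have -> : v ^+ (q ^ 2) - v = ('X^(q ^ 2) - 'X : {poly C}).[v] by rewrite !hornerE.
  rewrite genPoly_cst2 horner_prod.
  elim/big_ind: _ => [|x y [r r0 er] [t t0 et]|[c d] _].
  - by exists 0; rewrite ?ord_one.
  - by exists (r + t); [lra|rewrite ordM er et].
  - rewrite !hornerE /=.
    have [e|/ord_fine[r er]] := eqVneq (v - cst2 c d) 0.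
      by case: H; exists c, d, 1 => //; rewrite e; apply: oge0.
    exists r => //; rewrite leNgt; apply/negP => r0.
    by case: H; exists c, d, r => //; apply: oge_ord.
by case=> r r0 /ord_oge/(_ hv); lra.
Qed.

(** This is where the characteristic must be odd: the derivative [kappa] and the determinant in
    [two_point_bound] both contain the factor 2. *)
Lemma ord_2 : ord (2 : C) = 0%E.
Proof.
have -> : 2 = const C 2 :> C by rewrite rmorph_nat.
apply: ord_const; have [p p_pr pF] := finPcharP F.
rewrite -(dvdn_pcharf pF) gtnNdvd //; have p2 := prime_gt1 p_pr.
rewrite ltn_neqAle p2 andbT; apply: contraTneq hq => p2'.
have [k hk] : exists k, #|F| = (p ^ k)%N by eexists; apply: (card_pprimeChar pF).
have := finNzRing_gt1 F; rewrite hk oddX -p2' orbF.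
by case: k {hk}.
Qed.

(** Only even powers of tau occur for A = 0, and these fix omega. *)
Lemma exp1_omega (x : C) : exp1 (omega * x) = omega * exp1 x.
Proof.
have Z1 : mge 0 (0 : 'M[C]_1) by apply: mge0.
have : Exp (0 : 'M[C]_1) (omega *: x%:M) = omega *: Exp (0 : 'M[C]_1) x%:M.
  apply: Exp_unique; apply: eq_vcvg (vcvgZ omega (ExpP hq Z1 x%:M)) => k.
  rewrite scaler_sumr; apply: eq_bigr => i _; rewrite exptermZ.
  rewrite -[i : nat]odd_double_half; case: odd; last by rewrite add0n omega_frob_even.
  by rewrite /expterm expcoef0 ecoef_odd // raddf0 !mul0mx !scaler0.
rewrite scale_scalar_mx !Exp_scalar0 => /matrixP/(_ 0 0).
by rewrite !mxE eqxx !mulr1n.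
Qed.

End Omega.

(** * Inverses of matrices close to a scalar matrix *)

Section NearOne.
Context (F : finFieldType) (R : realType) (C : cinf F R).
Context (n : nat).
Implicit Types (X Y E : 'M[C]_n) (r s : R) (y : C).

(** A row u with u E = 0 equals u (1 - E), of larger order, so u = 0. The same gain in E^-1 = 1 + (1
    - E) E^-1 shows that E^-1 is integral, and then that it is close to 1. *)
Lemma near1_unit E r : 0 < r -> mge r (1%:M - E) ->
  E \in unitmx /\ mge r (1%:M - invmx E).
Proof.
move=> r0 hE.
have uE : E \in unitmx.
  rewrite -row_free_unit -kermx_eq0; apply/negPn/negP => /mge_attained[s [i [j [hs es]]]].
  have e : kermx E = kermx E *m (1%:M - E) by rewrite mulmxBr mulmx_ker mulmx1 subr0.
  have := mge_mul hs hE; rewrite -e => /(_ i j)/(ord_oge es); lra.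
split=> //.
have e : invmx E = 1%:M + (1%:M - E) *m invmx E.
  by rewrite mulmxBl mul1mx mulmxV // addrC subrK.
have h0 : mge 0 (invmx E).
  have [->|/mge_attained[s [i [j [hs es]]]]] := eqVneq (invmx E) 0; first exact: mge0.
  apply: mge_le (hs); rewrite leNgt; apply/negP => s0.
  have : mge (Num.min 0 (r + s)) (invmx E).
    rewrite e; apply: mgeD.
      by apply: mge_le (@mge1 F R C n); rewrite ge_min lexx.
    by apply: mge_le (mge_mul hE hs); rewrite ge_min lexx orbT.
  by move/(_ i j)/(ord_oge es); rewrite ge_min; case/orP; lra.
rewrite {1}e opprD addrA subrr add0r; apply/mgeN.
by apply: mge_le (mge_mul hE h0); lra.
Qed.

Lemma near_scalar_unit X y s r : ord y = s%:E -> s < r -> mge r (X - y%:M) ->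
  [/\ X \in unitmx, mge (- s) (invmx X) & mge (r - s - s) (invmx X - (y^-1)%:M)].
Proof.
move=> ey sr hX; have y0 := ord_neq0 ey.
have [||uE hE] := @near1_unit (y^-1 *: X) (r - s); first by lra.
  apply/mgeBC; have -> : y^-1 *: X - 1%:M = y^-1 *: (X - y%:M).
    by rewrite scalerBr scale_scalar_mx mulVf.
  exact: mgeZ_div ey hX.
have uX : X \in unitmx by move: uE; rewrite unitmxZ // unitfE invr_eq0.
have eX : invmx X = y^-1 *: invmx (y^-1 *: X).
  by rewrite invmxZ ?invrK ?scalerA ?mulVf ?scale1r // unitfE invr_eq0.
have h : mge (r - s - s) (invmx X - (y^-1)%:M).
  have -> : (y^-1)%:M = y^-1 *: 1%:M :> 'M_n by rewrite scale_scalar_mx mulr1.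
  rewrite eX -scalerBr.
  by apply: mgeZ_div ey _; apply: mgeBC.
split=> //; apply: mge_near (mge_le _ h) _; first by lra.
by apply: mge_scalar; apply: oge_ord; apply: ordV.
Qed.

End NearOne.

(** * Periods near y_0 and omega y_0 *)

Section ZerosNear.
Context (F : finFieldType) (R : realType) (C : cinf F R).
Hypothesis (hq : odd #|F|).
Local Notation q := (q_of F).
Local Notation Q := (qreal F R).
Local Notation rho := (tors_val F R).
Local Notation xi := (per_val F R).
Local Notation theta := (theta C).
Context (n : nat).
Implicit Types (A : 'M[C]_n) (r s h : R) (y : C).

Lemma radius_facts : [/\ 3 <= Q, 0 < rho, 3 * rho <= Q * rho, 8 * (Q * rho) <= 3
  & xi = 1 + rho].
Proof. by split; rewrite ?qreal_ge3 ?rho_gt0 ?qrho_le //; apply: qrho_gt. Qed.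

Lemma Exp_ge_inv A p (X : 'M[C]_(n, p)) x r : mge 0 A -> - xi < x -> mge x X ->
  - xi < r -> mge r (Exp A X) -> mge r X.
Proof.
move=> hA hx hX hr hE; have [Y hY eY] := Exp_solve hq hA hr hE.
suff -> : X = Y by [].
apply/eqP; rewrite -subr_eq0; apply/eqP.
apply: (Exp_inj (x := Num.min x r) hq hA); first by rewrite lt_min hx.
  by apply: mgeB; [apply: mge_le hX|apply: mge_le hY]; rewrite ge_min lexx ?orbT.
by rewrite (ExpB hq) // eY subrr.
Qed.

(** y I is a zero of Exp_0, so only the difference counts; its first-order term A y^q / theta_10 has
    order h - q xi + q = h - q rho. *)
Lemma Exp_scalar_ge A y h : 0 <= h -> mge h A -> exp1 y = 0 -> oge (- xi) y ->
  mge (h - Q * rho) (Exp A (y%:M : 'M[C]_n)).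
Proof.
move=> h0 hA ey hy.
have := Exp_diff hq (A2 := 0) (X := y%:M) h0 (mge_le h0 hA) (@mge0 F R C n n 0).
rewrite subr0 => /(_ hA (mge_scalar hy)) hE.
have e0 : Exp 0 (y%:M : 'M[C]_n) = 0.
  rewrite (Exp_0 hq); apply/matrixP=> i j; rewrite !mxE; case: eqP => _; rewrite ?mulr1n //.
  have := Exp0 hq (@mge0 F R C 1 1 0) 1; move/matrixP/(_ 0 0); rewrite mxE => <-.
  by rewrite /exp1 mulr0n raddf0.
rewrite e0 subr0 in hE.
have [Q3 r0 Qr0 Qr8 exi] := radius_facts.
apply: mge_near (mge_le _ hE) _; first by lra.
apply: mge_le (mgeZ_div (ord_thetad C hq 0) (mge_mul hA (mge_twist 1 (mge_scalar hy)))).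
by rewrite expr1 exi; lra.
Qed.

(** The zero is y I + D with Exp_A D = - Exp_A (y I), solved on the isometry ball; injectivity there
    identifies its columns with the values of [zero_near]. *)
Lemma zeros_nearP A y h : 1 <= h -> mge h A -> exp1 y = 0 -> oge (- xi) y ->
  Exp A (zeros_near A y) = 0 /\ mge (h - Q * rho) (zeros_near A y - y%:M).
Proof.
move=> h1 hA ey hy; have [Q3 r0 Qr0 Qr8 exi] := radius_facts.
have A0 : mge 0 A by apply: mge_le hA; lra.
have h0 : 0 <= h by lra.
have [|D hD eD] := Exp_solve hq A0 _ (proj2 (mgeN _ _) (Exp_scalar_ge h0 hA ey hy)).
  by lra.
have eW : Exp A (y%:M + D) = 0 by rewrite (ExpD hq) // eD subrr.
suff -> : zeros_near A y = y%:M + D by rewrite addrAC subrr add0r.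
have ecol p (X : 'M[C]_(n, p)) j : col j X = X *m map_mx (const C) (delta_mx j (0 : 'I_1)).
  by rewrite map_delta_mx -colE.
have Ecol j : Exp A (col j (y%:M + D)) = 0 by rewrite ecol (Exp_mulF hq) // eW mul0mx.
have dcol j : mge (h - Q * rho) (col j (y%:M + D) - y *: delta_mx j 0).
  have -> : col j (y%:M + D) - y *: delta_mx j 0 = col j D.
    by rewrite raddfD /= {1}colE mul_scalar_mx addrC addKr.
  by move=> i k; rewrite mxE.
apply/matrixP=> i j; rewrite mxE /zero_near.
rewrite (@xget_unique _ 0 _ (col j (y%:M + D))) ?mxE //.
  split; first by apply/Exp_eqP.
  by apply/lt_mxordP; exists (h - Q * rho) => //; lra.
move=> Y [/(Exp_eqP hq _ _ A0) eY /lt_mxordP[r rp hr]].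
apply/eqP; rewrite -subr_eq0; apply/eqP.
apply: (Exp_inj (x := 0) hq A0); [by lra| |by rewrite (ExpB hq) // eY Ecol subrr].
by apply: mge_trans (mge_le _ hr) (mgeBC (mge_le _ (dcol j))); lra.
Qed.

(** For the two zeros, Exp_A1 (Z1 - Z2) = - (Exp_A1 - Exp_A2) Z2, which [Exp_diff] evaluates to
    first order; Z1 - Z2 itself differs from the left side by a second-order error. *)
Lemma zeros_near_diff A1 A2 y h : 1 <= h -> mge 1 A1 -> mge 1 A2 -> mge h (A1 - A2) ->
  exp1 y = 0 -> oge (- xi) y ->
  mge h (zeros_near A1 y - zeros_near A2 y + (y ^+ q / thetad C 1 0) *: (A1 - A2)).
Proof.
move=> h1 hA1 hA2 hA ey hy; have [Q3 r0 Qr0 Qr8 exi] := radius_facts.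
have A10 : mge 0 A1 by apply: mge_le hA1; lra.
have A20 : mge 0 A2 by apply: mge_le hA2; lra.
have h0 : 0 <= h by lra.
have [e1 d1] := zeros_nearP (lexx _) hA1 ey hy.
have [e2 d2] := zeros_nearP (lexx _) hA2 ey hy.
set Z1 := zeros_near A1 y in e1 d1 *; set Z2 := zeros_near A2 y in e2 d2 *.
have hZ2 : mge (- xi) Z2.
  by apply: mge_near (mge_le _ d2) (mge_scalar hy); lra.
have hd : mge (1 - Q * rho) (Z1 - Z2) by apply: mge_trans d1 (mgeBC d2).
have hE := Exp_diff hq h0 A10 A20 hA hZ2.
rewrite e2 subr0 in hE.
have eE : Exp A1 (Z1 - Z2) = - Exp A1 Z2 by rewrite (ExpB hq) // e1 sub0r.
have et : twist 1 Z2 = (y ^+ q)%:M + twist 1 (Z2 - y%:M).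
  by rewrite twistB twist_scalar expn1 addrC subrK.
have hA' : mge h (Exp A1 (Z1 - Z2) + (y ^+ q / thetad C 1 0) *: (A1 - A2)).
  move/mgeN: hE; rewrite opprB addrC -eE et mulmxDr scalerDr addrA.
  rewrite mul_mx_scalar scalerA [_^-1 * _]mulrC => hE.
  have hs : mge h ((thetad C 1 0)^-1 *: ((A1 - A2) *m twist 1 (Z2 - y%:M))).
    apply: mge_le (mgeZ_div (ord_thetad C hq 0) (mge_mul hA (mge_twist 1 d2))).
    by rewrite expr1; nra.
  by have := mgeB hE hs; rewrite addrK.
have hEd : mge (h - Q * rho) (Exp A1 (Z1 - Z2)).
  rewrite -[Exp _ _](addrK ((y ^+ q / thetad C 1 0) *: (A1 - A2))).
  apply: mgeB; first by apply: mge_le hA'; lra.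
  rewrite [y ^+ q / _]mulrC -scalerA; apply: mge_le (mgeZ_div (ord_thetad C hq 0) (mgeZ _ hA)).
    2: by have := ogeX q hy; rewrite -/(qreal F R) => hyq; exact: hyq.
  by rewrite expr1 exi; lra.
have hd' : mge (h - Q * rho) (Z1 - Z2).
  by apply: (Exp_ge_inv A10 _ hd _ hEd); lra.
have hI : mge h (Exp A1 (Z1 - Z2) - (Z1 - Z2)).
  apply: mge_le (Exp_iso hq A10 _ hd'); last by lra.
  by lra.
by have := mgeB hA' hI; rewrite opprB addrC addrA subrK.
Qed.
End ZerosNear.

(** Isolates the part linear in B1 - B2. In [sigma_diff], a is an approximate value of the inverse
    G1, and the last two terms are of second order. *)
Lemma mul_inv_diff (C : comNzRingType) n (G1 X1 G2 X2 B1 B2 : 'M[C]_n) (a : C) :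
  G1 *m X1 = 1%:M -> X2 *m G2 = 1%:M ->
  G1 *m B1 - G2 *m B2 = a *: (B1 - B2) + (G1 - a%:M) *m (B1 - B2)
    + G1 *m (X2 - X1) *m G2 *m B2.
Proof.
move=> e1 e2; have -> : G1 *m (X2 - X1) *m G2 *m B2 = G1 *m B2 - G2 *m B2.
  by rewrite mulmxBr e1 !mulmxBl -(mulmxA G1) e2 mulmx1 mul1mx.
rewrite mulmxBl mul_scalar_mx [_ *: _ + _]addrC subrK mulmxBr.
by rewrite addrA subrK.
Qed.

(** * The Siegel matrix as a function of A: linearization and inversion *)

Section Sigma.
Context (F : finFieldType) (R : realType) (C : cinf F R).
Hypothesis (hq : odd #|F|).
Local Notation q := (q_of F).
Local Notation Q := (qreal F R).
Local Notation rho := (tors_val F R).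
Local Notation xi := (per_val F R).
Local Notation theta := (theta C).
Context (n : nat).
Implicit Types (A S : 'M[C]_n) (r s h c : R).

Context (omega y0 : C).
Hypotheses (homega : omega ^+ (#|F| ^ 2) = omega)
  (homegaF : forall a : F, const C a != omega)
  (homega2 : exists a : F, omega ^+ 2 = const C a)
  (hy0 : is_y0 y0).

Local Notation X A := (zeros_near A y0).
Local Notation X' A := (zeros_near A (omega * y0)).

Definition sigma A : 'M[C]_n := invmx (X A) *m X' A.

Lemma calS_sigma A : calS omega y0 A = (sigma A)^T.
Proof. by rewrite /calS /sigma trmx_mul trmx_inv. Qed.

Lemma ord_y : ord y0 = (- xi)%:E. Proof. by have [] := ord_y0 hq hy0. Qed.
Lemma exp1_y : exp1 y0 = 0. Proof. by have [] := ord_y0 hq hy0. Qed.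
Lemma ord_oy : ord (omega * y0) = (- xi)%:E.
Proof. by rewrite ordM (ord_omega hq) // ord_y add0e. Qed.
Lemma exp1_oy : exp1 (omega * y0) = 0.
Proof. by rewrite (exp1_omega hq) // exp1_y mulr0. Qed.

(* kappa * A is the first-order part of sigma A - omega. *)
Definition kappa : C := 2 * omega * (y0 ^+ q / thetad C 1 0) / y0.

Lemma ord_yq : ord (y0 ^+ q / thetad C 1 0) = (- (Q * rho))%:E.
Proof.
rewrite ordM (ordX _ ord_y) (ordV (ord_thetad C hq 0)) -EFinD expr1 opprK.
by congr EFin; rewrite /per_val -/(qreal F R); ring.
Qed.

Lemma ord_kappa : ord kappa = (xi - Q * rho)%:E.
Proof.
rewrite /kappa !ordM (ord_2 C hq) (ord_omega hq) // add0e add0e -ordM ord_yq.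
by rewrite (ordV ord_y) -EFinD opprK addrC.
Qed.

Lemma X_unit A h : 1 <= h -> mge h A ->
  [/\ X A \in unitmx, mge xi (invmx (X A)) &
      mge (h - Q * rho + xi + xi) (invmx (X A) - (y0^-1)%:M)].
Proof.
move=> h1 hA; have [Q3 r0 Qr0 Qr8 exi] := radius_facts R hq.
have [_ hX] := zeros_nearP hq h1 hA exp1_y (oge_ord ord_y).
have [|u h2 h3] := near_scalar_unit ord_y _ hX; first by lra.
by split=> //; [rewrite opprK in h2|rewrite !opprK in h3].
Qed.

(** Equal to X (sigma - omega). Unlike X', it is small with A, so that its products with other
    first-order quantities are of second order. *)
Definition Xdefect A := X' A - omega *: X A.

Lemma Xdefect_ge A h : 1 <= h -> mge h A -> mge (h - Q * rho) (Xdefect A).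
Proof.
move=> h1 hA.
have [_ hX] := zeros_nearP hq h1 hA exp1_y (oge_ord ord_y).
have [_ hX'] := zeros_nearP hq h1 hA exp1_oy (oge_ord ord_oy).
have -> : Xdefect A = (X' A - (omega * y0)%:M) - omega *: (X A - y0%:M).
  by rewrite /Xdefect scalerBr scale_scalar_mx opprB addrA subrK.
apply: mgeB => //; rewrite -[_ - _]add0r.
by apply: mgeZ => //; apply: oge_ord; apply: ord_omega.
Qed.

Lemma sigma_defect A h : 1 <= h -> mge h A ->
  sigma A - omega%:M = invmx (X A) *m Xdefect A.
Proof.
move=> h1 /(X_unit h1)[u _ _].
by rewrite /Xdefect mulmxBr -scalemxAr mulVmx // scale_scalar_mx mulr1.
Qed.

(** The first-order parts of X' and omega X are opposite, since (omega y_0)^q = - omega y_0^q; in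
    the difference they add up, whence the factor 2. *)
Lemma Xdefect_diff A1 A2 h : 1 <= h -> mge 1 A1 -> mge 1 A2 -> mge h (A1 - A2) ->
  mge h (Xdefect A1 - Xdefect A2 - (2 * omega * (y0 ^+ q / thetad C 1 0)) *: (A1 - A2)).
Proof.
move=> h1 hA1 hA2 hA.
have d := zeros_near_diff hq h1 hA1 hA2 hA exp1_y (oge_ord ord_y).
have d' := zeros_near_diff hq h1 hA1 hA2 hA exp1_oy (oge_ord ord_oy).
set a := y0 ^+ q / _ in d *.
have ea : (omega * y0) ^+ q / thetad C 1 0 = - (omega * a).
  by rewrite exprMn (omega_frob homegaF homega2) /a mulNr mulrA mulNr.
rewrite ea in d'.
have -> : Xdefect A1 - Xdefect A2 - (2 * omega * a) *: (A1 - A2) =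
    (X' A1 - X' A2 + - (omega * a) *: (A1 - A2)) -
    omega *: (X A1 - X A2 + a *: (A1 - A2)).
  rewrite /Xdefect; move: (X A1) (X A2) (X' A1) (X' A2) (A1 - A2) => x1 x2 x1' x2' b.
  by apply/matrixP=> i j; rewrite !mxE; ring.
apply: mgeB => //; rewrite -[h]add0r.
by apply: mgeZ => //; apply: oge_ord; apply: ord_omega.
Qed.

(** The linear part has order at least h + xi - q rho, so the remainder is better by q rho; this is
    the contraction. *)
Lemma sigma_diff A1 A2 h : 1 <= h -> mge 1 A1 -> mge 1 A2 -> mge h (A1 - A2) ->
  mge (h + xi) (sigma A1 - sigma A2 - kappa *: (A1 - A2)).
Proof.
move=> h1 hA1 hA2 hA; have [Q3 r0 Qr0 Qr8 exi] := radius_facts R hq.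
have [u1 g1 d1] := X_unit (lexx _) hA1; have [u2 g2 d2] := X_unit (lexx _) hA2.
have hB := Xdefect_diff h1 hA1 hA2 hA.
set mu := 2 * omega * _ in hB.
have emu : ord mu = (- (Q * rho))%:E.
  by rewrite /mu !ordM (ord_2 C hq) (ord_omega hq) // add0e add0e -ordM ord_yq.
have hB' : mge (h - Q * rho) (Xdefect A1 - Xdefect A2).
  apply: mge_near (mge_le _ hB) _; first by lra.
  by rewrite addrC; apply: mgeZ (oge_ord emu) hA.
have hX : mge (h - Q * rho) (X A2 - X A1).
  apply: mgeBC.
  have hd := zeros_near_diff hq h1 hA1 hA2 hA exp1_y (oge_ord ord_y).
  rewrite -[X A1 - X A2](addrK ((y0 ^+ q / thetad C 1 0) *: (A1 - A2))).
  apply: mgeB; first by apply: mge_le hd; lra.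
  by rewrite addrC; apply: mgeZ (oge_ord ord_yq) hA.
have -> : sigma A1 - sigma A2 - kappa *: (A1 - A2) =
    y0^-1 *: (Xdefect A1 - Xdefect A2 - mu *: (A1 - A2))
    + (invmx (X A1) - (y0^-1)%:M) *m (Xdefect A1 - Xdefect A2)
    + invmx (X A1) *m (X A2 - X A1) *m invmx (X A2) *m Xdefect A2.
  have e1 : sigma A1 - sigma A2 = invmx (X A1) *m Xdefect A1 - invmx (X A2) *m Xdefect A2.
    by rewrite -!(sigma_defect (lexx _)) // opprB addrA subrK.
  rewrite e1 (@mul_inv_diff _ _ _ _ _ _ (Xdefect A1) (Xdefect A2) y0^-1 (mulVmx u1) (mulmxV u2)).
  move: (A1 - A2) (Xdefect A1 - Xdefect A2) (_ *m Xdefect A2) (_ *m (_ - _)) => E D P' P.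
  rewrite /kappa -/mu [mu / y0]mulrC -scalerA scalerBr addrAC.
  by congr (_ + _); rewrite addrAC.
apply: mgeD; first apply: mgeD.
- by apply: mge_le (mgeZ_div ord_y hB); lra.
- by apply: mge_le (mge_mul d1 hB'); lra.
- apply: mge_le (mge_mul (mge_mul (mge_mul g1 hX) g2) (Xdefect_ge (lexx _) hA2)).
  by lra.
Qed.

Lemma sigma0 : sigma 0 = omega%:M.
Proof.
have e y : exp1 y = 0 -> oge (- xi) y -> zeros_near (0 : 'M[C]_n) y = y%:M.
  move=> ey hy; apply/eqP; rewrite -subr_eq0; apply/eqP/mge_oo => c.
  have h1 : 1 <= Num.max 1 (c + Q * rho) by rewrite le_max lexx.
  have [_ h] := zeros_nearP hq h1 (mge0 C _ : mge _ (0 : 'M_n)) ey hy.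
  by eexists; [|exact: h]; rewrite lerBrDr le_max lexx orbT.
rewrite /sigma !e ?exp1_y ?exp1_oy //; try exact: oge_ord ord_y; try exact: oge_ord ord_oy.
rewrite invmx_scalar -scalar_mxM mulrCA mulVf ?mulr1 //; exact: ord_neq0 ord_y.
Qed.

Lemma sigma_diff_ge A1 A2 h : 1 <= h -> mge 1 A1 -> mge 1 A2 -> mge h (A1 - A2) ->
  mge (h + xi - Q * rho) (sigma A1 - sigma A2).
Proof.
move=> h1 hA1 hA2 hA; have [Q3 r0 Qr0 Qr8 exi] := radius_facts R hq.
apply: mge_near (mge_le _ (sigma_diff h1 hA1 hA2 hA)) _; first by lra.
by apply: mge_le (mgeZ (oge_ord ord_kappa) hA); lra.
Qed.

Lemma sigma_inj A1 A2 : mge 1 A1 -> mge 1 A2 -> sigma A1 = sigma A2 -> A1 = A2.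
Proof.
move=> hA1 hA2 e; have [Q3 r0 Qr0 Qr8 exi] := radius_facts R hq.
apply/eqP; rewrite -subr_eq0; apply/negPn/negP => /mge_attained[r [i [j [hr er]]]].
have r1 : 1 <= r by apply: ord_oge er _; apply: mgeB.
have := sigma_diff r1 hA1 hA2 hr; rewrite e subrr sub0r => /mgeN/(_ i j).
rewrite mxE => /(oge_mulK ord_kappa)/(ord_oge er); lra.
Qed.

(** Newton iteration with the fixed derivative kappa: the order of S - sigma a_k grows by q rho at
    each step. The radius is 1 + ord kappa, which keeps the iterates at order at least 1, where
    [sigma_diff] applies. *)
Lemma sigma_surj S c : 1 + xi - Q * rho <= c -> mge c (S - omega%:M) ->
  exists2 A, mge (c - xi + Q * rho) A & sigma A = S.
Proof.
move=> hc hS; have [Q3 r0 Qr0 Qr8 exi] := radius_facts R hq.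
have [a a0 aS] : exists2 a : nat -> 'M[C]_n, a 0%N = 0 &
    forall k, a k.+1 - a k = kappa^-1 *: (S - sigma (a k)).
  exists (fun k => iter k (fun A => A + kappa^-1 *: (S - sigma A)) 0) => [//|k].
  by rewrite iterS addrAC subrr add0r.
have kap0 := ord_neq0 ord_kappa.
have k0 k : 0 <= k%:R * (Q * rho) by apply: mulr_ge0 => //; lra.
have H k : mge (c - xi + Q * rho) (a k) /\ mge (c + k%:R * (Q * rho)) (S - sigma (a k)).
  elim: k => [|k [IH1 IH2]].
    by rewrite a0 sigma0 mul0r addr0; split=> //; apply: mge0.
  have hd : mge (c + k%:R * (Q * rho) - xi + Q * rho) (a k.+1 - a k).
    by rewrite aS; apply: mge_le (mgeZ_div ord_kappa IH2); lra.
  have h1 : mge (c - xi + Q * rho) (a k.+1).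
    by apply: mge_near (mge_le _ hd) IH1; have := k0 k; lra.
  split; first exact: h1.
  have hh : 1 <= c + k%:R * (Q * rho) - xi + Q * rho by have := k0 k; lra.
  have i1 : mge 1 (a k.+1) by apply: mge_le h1; lra.
  have i2 : mge 1 (a k) by apply: mge_le IH1; lra.
  have := sigma_diff hh i1 i2 hd.
  have -> : kappa *: (a k.+1 - a k) = S - sigma (a k).
    by rewrite aS scalerA mulfV ?scale1r.
  rewrite opprB subrKA => /mgeBC.
  by apply: mge_le; rewrite -natr1; lra.
have hd k : mge (c + k%:R * (Q * rho) - xi + Q * rho) (a k.+1 - a k).
  by rewrite aS; apply: mge_le (mgeZ_div ord_kappa (H k).2); lra.
have hs : small (fun k => a k.+1 - a k).
  move=> t; have [N hN] := nat_unbounded ((t - c + xi) / (Q * rho)).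
  exists N => k /hN h; apply: mge_le (hd k).
  by move: h; rewrite ler_pdivrMr; lra.
have hA : vcvg a (msum (fun k => a k.+1 - a k)).
  apply: eq_vcvg (msumP hs) => k.
  by rewrite -(big_mkord predT (fun k => a k.+1 - a k)) telescope_sumr // a0 subr0.
set A := msum _ in hA.
have A1 : mge (c - xi + Q * rho) A by apply: (vcvg_ge (N := 0) hA) => k _; exact: (H k).1.
exists A => //; apply/eqP; rewrite -subr_eq0; apply/eqP/mge_oo => t.
(* The maximum with 1 meets the condition of [sigma_diff_ge], used here as continuity of sigma. *)
have [N hN] := hA (Num.max 1 t).
have [N' hN'] := nat_unbounded ((t - c) / (Q * rho)).
have /hN h1 := leq_maxl N N'; have /hN' h2 := leq_maxr N N'.
set k := maxn N N' in h1 h2.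
exists t => //; apply: (mge_trans (B := sigma (a k))).
  apply: mgeBC; apply: mge_le (sigma_diff_ge _ _ _ h1).
  - have : t <= Num.max 1 t by rewrite le_max lexx orbT.
    by lra.
  - by rewrite le_max lexx.
  - by apply: mge_le (H k).1; lra.
  - by apply: mge_le A1; lra.
apply: mgeBC; apply: mge_le (H k).2.
by move: h2; rewrite ler_pdivrMr; lra.
Qed.

End Sigma.

(** * Evaluation of polynomials at theta *)

Section Evtheta.
Context (F : finFieldType) (R : realType) (C : cinf F R).

Lemma evtheta_additive : zmod_morphism (@evtheta F R C).
Proof. by move=> p p'; rewrite /evtheta rmorphB hornerD hornerN. Qed.
Lemma evtheta_monoid : monoid_morphism (@evtheta F R C).
Proof. by split=> [|p p']; rewrite /evtheta ?rmorph1 ?hornerC // rmorphM hornerM. Qed.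
HB.instance Definition _ := GRing.isZmodMorphism.Build {poly F} C (@evtheta F R C) evtheta_additive.
HB.instance Definition _ := GRing.isMonoidMorphism.Build {poly F} C (@evtheta F R C) evtheta_monoid.

Lemma evthetaC (a : F) : evtheta C a%:P = const C a.
Proof. by rewrite /evtheta map_polyC hornerC. Qed.
Lemma evthetaX : evtheta C 'X = theta C.
Proof. by rewrite /evtheta map_polyX hornerX. Qed.

Lemma evtheta_mxC m n (M : 'M[F]_(m, n)) :
  map_mx (evtheta C) (map_mx polyC M) = map_mx (const C) M.
Proof. by apply/matrixP=> i j; rewrite !mxE evthetaC. Qed.

End Evtheta.

(** * The kernel of the exponential *)

Section Kernel.
Context (F : finFieldType) (R : realType) (C : cinf F R).
Hypothesis (hq : odd #|F|).
Local Notation q := (q_of F).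
Local Notation Q := (qreal F R).
Local Notation rho := (tors_val F R).
Local Notation xi := (per_val F R).
Local Notation theta := (theta C).
Local Notation ev := (map_mx (evtheta C)).
Local Notation cst := (map_mx (const C)).
Context (n : nat).
Implicit Types (A S : 'M[C]_n) (r s h : R).

Lemma Exp_eval A p (V : 'M[C]_(n, p)) p' (M : 'M[{poly F}]_(p, p')) :
  mge 0 A -> Exp A V = 0 -> Exp A (V *m ev M) = 0.
Proof.
move=> hA hV.
have [N hN] : exists N, forall i j, (size (M i j) <= N)%N.
  exists (\max_(ij : 'I_p * 'I_p') size (M ij.1 ij.2))%N => i j.
  exact: (leq_bigmax (i, j)).
elim: N M hN => [|N IH] M hN.
  have -> : M = 0.
    by apply/matrixP=> i j; rewrite mxE; apply/eqP; rewrite -size_poly_leq0.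
  by rewrite raddf0 mulmx0 (Exp0 hq).
pose M1 : 'M[{poly F}]_(p, p') := map_mx (drop_poly 1) M.
pose M0 : 'M[F]_(p, p') := map_mx (fun f : {poly F} => f`_0) M.
have eM : M = 'X *: M1 + map_mx polyC M0.
  apply/matrixP=> i j; rewrite !mxE -{1}[M i j](poly_take_drop 1) addrC mulrC expr1.
  congr (_ + _); apply/polyP=> k; rewrite coef_take_poly coefC.
  by case: k => [|k].
have -> : ev M = theta *: ev M1 + cst M0.
  by rewrite eM raddfD /= evtheta_mxC map_mxZ /= evthetaX.
rewrite mulmxDr (ExpD hq) // (Exp_mulF hq) // hV mul0mx addr0.
rewrite -scalemxAr (Exp_theta hq) // IH ?/actTmx ?scaler0 ?twist0 ?mulmx0 ?addr0 //.
by move=> i j; rewrite mxE size_drop_poly; have := hN i j; lia.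
Qed.

(** The preimage B of Y in the isometry ball gives a zero theta B of Exp_A of order > - xi, hence B
    = 0. *)
Lemma torsion_small A p (Y : 'M[C]_(n, p)) t : mge 0 A -> actTmx A Y = 0 ->
  - rho < t -> mge t Y -> Y = 0.
Proof.
move=> hA hT ht hY; have [Q3 r0 Qr0 Qr8 exi] := radius_facts R hq.
have [|B hB eB] := Exp_solve hq hA _ hY; first by lra.
have : theta *: B = 0.
  apply: (Exp_inj hq hA (x := -1 + t)); first by lra.
    by apply: mgeZ hB; apply: oge_ord; apply: ord_theta.
  by rewrite (Exp_theta hq) // eB.
move/eqP; rewrite scaler_eq0 (negbTE (ord_neq0 (ord_theta C))) /= => /eqP B0.
by rewrite -eB B0 (Exp0 hq).
Qed.

(** Below order - rho the term Y^(2) strictly dominates the other two. *)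
Lemma torsion_ge A p (Y : 'M[C]_(n, p)) : mge 0 A -> actTmx A Y = 0 -> mge (- rho) Y.
Proof.
move=> hA hT; have [Q3 r0 Qr0 Qr8 exi] := radius_facts R hq.
have eQ := qreal_rho R hq.
have [->|/mge_attained[r [i [j [hr er]]]]] := eqVneq Y 0; first exact: mge0.
apply: mge_le (hr); rewrite leNgt; apply/negP => lt.
have e1 : ord (twist 2 Y i j) = (Q ^+ 2 * r)%:E by rewrite mxE (ordX _ er) natr_qk.
have h1 : mge (Num.min (-1 + r) (0 + Q ^+ 1 * r)) (twist 2 Y).
  have -> : twist 2 Y = - (theta *: Y + A *m twist 1 Y).
    by move/eqP: hT; rewrite /actTmx addr_eq0 => /eqP ->; rewrite opprK.
  apply/mgeN; apply: mgeD.
    by apply: mge_le (mgeZ (oge_ord (ord_theta C)) hr); rewrite ge_min lexx.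
  by apply: mge_le (mge_mul hA (mge_twist 1 hr)); rewrite ge_min lexx orbT.
have := ord_oge e1 (h1 i j); rewrite ge_min expr1 add0r.
have h2 : 0 < (Q ^+ 2 - 1) * (- rho - r) by rewrite mulr_gt0 //; nra.
have h3 : 0 < (Q ^+ 2 - Q) * (- r) by rewrite mulr_gt0 //; nra.
by case/orP; lra.
Qed.

Context (omega y0 : C).
Hypotheses (homega : omega ^+ (#|F| ^ 2) = omega)
  (homegaF : forall a : F, const C a != omega)
  (homega2 : exists a : F, omega ^+ 2 = const C a)
  (hy0 : is_y0 y0).

Local Notation X A := (zeros_near A y0).
Local Notation X' A := (zeros_near A (omega * y0)).
Local Notation eta := (theta^-1 * y0).

Lemma ord_eta : ord eta = (- rho)%:E.
Proof.
rewrite ordM (ordV (ord_theta C)) (ord_y hq hy0) -EFinD; congr EFin.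
by rewrite /per_val; lra.
Qed.

(** With y1 = exp1 eta one has y1^(q^2) = - theta y1, so dividing an entry of Y by y1 turns the
    torsion equation into v^(q^2) - v small, and [near_cst2] applies; y1 is then replaced by the
    nearby eta. *)
Lemma torsion_near A p (Y : 'M[C]_(n, p)) : mge 1 A -> actTmx A Y = 0 ->
  exists c d : 'M[F]_(n, p), exists2 t, - rho < t &
    mge t (Y - eta *: (cst c + omega *: cst d)).
Proof.
move=> hA hT; have [Q3 r0 Qr0 Qr8 exi] := radius_facts R hq.
have eQ := qreal_rho R hq.
have hY := torsion_ge (mge_le ler01 hA) hT.
have Z1 : mge 0 (0 : 'M[C]_1) by apply: mge0.
pose y1 := exp1 eta.
have hy1 : oge (1 - rho) (y1 - eta).
  have := Exp_iso hq Z1 (x := - rho) _ (mge_scalar (oge_ord ord_eta)).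
  rewrite Exp_scalar0 => h; have /h/(_ 0 0) : - xi <= - rho by lra.
  by rewrite !mxE eqxx !mulr1n; apply: oge_le; lra.
have ey1 : ord y1 = (- rho)%:E.
  by apply: ord_near ord_eta _ hy1; lra.
have Ty1 : y1 ^+ (q ^ 2) = - (theta * y1).
  apply/eqP; rewrite -addr_eq0 addrC -(exp1_theta hq) mulrA mulfV ?mul1r; last first.
    exact: ord_neq0 (ord_theta C).
  by rewrite (exp1_y hq hy0).
have y1n0 := ord_neq0 ey1.
have H (ij : 'I_n * 'I_p) : exists cd : F * F, exists2 t, - rho < t &
    oge t (Y ij.1 ij.2 - eta * cst2 omega cd.1 cd.2).
  case: ij => i j /=; set y := Y i j.
  have hz : oge (1 - Q * rho) (y ^+ (q ^ 2) + theta * y).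
    have -> : y ^+ (q ^ 2) + theta * y = (- (A *m twist 1 Y)) i j.
      have := congr1 (fun M : 'M_(n, p) => M i j) hT; rewrite /actTmx !mxE => /eqP.
      by rewrite addrAC addr_eq0 => /eqP <-; rewrite addrC.
    have := mge_mul hA (mge_twist 1 hY); rewrite expr1 mulrN => h.
    by have /mgeN := h; apply.
  have hv : oge (1 - Q * rho + xi) ((y / y1) ^+ (q ^ 2) - y / y1).
    have e2 : ord (y1 ^+ (q ^ 2)) = (- xi)%:E.
      by rewrite (ordX _ ey1) natr_qk; congr EFin; rewrite /per_val; lra.
    rewrite -[1 - Q * rho + xi]/(_) -{1}[xi]opprK.
    apply: (oge_mulK e2); rewrite mulrBr -exprMn mulrCA divff // mulr1.
    by rewrite Ty1 mulNr opprK -mulrA (mulrCA y1) divff ?mulr1.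
  have vpos : 0 < 1 - Q * rho + xi by lra.
  have [c [d [t t0 ht]]] := near_cst2 hq homega homegaF vpos hv.
  exists (c, d), (Num.min (t - rho) (1 - rho)).
    by rewrite lt_min; apply/andP; split; lra.
  rewrite -(subrKA (y1 * cst2 omega c d)); apply: ogeD.
    have -> : y - y1 * cst2 omega c d = y1 * (y / y1 - cst2 omega c d).
      by rewrite mulrBr mulrCA divff ?mulr1.
    apply: oge_le (ogeM (oge_ord ey1) ht).
    by rewrite ge_min; apply/orP; left; lra.
  rewrite -mulrBl; apply: oge_le (ogeM hy1 (oge_cst2 hq homega homegaF c d)).
  by rewrite ge_min; apply/orP; right; lra.
have [cd hcd] := choice H.
exists (\matrix_(i, j) (cd (i, j)).1), (\matrix_(i, j) (cd (i, j)).2).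
(* The bound t depends on the entry; [mxord] supplies a common one. *)
apply/lt_mxordP; apply/bigmin_gtP; split=> [|i _]; first by rewrite ltey.
apply/bigmin_gtP; split=> [|j _]; first by rewrite ltey.
have [t rt ht] := hcd (i, j); rewrite !mxE.
by apply: lt_le_trans ht; rewrite lte_fin.
Qed.

(* Descent: if Exp_A V = 0, then Exp_A (V / theta) is a torsion point; subtracting
   from V the F_q-combination of the X_i, X'_i with the same torsion point leaves
   theta U with Exp_A U = 0 and U smaller than V. *)
Lemma Exp_kernel A p (V : 'M[C]_(n, p)) : mge 1 A ->
  Exp A V = 0 <-> exists a b : 'M[{poly F}]_(n, p), V = X A *m ev a + X' A *m ev b.
Proof.
move=> hA; have A0 : mge 0 A := mge_le ler01 hA.
have [Q3 r0 Qr0 Qr8 exi] := radius_facts R hq.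
have oy := oge_ord (ord_y hq hy0); have ooy := oge_ord (ord_oy hq homega homegaF hy0).
have [eX dX] := zeros_nearP hq (lexx _) hA (exp1_y hq hy0) oy.
have [eX' dX'] := zeros_nearP hq (lexx _) hA (exp1_oy hq homega hy0) ooy.
split=> [|[a [b ->]]]; last first.
  by rewrite (ExpD hq) // !Exp_eval ?addr0.
have [r hr] := mge_ex V; have [N hN] := nat_unbounded (- r).
have {}hr : exists2 r, - N%:R - xi < r & mge r V.
  by exists r => //; have := hN N (leqnn N); lra.
(* N measures how far V lies outside the isometry ball: for N = 0 injectivity gives V = 0, and
   passing to (V - L) / theta lowers N by one. *)
elim: N V hr {hN} => [|N IH] V [{}r rN hr] hV.
  exists 0, 0; rewrite raddf0 !mulmx0 addr0.
  by apply: (Exp_inj hq A0 _ hr hV); lra.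
have th0 : theta != 0 := ord_neq0 (ord_theta C).
have thV : theta *: (theta^-1 *: V) = V by rewrite scalerA divff ?scale1r.
have hT : actTmx A (Exp A (theta^-1 *: V)) = 0 by rewrite -(Exp_theta hq) ?thV.
have [c [d [t rt ht]]] := torsion_near hA hT.
pose L := X A *m cst c + X' A *m cst d.
have EL : Exp A L = 0 by rewrite /L (ExpD hq) // !(Exp_mulF hq) // eX eX' !mul0mx addr0.
have c0 : mge 0 (cst c) by move=> i j; rewrite mxE; apply: oge_const.
have d0 : mge 0 (cst d) by move=> i j; rewrite mxE; apply: oge_const.
have dL : mge (1 - Q * rho) (L - y0 *: (cst c + omega *: cst d)).
  have -> : L - y0 *: (cst c + omega *: cst d) =
      (X A - y0%:M) *m cst c + (X' A - (omega * y0)%:M) *m cst d.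
    rewrite /L !mulmxBl !mul_scalar_mx scalerDr scalerA (mulrC y0).
    by rewrite opprD addrACA.
  by apply: mgeD; rewrite -[1 - _]addr0; apply: mge_mul.
have hcd : mge 0 (cst c + omega *: cst d).
  apply: mgeD => //; rewrite -[0]addr0; apply: mgeZ => //.
  by apply: oge_ord; apply: (ord_omega hq).
have hL : mge (- xi) L.
  apply: mge_near (mge_le _ dL) _; first by lra.
  by rewrite -[- xi]addr0; apply: mgeZ.
have thV1 : oge 1 theta^-1.
  by apply: oge_ord; rewrite (ordV (ord_theta C)) opprK.
have hEL : mge (1 - rho) (Exp A (theta^-1 *: L) - eta *: (cst c + omega *: cst d)).
  have h1 : mge (- rho) (theta^-1 *: L) by apply: mge_le (mgeZ thV1 hL); lra.
  have rx : - xi <= - rho by lra.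
  have h2 := Exp_iso hq A0 rx h1.
  apply: mge_trans (mge_le _ h2) _; first by lra.
  rewrite -scalerA -scalerBr; apply: mge_le (mgeZ thV1 dL); lra.
(* Both Exp_A (V / theta) and Exp_A (L / theta) equal eta (c + omega d) up to order > - rho, so
   their difference is a torsion point too small to be nonzero. *)
have U0 : Exp A (theta^-1 *: (V - L)) = 0.
  apply: (torsion_small (t := Num.min t (1 - rho)) A0).
  - by rewrite -(Exp_theta hq) // scalerA divff // scale1r (ExpB hq) // hV EL subr0.
  - by rewrite lt_min rt /=; lra.
  rewrite scalerBr (ExpB hq) //; apply: mge_trans (mge_le _ ht) (mgeBC (mge_le _ hEL)).
    by rewrite ge_min lexx.
  by rewrite ge_min lexx orbT.
have [|a [b eU]] := IH (theta^-1 *: (V - L)) _ U0.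
  exists (1 + Num.min r (- xi)).
    rewrite -ltrBlDl lt_min; move: rN; rewrite -natr1 => rN.
    have N0 : 0 <= N%:R :> R by [].
    by apply/andP; split; lra.
  apply: mgeZ => //; apply: mgeB; first by apply: mge_le hr; rewrite ge_min lexx.
  by apply: mge_le hL; rewrite ge_min lexx orbT.
exists ('X *: a + map_mx polyC c), ('X *: b + map_mx polyC d).
rewrite !map_mxD !map_mxZ !evtheta_mxC /= evthetaX !mulmxDr -!scalemxAr addrACA.
rewrite -scalerDr -eU scalerA divff // scale1r -/L subrK //.
Qed.

End Kernel.

(** * Lattices and Siegel matrices *)

Section Laurent.
Context (F : finFieldType) (R : realType) (C : cinf F R).
Local Notation theta := (theta C).
Local Notation K := (@field_K F R C).
Implicit Types (x y : C) (r s t : R).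

Definition lterm (N : nat) (c : nat -> F) i : C := const C (c i) * (theta ^+ N / theta ^+ i).
Definition lsum N c k : C := \sum_(i < k) lterm N c i.

Lemma field_KP x : K x <-> exists N c, vcvg (fun k => (lsum N c k)%:M : 'M[C]_1) x%:M.
Proof.
split=> -[N [c h]]; exists N, c => t.
  have [M hM] := h t; exists M => k /hM hk i j.
  by rewrite !mxE !ord1 eqxx !mulr1n; apply: ltW.
have [M hM] := h (t + 1); exists M => k /hM/(_ 0 0); rewrite !mxE eqxx !mulr1n.
by apply: lt_le_trans; rewrite lte_fin; lra.
Qed.

Let theta_neq0 : theta != 0. Proof. exact: ord_neq0 (ord_theta C). Qed.

(** Padding with zeros gives two series the same starting exponent, as needed for their sum. *)
Lemma field_K_raise N c d : exists c', forall k, lsum (N + d) c' (d + k) = lsum N c k.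
Proof.
exists (fun i => if (i < d)%N then 0 else c (i - d)%N) => k.
rewrite /lsum big_split_ord /= big1 ?add0r => [|i _].
  apply: eq_bigr => i _; rewrite /lterm /= ltnNge leq_addr /= addKn.
  by rewrite [(d + i)%N]addnC !exprD -mulf_div divff ?expf_neq0 ?mulr1.
by rewrite /lterm ltn_ord rmorph0 mul0r.
Qed.

Lemma field_K0 : K 0.
Proof.
apply/field_KP; exists 0%N, (fun=> 0); apply: eq_vcvg (vcvg_const _) => k.
by rewrite /lsum big1 // => i _; rewrite /lterm rmorph0 mul0r.
Qed.

Lemma field_K1 : K 1.
Proof.
apply/field_KP; exists 0%N, (fun i => (i == 0%N)%:R).
apply/(vcvg_shift 1); apply: eq_vcvg (vcvg_const _) => k.
rewrite addn1 /lsum big_ord_recl big1 ?addr0 /lterm /= => [|i _].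
  by rewrite (rmorph1 (const C)) expr0 invr1 !mulr1.
by rewrite rmorph0 mul0r.
Qed.

Lemma field_KD x y : K x -> K y -> K (x + y).
Proof.
move=> /field_KP[N [c hx]] /field_KP[M [d hy]]; apply/field_KP.
have [c' hc] := field_K_raise N c M; have [d' hd] := field_K_raise M d N.
exists (N + M)%N, (fun i => c' i + d' i); rewrite raddfD.
apply/(vcvg_shift (N + M)).
have h1 := (vcvg_shift N _ _).2 hx; have h2 := (vcvg_shift M _ _).2 hy.
apply: eq_vcvg (vcvgD h1 h2) => k /=.
rewrite -!hc -!hd -raddfD; congr (_%:M).
rewrite (addnC M N) [(M + (k + N))%N]addnC [(N + (k + M))%N]addnC -!addnA (addnC M N) /lsum.
by rewrite -big_split; apply: eq_bigr => i _; rewrite /lterm rmorphD mulrDl.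
Qed.

Lemma field_K_const a x : K x -> K (const C a * x).
Proof.
move=> /field_KP[N [c hx]]; apply/field_KP; exists N, (fun i => a * c i).
rewrite -scale_scalar_mx; apply: eq_vcvg (vcvgZ (const C a) hx) => k.
rewrite scale_scalar_mx /lsum mulr_sumr; congr (_%:M); apply: eq_bigr => i _.
by rewrite /lterm rmorphM mulrA.
Qed.

Lemma field_K_theta x : K x -> K (theta * x).
Proof.
move=> /field_KP[N [c hx]]; apply/field_KP; exists N.+1, c.
rewrite -scale_scalar_mx; apply: eq_vcvg (vcvgZ theta hx) => k.
rewrite scale_scalar_mx /lsum mulr_sumr; congr (_%:M); apply: eq_bigr => i _.
by rewrite /lterm exprS; rewrite mulrCA !mulrA.
Qed.

Lemma field_K_evtheta p x : K x -> K (evtheta C p * x).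
Proof.
move=> hx; elim/poly_ind: p => [|p a IH]; first by rewrite rmorph0 mul0r; apply: field_K0.
rewrite rmorphD rmorphM /= evthetaX evthetaC mulrDl (mulrC _ theta) -mulrA.
by apply: field_KD; [apply: field_K_theta|apply: field_K_const].
Qed.

Lemma ring_A_field_K x : @ring_A F R C x -> K x.
Proof. by case=> p _ <-; rewrite -[evtheta C p]mulr1; apply: field_K_evtheta field_K1. Qed.

Lemma field_K_sum I (s : seq I) (f : I -> C) : (forall i, K (f i)) -> K (\sum_(i <- s) f i).
Proof. by move=> h; elim/big_ind: _ => //; [exact: field_K0|exact: field_KD]. Qed.

Lemma ord_theta_quot N i : ord (theta ^+ N / theta ^+ i) = (i%:R - N%:R)%:E.
Proof.
rewrite ordM (ordV (ordX i (ord_theta C))) (ordX N (ord_theta C)) -EFinD.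
by congr EFin; ring.
Qed.

Lemma field_K_lead x : K x -> x = 0 \/ exists N i (a : F) t,
  [/\ a != 0, i%:R - N%:R < t & oge t (x - const C a * (theta ^+ N / theta ^+ i))].
Proof.
move=> /field_KP[N [c hx]].
have [h0|] := pselect (forall i, c i = 0).
  left; have /matrixP/(_ 0 0) : x%:M = 0 :> 'M[C]_1; last by rewrite !mxE.
  apply: vcvg_unique hx _; apply: eq_vcvg (vcvg_const _) => k.
  by rewrite /lsum big1 ?raddf0 // => i _; rewrite /lterm h0 rmorph0 mul0r.
move=> /existsNP[i0 /eqP hi0].
have ex : exists i, c i != 0 by exists i0.
case: (ex_minnP ex) => i ci imin; right; exists N, i, (c i), (i.+1%:R - N%:R); split=> //.
  by rewrite -natr1; lra.
have [M hM] := hx (i.+1%:R - N%:R).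
have := hM (i.+1 + M)%N (leq_addl _ _) 0 0.
rewrite !mxE eqxx !mulr1n /lsum big_split_ord big_ord_recr /= big1 ?add0r => [|j _]; last first.
  rewrite /lterm /=; have [|cj] := eqVneq (c j) 0; first by move=> ->; rewrite rmorph0 mul0r.
  by have := imin _ cj; rewrite leqNgt ltn_ord.
move=> h; rewrite -/(lterm N c i).
have h2 : oge (i.+1%:R - N%:R) (\sum_(j < M) lterm N c (i.+1 + j)).
  apply: oge_sum => j _; rewrite /lterm.
  apply: oge_le (ogeM (oge_const _ _) (oge_ord (ord_theta_quot _ _))).
  by rewrite natrD; have : 0 <= j%:R :> R by []; lra.
by have := ogeB h2 h; congr oge; rewrite /lterm; ring.
Qed.

End Laurent.

(** * Independence over F_q((1/theta)), and Siegel matrices in matrix form *)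

Section Lattices.
Context (F : finFieldType) (R : realType) (C : cinf F R).
Hypothesis (hq : odd #|F|).
Local Notation theta := (theta C).
Local Notation K := (@field_K F R C).
Local Notation RA := (@ring_A F R C).
Local Notation ev := (map_mx (evtheta C)).
Implicit Types (r s t : R).
Context (n : nat).
Implicit Types (S G : 'M[C]_n) (L : set 'cV[C]_n).

Context (omega : C).
Hypotheses (homega : omega ^+ (#|F| ^ 2) = omega)
  (homegaF : forall a : F, const C a != omega).

(** 1 and omega are orthogonal over F_q((1/theta)): leading terms can cancel only when ord a = ord
    b, and then the leading coefficient x + omega y is a nonzero element of F_(q^2), of order 0. *)
Lemma field_K_omega (a b : C) r : K a -> K b -> oge r (a + omega * b) -> oge r a /\ oge r b.
Proof.
move=> ha hb h; have oo := ord_omega hq homega homegaF.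
have [a0|/ord_fine[s es]] := eqVneq a 0.
  rewrite a0 add0r in h *; split; first exact: oge0.
  by have := oge_mulK oo h; rewrite subr0.
have [b0|/ord_fine[t et]] := eqVneq b 0.
  by rewrite b0 mulr0 addr0 in h; rewrite b0; split=> //; apply: oge0.
have et' : ord (omega * b) = t%:E by rewrite ordM oo add0e.
suff [rs rt] : r <= s /\ r <= t.
  by split; [apply: oge_le (oge_ord es)|apply: oge_le (oge_ord et)].
case: (ltgtP s t) => st.
- have e : ord (a + omega * b) = s%:E.
    by apply: ord_near es st _; rewrite addrAC subrr add0r; apply: oge_ord.
  by have := ord_oge e h; split=> //; lra.
- have e : ord (a + omega * b) = t%:E.
    by apply: ord_near et' st _; rewrite addrK; apply: oge_ord.
  by have := ord_oge e h; split=> //; lra.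
suff e : ord (a + omega * b) = s%:E by have := ord_oge e h; split=> //; lra.
have [a0|[N [i [x [u [x0 hu hx]]]]]] := field_K_lead ha.
  by have := ord_neq0 es; rewrite a0 eqxx.
have [b0|[M [j [y [v [y0 hv hy]]]]]] := field_K_lead hb.
  by have := ord_neq0 et; rewrite b0 eqxx.
set m := theta ^+ N / theta ^+ i in hx; set m' := theta ^+ M / theta ^+ j in hy.
have em : ord m = (i%:R - N%:R)%:E by apply: ord_theta_quot.
have em' : ord m' = (j%:R - M%:R)%:E by apply: ord_theta_quot.
have exm : ord (const C x * m) = (i%:R - N%:R)%:E by rewrite ordM (ord_const C x0) add0e.
have eym : ord (const C y * m') = (j%:R - M%:R)%:E by rewrite ordM (ord_const C y0) add0e.
have sm : s = i%:R - N%:R by have := ord_near exm hu hx; rewrite es => -[].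
have tm : t = j%:R - M%:R by have := ord_near eym hv hy; rewrite et => -[].
(* Equal orders force the two leading monomials in theta to coincide. *)
have mm : m = m'.
  have nat_e : (i + M = j + N)%N.
    by apply/eqP; rewrite -(eqr_nat R) !natrD; apply/eqP; lra.
  have th0 : theta != 0 := ord_neq0 (ord_theta C).
  rewrite /m /m'; apply/eqP; rewrite eqr_div ?expf_neq0 // -!exprD addnC [(M + i)%N]addnC.
  by rewrite nat_e.
have e1 : ord (m * cst2 omega x y) = s%:E.
  by rewrite ordM em (ord_cst2 hq homega homegaF) ?x0 // adde0 sm.
apply: (ord_near e1 (s := Num.min u v)); first by rewrite lt_min; apply/andP; split; lra.
have -> : a + omega * b - m * cst2 omega x y =
    (a - const C x * m) + omega * (b - const C y * m').
  by rewrite -mm /cst2; ring.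
apply: ogeD; first by apply: oge_le hx; rewrite ge_min lexx.
by apply: oge_le (ogeM (oge_ord oo) hy); rewrite add0r ge_min lexx orbT.
Qed.

(** Otherwise a + omega b = - (S - omega) b would have larger order than b, against
    [field_K_omega]. *)
Lemma field_K_indep S r (a b : 'cV[C]_n) : 0 < r -> mge r (S - omega%:M) ->
  (forall i, K (a i 0)) -> (forall i, K (b i 0)) -> a + S *m b = 0 -> a = 0 /\ b = 0.
Proof.
move=> r0 hS ha hb e.
have [b0|] := eqVneq b 0; first by move: e; rewrite b0 mulmx0 addr0.
move/mge_attained => [s [i [j [hs es]]]]; rewrite ord1 in es.
have e' : a + omega *: b = - ((S - omega%:M) *m b).
  by move/eqP: e; rewrite addr_eq0 => /eqP ->; rewrite mulmxBl mul_scalar_mx opprB addrC.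
have : mge (r + s) (a + omega *: b) by rewrite e'; apply/mgeN; apply: mge_mul.
move=> /(_ i 0); rewrite !mxE => /(field_K_omega (ha i) (hb i))[_].
by move=> /(ord_oge es) h; exfalso; clear e e'; lra.
Qed.

Lemma sum_lin_mx m p (M : 'M[C]_(m, p)) (c : 'I_p -> C) :
  \sum_i c i *: col i M = M *m \col_i c i.
Proof.
apply/matrixP=> i j; rewrite summxE mxE; apply: eq_bigr => k _.
by rewrite !mxE mulrC.
Qed.

Lemma basis_unit G (g : 'I_n -> 'cV[C]_n) : (forall i, g i = col i G) ->
  (forall c : 'I_n -> C, (forall i, setT (c i)) -> \sum_i c i *: g i = 0 -> forall i, c i = 0) ->
  G \in unitmx.
Proof.
move=> hl free; rewrite -unitmx_tr -row_free_unit -kermx_eq0; apply/eqP/row_matrixP => i.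
have := mulmx_ker G^T; move/(congr1 (row i)); rewrite row_mul !row0.
move: (row i _) => u hu; have := free (u 0) (fun=> I).
under eq_bigr do rewrite hl.
rewrite sum_lin_mx => h; apply/rowP=> j; rewrite mxE; apply: h.
rewrite -[RHS]trmx0 -hu trmx_mul trmxK; congr (_ *m _).
by apply/matrixP=> k l; rewrite !mxE ord1.
Qed.

(** The columns of G are g_1, ..., g_n and those of G S^T are g_(n+1), ..., g_(2n). *)
Definition siegel_span G S L : Prop :=
  forall v, L v <-> exists a b : 'cV[{poly F}]_n, v = G *m (ev a + S^T *m ev b).

Definition siegel_free S : Prop :=
  forall a b : 'cV[{poly F}]_n, ev a + S^T *m ev b = 0 -> ev a = 0 /\ ev b = 0.

Lemma siegel_comb S G (g : 'I_(n + n) -> 'cV[C]_n) (c : 'I_(n + n) -> C) :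
  (forall i, g (lshift n i) = col i G) ->
  (forall i, g (rshift n i) = \sum_j S i j *: g (lshift n j)) ->
  \sum_i c i *: g i = G *m (\col_i c (lshift n i) + S^T *m \col_i c (rshift n i)).
Proof.
move=> hl hr; rewrite big_split_ord /= mulmxDr; congr (_ + _).
  by rewrite -sum_lin_mx; apply: eq_bigr => i _; rewrite hl.
rewrite mulmxA -sum_lin_mx; apply: eq_bigr => i _; congr (_ *: _).
rewrite hr; under eq_bigr do rewrite hl.
rewrite sum_lin_mx colE -mulmxA -colE; congr (_ *m _).
by apply/matrixP=> k j; rewrite !mxE.
Qed.

Lemma ring_A_col (c : 'I_n -> C) : (forall i, RA (c i)) ->
  exists a : 'cV[{poly F}]_n, \col_i c i = ev a.
Proof.
move=> hc; have /choice[p hp] i : exists p, evtheta C p = c i by case: (hc i) => p _ <-; exists p.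
by exists (\col_i p i); apply/matrixP=> i j; rewrite !mxE hp.
Qed.

Lemma ring_A_glue (a b : 'cV[{poly F}]_n) : exists c : 'I_(n + n) -> C,
  [/\ forall k, RA (c k), \col_i c (lshift n i) = ev a & \col_i c (rshift n i) = ev b].
Proof.
exists (fun k => match fintype.split k with
  inl i => evtheta C (a i 0) | inr i => evtheta C (b i 0) end); split.
- by move=> k; case: fintype.split => i; [exists (a i 0)|exists (b i 0)].
- by apply/matrixP=> i j; rewrite !mxE ord1 (unsplitK (inl i)).
- by apply/matrixP=> i j; rewrite !mxE ord1 (unsplitK (inr i)).
Qed.

Lemma siegel_ofP L S : siegel_of L S <->
  exists2 G, G \in unitmx & siegel_span G S L /\ siegel_free S.
Proof.
split=> [[g [[gen free] [_ freeC] hr]]|[G uG [gen free]]].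
  pose G := \matrix_(i, j) g (lshift n j) i 0.
  have hl i : g (lshift n i) = col i G by apply/matrixP=> k j; rewrite !mxE ord1.
  have uG := basis_unit hl freeC.
  exists G => //; split=> [v|a b e].
    rewrite gen; split=> [[c hc ->]|[a [b ->]]].
      rewrite (siegel_comb c hl hr).
      have [a ->] := ring_A_col (fun i => hc (lshift n i)).
      have [b ->] := ring_A_col (fun i => hc (rshift n i)).
      by exists a, b.
    have [c [hc ha hb]] := ring_A_glue a b; exists c => //.
    by rewrite (siegel_comb c hl hr) ha hb.
  have [c [hc ha hb]] := ring_A_glue a b.
  have h : forall i, c i = 0 by apply: free => //; rewrite (siegel_comb c hl hr) ha hb e mulmx0.
  by rewrite -ha -hb; split; apply/matrixP=> i j; rewrite !mxE h.
pose g k := match fintype.split k with inl i => col i G | inr i => G *m col i S^T end.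
have hl i : g (lshift n i) = col i G by rewrite /g (unsplitK (inl i)).
have hr i : g (rshift n i) = \sum_j S i j *: g (lshift n j).
  under eq_bigr do rewrite hl.
  rewrite /g (unsplitK (inr i)) sum_lin_mx; congr (_ *m _).
  by apply/matrixP=> k j; rewrite !mxE.
exists g; split=> //; split.
- move=> v; rewrite gen; split=> [[a [b ->]]|[c hc ->]].
    have [c [hc ha hb]] := ring_A_glue a b; exists c => //.
    by rewrite (siegel_comb c hl hr) ha hb.
  rewrite (siegel_comb c hl hr).
  have [a ->] := ring_A_col (fun i => hc (lshift n i)).
  have [b ->] := ring_A_col (fun i => hc (rshift n i)).
  by exists a, b.
- move=> c hc; rewrite (siegel_comb c hl hr) => e.
  have [a ea] := ring_A_col (fun i => hc (lshift n i)).
  have [b eb] := ring_A_col (fun i => hc (rshift n i)).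
  have [a0 b0] : ev a = 0 /\ ev b = 0.
    by apply: free; rewrite -ea -eb -[LHS](mulKmx uG) e mulmx0.
  move=> k; rewrite -[k]splitK; case: fintype.split => i /=.
    by have := congr1 (fun M : 'cV_n => M i 0) ea; rewrite a0 !mxE.
  by have := congr1 (fun M : 'cV_n => M i 0) eb; rewrite b0 !mxE.
- move=> v; split=> // _; exists (fun i => (invmx G *m v) i 0) => //.
  under eq_bigr do rewrite hl.
  rewrite sum_lin_mx -[LHS](mulKVmx uG); congr (_ *m _).
  by apply/matrixP=> i j; rewrite !mxE ord1.
- move=> c _; under eq_bigr do rewrite hl.
  rewrite sum_lin_mx => e i.
  have : \col_i c i = 0 :> 'cV_n by rewrite -[LHS](mulKmx uG) e mulmx0.
  by move/matrixP/(_ i 0); rewrite !mxE.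
Qed.

Lemma siegel_free_near S r : 0 < r -> mge r (S^T - omega%:M) -> siegel_free S.
Proof.
move=> r0 hS a b; apply: (field_K_indep r0 hS) => i; rewrite mxE;
  by apply: ring_A_field_K; eexists.
Qed.

(** Generation and freeness over F_q[theta] are part of [siegel_of]; independence over
    F_q((1/theta)) is what the nearness to omega provides. *)
Lemma siegel_lattice L S r : siegel_of L S -> 0 < r -> mge r (S^T - omega%:M) ->
  is_lattice (n + n) L.
Proof.
move=> hL r0 hS; case: (hL) => g [[gen free] [genC freeC] hr].
have gL k : L (g k).
  apply/gen; exists (fun j => (j == k)%:R).
    by move=> j; exists ((j == k)%:R) => //; rewrite rmorph_nat.
  rewrite (bigD1 k) //= eqxx scale1r big1 ?addr0 // => j /negbTE ->.
  by rewrite scale0r.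
split; first by exists g.
  apply/seteqP; split=> // v _; have [c _ ->] := (genC v).1 I.
  by exists n, (fun i => g (lshift n i)), c.
exists g; split.
  move=> v; split=> [[k [w [c [hw hc ->]]]]|[c hc ->]]; last by exists (n + n)%N, g, c.
  have /choice[p hp] i : exists p : 'I_(n + n) -> {poly F}, w i = \sum_j evtheta C (p j) *: g j.
    have [d hd ->] := (gen (w i)).1 (hw i).
    have /choice[p hp] j : exists p, evtheta C p = d j by case: (hd j) => p _ <-; exists p.
    by exists p; apply: eq_bigr => j _; rewrite hp.
  exists (fun j => \sum_i evtheta C (p i j) * c i).
    by move=> j; apply: field_K_sum => i; apply: field_K_evtheta.
  under [RHS]eq_bigr do rewrite scaler_suml.
  rewrite exchange_big; apply: eq_bigr => i _.
  by rewrite hp scaler_sumr; apply: eq_bigr => j _; rewrite scalerA mulrC.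
move=> c hc.
pose G' := \matrix_(i, j) g (lshift n j) i 0.
have hl i : g (lshift n i) = col i G' by apply/matrixP=> k j; rewrite !mxE ord1.
have uG := basis_unit hl freeC.
rewrite (siegel_comb c hl hr) => e.
have [|||a0 b0] := field_K_indep (a := \col_i c (lshift n i)) (b := \col_i c (rshift n i)) r0 hS.
- by move=> i; rewrite mxE.
- by move=> i; rewrite mxE.
- by rewrite -[LHS](mulKmx uG) e mulmx0.
move=> k; rewrite -[k]splitK; case: fintype.split => i /=.
  by move/matrixP/(_ i 0): a0; rewrite !mxE.
by move/matrixP/(_ i 0): b0; rewrite !mxE.
Qed.

End Lattices.

(** * Change of lattice basis and continuity of Siegel matrices *)

Lemma mul_mx_lsub (A : pzSemiRingType) m n p1 p2 (M : 'M[A]_(m, n)) (N : 'M_(n, p1 + p2)) :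
  M *m lsubmx N = lsubmx (M *m N).
Proof. by apply/matrixP=> i j; rewrite !mxE; apply: eq_bigr => k _; rewrite !mxE. Qed.

Lemma mul_mx_rsub (A : pzSemiRingType) m n p1 p2 (M : 'M[A]_(m, n)) (N : 'M_(n, p1 + p2)) :
  M *m rsubmx N = rsubmx (M *m N).
Proof. by apply/matrixP=> i j; rewrite !mxE; apply: eq_bigr => k _; rewrite !mxE. Qed.

Section ChangeOfBasis.
Context (F : finFieldType) (R : realType) (C : cinf F R).
Local Notation ev := (map_mx (evtheta C)).
Implicit Types (r s t : R).
Context (n : nat).
Implicit Types (S G : 'M[C]_n) (L : set 'cV[C]_n).

Definition siegel_row S : 'M[C]_(n, n + n) := row_mx 1%:M S^T.

Lemma siegel_rowE S p (a b : 'M[{poly F}]_(n, p)) :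
  siegel_row S *m ev (col_mx a b) = ev a + S^T *m ev b.
Proof. by rewrite map_col_mx mul_row_col mul1mx. Qed.

Lemma siegel_spanP G S L : siegel_span G S L <->
  forall v, L v <-> exists m : 'cV[{poly F}]_(n + n), v = G *m siegel_row S *m ev m.
Proof.
have e v : (exists a b : 'cV[{poly F}]_n, v = G *m (ev a + S^T *m ev b)) <->
    exists m : 'cV[{poly F}]_(n + n), v = G *m siegel_row S *m ev m.
  split=> [[a [b ->]]|[m ->]].
    by exists (col_mx a b); rewrite -mulmxA siegel_rowE.
  by exists (usubmx m), (dsubmx m); rewrite -mulmxA -[in LHS](vsubmxK m) siegel_rowE.
by split=> h v; rewrite h e.
Qed.

Lemma siegel_freeP S : siegel_free S <->
  forall p (m : 'M[{poly F}]_(n + n, p)), siegel_row S *m ev m = 0 -> ev m = 0.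
Proof.
split=> h => [p m e|a b]; last first.
  rewrite -siegel_rowE => /h; rewrite map_col_mx -[0]col_mx0 => /eq_col_mx; exact.
apply/matrixP=> i j; rewrite mxE.
have := congr1 (col j) e; rewrite colE -mulmxA -colE -map_col -[col j m]vsubmxK siegel_rowE.
have -> : col j (0 : 'M[C]_(n, p)) = 0 by apply/matrixP=> k l; rewrite !mxE.
move=> /h[e1 e2].
have : ev (col j m) = 0 by rewrite -[col j m]vsubmxK map_col_mx e1 e2 col_mx0.
by move/matrixP/(_ i 0); rewrite !mxE.
Qed.

Lemma siegel_span_mx G S L p (V : 'M[C]_(n, p)) : siegel_span G S L ->
  (forall j, L (col j V)) -> exists M, V = G *m siegel_row S *m ev M.
Proof.
move=> /siegel_spanP hL hV; have /choice[m hm] j := (hL _).1 (hV j).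
exists (\matrix_(i, j) m j i 0); apply/matrixP=> i j.
have /matrixP/(_ i 0) := hm j; rewrite !mxE => ->.
by apply: eq_bigr => k _; rewrite !mxE.
Qed.

Lemma siegel_span_row G S L j : siegel_span G S L -> L (col j (G *m siegel_row S)).
Proof.
move=> /siegel_spanP hL; apply/hL; exists (delta_mx j 0).
by rewrite map_delta_mx -colE.
Qed.

(** P expresses one basis of L in the other, so that (1, S^T) P = D (1, S0^T). The last clause
    applies the same P to any lattice for which D stays invertible, and so compares neighbors of S
    with neighbors of S0. *)
Lemma siegel_change L S S0 : siegel_of L S -> siegel_of L S0 ->
  exists P : 'M[{poly F}]_(n + n),
    [/\ lsubmx (siegel_row S *m ev P) \in unitmx,
        rsubmx (siegel_row S *m ev P) = lsubmx (siegel_row S *m ev P) *m S0^T &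
        forall L' S', siegel_of L' S' -> lsubmx (siegel_row S' *m ev P) \in unitmx ->
          siegel_of L' (invmx (lsubmx (siegel_row S' *m ev P))
                        *m rsubmx (siegel_row S' *m ev P))^T].
Proof.
move=> /siegel_ofP[G uG [hG fS]] /siegel_ofP[G0 uG0 [hG0 fS0]].
have [P eP] := siegel_span_mx hG (fun j => siegel_span_row j hG0).
have [P' eP'] := siegel_span_mx hG0 (fun j => siegel_span_row j hG).
(* Going to the other basis and back fixes (1, S^T), and freeness allows coefficients to be
   compared. *)
have PP' : ev P *m ev P' = 1%:M.
  rewrite -map_mxM -(map_mx1 (evtheta C)); apply/eqP; rewrite -subr_eq0 -map_mxB; apply/eqP.
  apply: (siegel_freeP S).1 => //; rewrite map_mxB map_mx1 map_mxM mulmxBr mulmx1.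
  rewrite -[LHS](mulKmx uG) mulmxBr !mulmxA -eP -eP' subrr mulmx0 //.
have P'P := mulmx1C PP'.
exists P; split.
- have : lsubmx (G *m (siegel_row S *m ev P)) = G0.
    by rewrite mulmxA -eP /siegel_row mul_mx_row row_mxKl mulmx1.
  rewrite -mul_mx_lsub => e; move: uG0; rewrite -e !unitmxE det_mulmx unitrM.
  by case/andP.
- rewrite -[LHS](mulKmx uG) -[RHS](mulKmx uG); congr (_ *m _).
  rewrite mul_mx_rsub mulmxA -eP mulmxA mul_mx_lsub mulmxA -eP.
  by rewrite /siegel_row mul_mx_row row_mxKr row_mxKl mulmx1.
move=> L' S' /siegel_ofP[G' uG' [hG' fS']]; set D := lsubmx _; set N := rsubmx _ => uD.
have eB : G' *m D *m siegel_row (invmx D *m N)^T = G' *m siegel_row S' *m ev P.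
  rewrite /siegel_row trmxK mul_mx_row mulmx1 mulmxA mulmxK // -(mulmxA G' _ (ev P)).
  by rewrite -[siegel_row S' *m ev P]hsubmxK mul_mx_row.
apply/siegel_ofP; exists (G' *m D); first by rewrite unitmx_mul uG'.
split.
  apply/siegel_spanP => v; rewrite eB.
  split=> [/((siegel_spanP _ _ _).1 hG')[m ->]|[m ->]].
    by exists (P' *m m); rewrite map_mxM !mulmxA -(mulmxA _ (ev P)) PP' mulmx1.
  by apply/((siegel_spanP _ _ _).1 hG'); exists (P *m m); rewrite map_mxM !mulmxA.
apply/siegel_freeP => p m e.
have : siegel_row S' *m ev (P *m m) = 0.
  rewrite -[LHS](mulKmx uG'); have -> : G' *m (siegel_row S' *m ev (P *m m)) = 0.
    by rewrite map_mxM !mulmxA -eB -mulmxA e mulmx0.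
  by rewrite mulmx0.
move/((siegel_freeP S').1 fS'); rewrite map_mxM => e'.
by rewrite -[LHS]mul1mx -P'P -mulmxA e' mulmx0.
Qed.

Lemma siegel_same_iso L1 L2 S : siegel_of L1 S -> siegel_of L2 S -> lattice_iso L1 L2.
Proof.
move=> /siegel_ofP[G1 u1 [h1 _]] /siegel_ofP[G2 u2 [h2 _]].
exists (G2 *m invmx G1); first by rewrite unitmx_mul u2 unitmx_inv.
apply/seteqP; split=> [v /h2[a [b ->]]|_ [v /h1[a [b ->]] <-]].
  exists (G1 *m (ev a + S^T *m ev b)); first by apply/h1; exists a, b.
  by rewrite mulmxA mulmxKV.
by apply/h2; exists a, b; rewrite mulmxA mulmxKV.
Qed.

Lemma siegel_iso L1 L2 S : siegel_of L1 S -> lattice_iso L1 L2 -> siegel_of L2 S.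
Proof.
move=> /siegel_ofP[G u [h f]] [P uP ->]; apply/siegel_ofP.
exists (P *m G); first by rewrite unitmx_mul uP.
split=> // v; split=> [[w /h[a [b ->]] <-]|[a [b ->]]].
  by exists a, b; rewrite mulmxA.
by exists (G *m (ev a + S^T *m ev b)); [apply/h; exists a, b|rewrite mulmxA].
Qed.

Lemma unitmx_near (D : 'M[C]_n) : D \in unitmx -> exists b c : R, forall D', mge c (D' - D) ->
  D' \in unitmx /\ mge b (invmx D').
Proof.
move=> uD; have [b hb] := mge_ex (invmx D); exists b, (1 - b) => D' hD'.
pose E := invmx D *m D'.
have hE : mge 1 (1%:M - E).
  apply: mgeBC; have -> : E - 1%:M = invmx D *m (D' - D) by rewrite mulmxBr mulVmx.
  by apply: mge_le (mge_mul hb hD'); lra.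
have [uE hE'] := near1_unit ltr01 hE.
have eD' : D' = D *m E by rewrite mulmxA mulmxV // mul1mx.
have uD' : D' \in unitmx by rewrite eD' unitmx_mul uD.
split=> //.
have -> : invmx D' = invmx E *m invmx D.
  by rewrite -[RHS](mulmxK uD') -(mulmxA (invmx E)) mulVmx // mul1mx.
have h0 : mge 0 (invmx E).
  apply: mge_near (mgeBC (mge_le _ hE')) (@mge1 F R C n); lra.
by apply: mge_le (mge_mul h0 hb); lra.
Qed.

Lemma siegel_change_near L S S0 (c : R) : siegel_of L S -> siegel_of L S0 ->
  exists c1 : R, forall L' S', siegel_of L' S' -> mge c1 (S' - S) ->
    exists2 S0', siegel_of L' S0' & mge c (S0' - S0).
Proof.
move=> hS hS0; have [P [uD eN H]] := siegel_change hS hS0.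
have [b [c0 hb]] := unitmx_near uD.
have [s hs] := mge_ex (siegel_row S *m ev P); have [t ht] := mge_ex (ev P).
have [u hu] := mge_ex S0^T.
(* The three bounds keep D' invertible, and give order at least c - b to the error of N' and to that
   of D' times S0^T. *)
pose c1 := Num.max (c0 - t) (Num.max (c - b - t) (c - b - t - u)).
exists c1 => L' S' hS' hd.
have hrow : mge (c1 + t) (siegel_row S' *m ev P - siegel_row S *m ev P).
  rewrite -mulmxBl; apply: mge_mul ht.
  rewrite /siegel_row opp_row_mx add_row_mx subrr; apply/mge_row_mx; split; first exact: mge0.
  by rewrite -linearB /=; apply/mge_tr.
have [hl hr] : mge (c1 + t) (lsubmx (siegel_row S' *m ev P) - lsubmx (siegel_row S *m ev P)) /\
   mge (c1 + t) (rsubmx (siegel_row S' *m ev P) - rsubmx (siegel_row S *m ev P)).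
  by apply/mge_row_mx; rewrite -linearB -(linearB (@rsubmx _ _ _ _)) hsubmxK.
have [m1 m2 m3] : [/\ c0 - t <= c1, c - b - t <= c1 & c - b - t - u <= c1].
  by rewrite /c1 !le_max !lexx !orbT.
have [|uD' hD'] := hb (lsubmx (siegel_row S' *m ev P)); first by apply: mge_le hl; lra.
eexists; first exact: H hS' uD'.
rewrite -[S0]trmxK -linearB /=; apply/mge_tr.
set D' := lsubmx _ in hl uD' hD' *; set N' := rsubmx _ in hr *.
have -> : invmx D' *m N' - S0^T = invmx D' *m ((N' - rsubmx (siegel_row S *m ev P))
    - (D' - lsubmx (siegel_row S *m ev P)) *m S0^T).
  by rewrite eN mulmxBl opprB addrA subrK mulmxBr mulmxA mulVmx // mul1mx.
have -> : c = b + (c - b) by lra.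
apply: mge_mul => //; apply: mgeB; first by apply: mge_le hr; lra.
by apply: mge_le (mge_mul hl hu); lra.
Qed.

End ChangeOfBasis.

(** * The two balls and the open set of lattices *)

Section Surjectivity.
Context (F : finFieldType) (R : realType) (C : cinf F R).
Hypothesis (hq : odd #|F|).
Local Notation q := (q_of F).
Local Notation Q := (qreal F R).
Local Notation rho := (tors_val F R).
Local Notation xi := (per_val F R).
Local Notation ev := (map_mx (evtheta C)).
Context (n : nat).
Implicit Types (A S : 'M[C]_n) (r s h c : R).

Context (omega y0 : C).
Hypotheses (homega : omega ^+ (#|F| ^ 2) = omega)
  (homegaF : forall a : F, const C a != omega)
  (homega2 : exists a : F, omega ^+ 2 = const C a)
  (hy0 : is_y0 y0).

Definition dom_ball : set 'M[C]_n := [set A | (1%:E < mxord A)%E].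

(** The radius is that of [dom_ball] shifted by ord kappa = xi - q rho. *)
Definition siegel_ball : set 'M[C]_n :=
  [set S | ((1 + xi - Q * rho)%:E < mxord (S - omega%:M))%E].

Lemma dom_ballP A : dom_ball A -> exists2 h, 1 < h & mge h A.
Proof. by move/lt_mxordP. Qed.

Lemma dom_ball_mge A : dom_ball A -> mge 1 A.
Proof. by move=> /dom_ballP[h h1]; apply: mge_le; lra. Qed.

Lemma siegel_ballP S : siegel_ball S <->
  exists2 c, 1 + xi - Q * rho < c & mge c (S^T - omega%:M).
Proof.
have e : S^T - omega%:M = (S - omega%:M)^T by rewrite linearB /= tr_scalar_mx.
rewrite e; split=> [/lt_mxordP[c hc h]|[c hc /mge_tr h]].
  by exists c => //; apply/mge_tr.
by apply/lt_mxordP; exists c.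
Qed.

Lemma calS_dom_ball : dom_ball `<=` @calS_dom F R C n.
Proof.
move=> A; apply: le_lt_trans; rewrite lee_fin.
rewrite -/(qreal F R) -/(tors_val F R).
by have := qrho_le R hq; lra.
Qed.

Lemma siegel_ball_lattice S : siegel_ball S ->
  forall L, siegel_of L S -> is_lattice (n + n) L.
Proof.
move=> /siegel_ballP[c hc hS] L hL; have [Q3 r0 Qr0 Qr8 exi] := radius_facts R hq.
by apply: (siegel_lattice hq homega homegaF hL _ hS); lra.
Qed.

Lemma siegel_ball_siegel : siegel_ball `<=` @siegel_matrices F R C n.
Proof.
move=> S hS; have [Q3 r0 Qr0 Qr8 exi] := radius_facts R hq.
pose L := [set v : 'cV[C]_n | exists a b : 'cV[{poly F}]_n, v = 1%:M *m (ev a + S^T *m ev b)].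
have hL : siegel_of L S.
  apply/siegel_ofP; exists 1%:M; first exact: unitmx1.
  split=> //; have [c hc hS'] := (siegel_ballP S).1 hS.
  by apply: (siegel_free_near hq homega homegaF _ hS'); lra.
by exists L => //; apply: siegel_ball_lattice hL.
Qed.

Lemma calS_ball A : dom_ball A -> siegel_ball (calS omega y0 A).
Proof.
move=> /dom_ballP[h h1 hA]; apply/siegel_ballP; rewrite calS_sigma trmxK.
exists (h + xi - Q * rho); first by lra.
rewrite -(sigma0 hq n homega homegaF hy0).
apply: (sigma_diff_ge hq homega homegaF homega2 hy0); rewrite ?subr0 //; first by lra.
  by apply: mge_le hA; lra.
exact: mge0.
Qed.

Lemma calS_bij : set_bij dom_ball siegel_ball (calS omega y0).
Proof.
split; first by move=> A; apply: calS_ball.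
  move=> A1 A2; rewrite !inE => /dom_ball_mge h1 /dom_ball_mge h2.
  rewrite !calS_sigma => /trmx_inj; exact: (sigma_inj hq homega homegaF homega2 hy0).
move=> S /siegel_ballP[c hc hS].
have [|A hA eA] := sigma_surj hq homega homegaF homega2 hy0 _ hS; first by lra.
exists A; last by rewrite calS_sigma eA trmxK.
by apply/lt_mxordP; exists (c - xi + Q * rho) => //; lra.
Qed.

Lemma siegel_tmotive A : dom_ball A -> siegel_of (tmotive_lattice A) (calS omega y0 A).
Proof.
move=> hA; have A1 := dom_ball_mge hA; have [Q3 r0 Qr0 Qr8 exi] := radius_facts R hq.
have [uX _ _] := X_unit hq hy0 (lexx _) A1.
apply/siegel_ofP; exists (zeros_near A y0) => //; split; last first.
  have /siegel_ballP[c hc hS] := calS_ball hA.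
  by apply: (siegel_free_near hq homega homegaF _ hS); lra.
move=> v; rewrite calS_sigma trmxK.
have A0 : mge 0 A by apply: mge_le A1; lra.
have -> : tmotive_lattice A v <-> Exp A v = 0 by apply: Exp_eqP.
rewrite (Exp_kernel hq homega homegaF hy0 _ A1).
by split=> -[a [b ->]]; exists a, b; rewrite mulmxDr mulmxA /sigma mulKVmx.
Qed.

Lemma uniformizable_ball A : dom_ball A -> uniformizable A.
Proof.
move=> /dom_ball_mge hA Y; have A0 : mge 0 A by apply: mge_le hA; lra.
by have [X eX] := Exp_surj hq Y A0; exists X; apply/Exp_eqP.
Qed.

Definition near_lattices : set (set 'cV[C]_n) :=
  [set L | exists2 S, siegel_ball S & siegel_of L S].

(** Openness must be checked at every Siegel matrix S of L, not only at the one S0 in the ball;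
    [siegel_change_near] carries nearness from S to S0. *)
Lemma near_lattices_open : lattice_open near_lattices.
Proof.
split.
- by move=> L [S hS hL]; apply: siegel_ball_lattice hL.
- by move=> L1 L2 [S hS hL] /(siegel_iso hL) hL2; exists S.
move=> L S [S0 hS0 hL0] hL; have /lt_mxordP[c hc h0] := hS0.
have [c1 H] := siegel_change_near c hL hL0.
exists c1 => S' hd [L' _ hL']; exists L' => //.
have [|S0' hS0' hd'] := H L' S' hL'.
  by have /lt_mxordP[r hr] := hd; apply: mge_le; lra.
exists S0' => //; apply/lt_mxordP; exists c => //.
by rewrite -(subrKA S0); apply: mgeD.
Qed.

Lemma dom_ball0 : dom_ball 0.
Proof. by apply/lt_mxordP; exists 2; [lra|exact: mge0]. Qed.

Lemma near_lattices_tmotive L : near_lattices L ->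
  exists A : 'M[C]_n, uniformizable A /\ lattice_iso L (tmotive_lattice A).
Proof.
move=> [S hS hL]; have [_ _ /(_ S hS)[A hA eA]] := calS_bij.
exists A; split; first exact: uniformizable_ball.
by apply: siegel_same_iso hL _; rewrite -eA; apply: siegel_tmotive.
Qed.

End Surjectivity.

(** * Intertwining series *)

Section Intertwiner.
Context (F : finFieldType) (R : realType) (C : cinf F R).
Hypothesis (hq : odd #|F|).
Local Notation q := (q_of F).
Local Notation Q := (qreal F R).
Local Notation rho := (tors_val F R).
Local Notation xi := (per_val F R).
Local Notation theta := (theta C).
Implicit Types (r s h c x : R).

(** If the order of Z were below c, the attained order M could be improved to more than M. *)
Lemma mge_bootstrap m n (Z : 'M[C]_(m, n)) c :
  (forall M, mge M Z -> mge (Num.min c (M + 1)) Z) -> mge c Z.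
Proof.
move=> H; have [->|/mge_attained[M [i [j [hM eM]]]]] := eqVneq Z 0; first exact: mge0.
have := ord_oge eM (H M hM i j); rewrite ge_min => /orP[h|h]; last by exfalso; clear eM; lra.
exact: mge_le hM.
Qed.

Lemma small_grow m n (u : nat -> 'M[C]_(m, n)) (a b : R) N : 0 < a ->
  (forall k, (N <= k)%N -> mge (a * k%:R + b) (u k)) -> small u.
Proof.
move=> a0 hu c; have [M hM] := nat_unbounded ((c - b) / a).
exists (maxn M N) => k; rewrite geq_max => /andP[/hM h /hu hk].
by apply: mge_le hk; move: h; rewrite ler_pdivrMr // mulrC; lra.
Qed.

Context (n : nat).
Implicit Types (A P Y : 'M[C]_n).

Lemma actTmxD A p (U V : 'M[C]_(n, p)) : actTmx A (U + V) = actTmx A U + actTmx A V.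
Proof.
by rewrite /actTmx scalerDr !twistD mulmxDr [X in X + _ = _]addrACA [LHS]addrACA.
Qed.

(* itw A1 A2 P k is Phi_k, where sum Phi_k tau^k is the solution of
   Phi (theta + A2 tau + tau^2) = (theta + A1 tau + tau^2) Phi with Phi_0 = P. *)
Fixpoint itw_pair A1 A2 P k : 'M[C]_n * 'M[C]_n :=
  if k is k'.+1 then
    let: (X0, X1) := itw_pair A1 A2 P k' in
    (X1, (thetad C k.+1 0)^-1 *: (A1 *m twist 1 X1 - X1 *m twist k A2 + twist 2 X0 - X0))
  else (P, (thetad C 1 0)^-1 *: (A1 *m twist 1 P - P *m A2)).

Definition itw A1 A2 P k := (itw_pair A1 A2 P k).1.

Section Recursion.
Context (A1 A2 P : 'M[C]_n).
Local Notation phi := (itw A1 A2 P).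

Lemma itw0 : phi 0 = P. Proof. by []. Qed.

Lemma thetad_itw1 : thetad C 1 0 *: phi 1 = A1 *m twist 1 P - P *m A2.
Proof. by rewrite /itw /= scalerA divff ?scale1r // thetad_neq0. Qed.

Lemma thetad_itwSS k : thetad C k.+2 0 *: phi k.+2 =
  A1 *m twist 1 (phi k.+1) - phi k.+1 *m twist k.+1 A2 + twist 2 (phi k) - phi k.
Proof.
have e : (itw_pair A1 A2 P k).2 = phi k.+1 by rewrite /itw /=; case: itw_pair.
rewrite /itw /=; rewrite -/(itw_pair A1 A2 P k); case E : (itw_pair A1 A2 P k) => [X0 X1] /=.
by rewrite scalerA divff ?scale1r // thetad_neq0.
Qed.

Hypotheses (hA1 : mge 1 A1) (hA2 : mge 1 A2).
Context (m : R).
Hypotheses (m0 : 0 <= m) (hP : mge (- m) P).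

Let c k : R := Num.max 0 (m - k%:R / 2).

Lemma itw_thetad_ge k t : mge t (thetad C k.+1 0 *: phi k.+1) -> mge (t + Q ^+ k.+1) (phi k.+1).
Proof.
move=> h; have -> : phi k.+1 = (thetad C k.+1 0)^-1 *: (thetad C k.+1 0 *: phi k.+1).
  by rewrite scalerA mulVf ?scale1r // thetad_neq0.
by have := mgeZ_div (ord_thetad C hq k) h; rewrite opprK.
Qed.

(** In units of q^k the pole order of Phi_k is at most c k. Dividing by theta_(k+2,0) gains one such
    unit over Phi_k^(2), so the pole order drops by 1/2 per index until it reaches 0. *)
Lemma itw_ge_c k : mge (- (Q ^+ k * c k)) (phi k).
Proof.
have Q3 := qreal_ge3 R hq.
have c_ge0 j : 0 <= c j by rewrite /c le_max lexx.
have c0 : c 0%N = m by rewrite /c mul0r subr0; apply/max_idPr.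
have cS j : c j.+1 <= c j.
  rewrite /c ge_max le_max lexx /= le_max -natr1; apply/orP; right.
  by have := ler0n R j; lra.
have cS1 j : c j <= c j.+1 + 1.
  rewrite {1}/c ge_max; apply/andP; split; first by have := c_ge0 j.+1; lra.
  have : m - j.+1%:R / 2 <= c j.+1 by rewrite /c le_max lexx orbT.
  by rewrite -natr1; lra.
have cS2 j : c j <= c j.+2 + 1.
  rewrite {1}/c ge_max; apply/andP; split; first by have := c_ge0 j.+2; lra.
  have : m - j.+2%:R / 2 <= c j.+2 by rewrite /c le_max lexx orbT.
  by rewrite -addn2 natrD; lra.
suff [] : mge (- (Q ^+ k * c k)) (phi k) /\ mge (- (Q ^+ k.+1 * c k.+1)) (phi k.+1) by [].
elim: k => [|k [IH0 IH1]].
  split; first by rewrite mul1r c0.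
  apply: mge_le (itw_thetad_ge (t := - (Q * m)) _).
    have := cS1 0%N; rewrite c0 expr1 => h.
    have u : 0 <= Q * (c 1%N + 1 - m) by rewrite mulr_ge0 //; lra.
    by lra.
  rewrite thetad_itw1; apply: mgeB.
    by apply: mge_le (mge_mul hA1 (mge_twist 1 hP)); rewrite expr1; lra.
  have u : 0 <= (Q - 1) * m by rewrite mulr_ge0 //; lra.
  by apply: mge_le (mge_mul hP hA2); lra.
split=> //.
have Qk := qrealX_ge1 R hq k.
have e1 : Q ^+ k.+1 = Q * Q ^+ k by rewrite exprS.
have e2 : Q ^+ k.+2 = Q * (Q * Q ^+ k) by rewrite !exprS.
have ck := c_ge0 k; have ck1 := c_ge0 k.+1; have ck2 := c_ge0 k.+2.
have d1 := cS k; have d2 := cS2 k.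
set w := Q ^+ k in Qk e1 e2 IH0.
have u0 : 0 <= w * c k by rewrite mulr_ge0 //; lra.
have u1 : 0 <= w * (c k - c k.+1) by rewrite mulr_ge0 //; lra.
have u2 : 0 <= w * c k.+1 by rewrite mulr_ge0 //; lra.
have u3 : 0 <= (Q - 1) * (w * c k) by rewrite mulr_ge0 //; lra.
have u4 : 0 <= (Q * Q) * (w * (c k - c k.+1)) by rewrite mulr_ge0 //; nra.
have u5 : 0 <= (Q * Q - Q) * (w * c k.+1) by rewrite mulr_ge0 //; nra.
have u6 : 0 <= (Q * Q - 1) * (w * c k) by rewrite mulr_ge0 //; nra.
have u7 : 0 <= (Q * Q) * w * (c k.+2 + 1 - c k) by rewrite !mulr_ge0 //; nra.
apply: mge_le (itw_thetad_ge (t := - (Q ^+ k.+2 * c k)) _).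
  by rewrite e2; nra.
rewrite thetad_itwSS; apply: mgeB; first apply: mgeD; first apply: mgeB.
- by apply: mge_le (mge_mul hA1 (mge_twist 1 IH1)); rewrite expr1 e1 e2; nra.
- by apply: mge_le (mge_mul IH1 (mge_twist k.+1 hA2)); rewrite e1 e2; nra.
- by apply: mge_le (mge_twist 2 IH0); rewrite e2; nra.
- by apply: mge_le IH0; rewrite e2; nra.
Qed.

Lemma itw_ge_m k : mge (- (Q ^+ k * m)) (phi k).
Proof.
apply: mge_le (itw_ge_c k); rewrite lerN2; apply: ler_wpM2l.
  by apply: le_trans (qrealX_ge1 R hq k).
by rewrite /c ge_max m0 /=; have := ler0n R k; lra.
Qed.

(** Once two consecutive Phi_j are integral, so is theta_(k,0) Phi_k, and the division gives order
    q^k. *)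
Lemma itw_ge_Q : exists K, forall k, (K <= k)%N -> mge (Q ^+ k) (phi k).
Proof.
have Q3 := qreal_ge3 R hq.
have [K hK] := nat_unbounded (2 * m); exists K.+2 => k hk.
have h0 j : (K <= j)%N -> mge 0 (phi j).
  move=> /hK h; apply: mge_le (itw_ge_c j).
  have -> : c j = 0 by rewrite /c; apply/max_idPl; lra.
  by rewrite mulr0 oppr0.
case: k hk => [|[|k]] // hk; rewrite -[Q ^+ _]add0r; apply: itw_thetad_ge.
have k0 := h0 k ltac:(lia); have k1 := h0 k.+1 ltac:(lia).
rewrite thetad_itwSS; apply: mgeB => //; apply: mgeD; first apply: mgeB.
- by apply: mge_le (mge_mul hA1 (mge_twist 1 k1)); rewrite mulr0; lra.
- apply: mge_le (mge_mul k1 (mge_twist k.+1 hA2)).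
  by have := qrealX_ge1 R hq k.+1; lra.
- by apply: mge_le (mge_twist 2 k0); rewrite mulr0.
Qed.

Definition itwterm p (Y : 'M[C]_(n, p)) k := phi k *m twist k Y.
Definition Itw p (Y : 'M[C]_(n, p)) := msum (itwterm Y).

Lemma small_itwterm p (Y : 'M[C]_(n, p)) : mge (- rho) Y -> small (itwterm Y).
Proof.
move=> hY; have [Q3 r0 Qr0 Qr8 exi] := radius_facts R hq; have [K hK] := itw_ge_Q.
have r8 := rho_le R hq.
apply: (small_grow (a := 1 - rho) (b := 0) (N := K)); first by lra.
move=> k hk; apply: mge_le (mge_mul (hK k hk) (mge_twist k hY)).
by have := qrealX_ge_nat R hq k; nra.
Qed.

Lemma ItwP p (Y : 'M[C]_(n, p)) : mge (- rho) Y ->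
  vcvg (fun k => \sum_(i < k) itwterm Y i) (Itw Y).
Proof. by move=> h; apply: msumP; apply: small_itwterm. Qed.

(** The recursion cancels all coefficients up to tau^N. At tau^(N+1) the sum still owes what would
    be theta_(N+1,0) Phi_(N+1), and at tau^(N+2) only Phi_N contributes. *)
Lemma itw_trunc p (Y : 'M[C]_(n, p)) N :
  actTmx A1 (\sum_(i < N.+1) itwterm Y i) - \sum_(i < N.+1) itwterm (actTmx A2 Y) i =
  (thetad C N.+1 0 *: phi N.+1) *m twist N.+1 Y
  + (twist 2 (phi N) - phi N) *m twist N.+2 Y.
Proof.
have step k : actTmx A1 (itwterm Y k) - itwterm (actTmx A2 Y) k =
    - (thetad C k 0 *: phi k) *m twist k Y
    + (A1 *m twist 1 (phi k) - phi k *m twist k A2) *m twist k.+1 Y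
    + (twist 2 (phi k) - phi k) *m twist k.+2 Y.
  have -> : actTmx A1 (itwterm Y k) = theta *: (phi k *m twist k Y)
      + (A1 *m twist 1 (phi k)) *m twist k.+1 Y + twist 2 (phi k) *m twist k.+2 Y.
    by rewrite /actTmx /itwterm !twistM !twist_twist add1n add2n mulmxA.
  have -> : itwterm (actTmx A2 Y) k = theta ^+ (q ^ k) *: (phi k *m twist k Y)
      + (phi k *m twist k A2) *m twist k.+1 Y + phi k *m twist k.+2 Y.
    rewrite /itwterm /actTmx !twistD twistZ twistM !twist_twist addn1 addn2.
    by rewrite !mulmxDr -scalemxAr mulmxA.
  have -> : - (thetad C k 0 *: phi k) *m twist k Y =
      theta *: (phi k *m twist k Y) - theta ^+ (q ^ k) *: (phi k *m twist k Y).
    by rewrite mulNmx -scalemxAl /thetad expn0 expr1 scalerBl opprB.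
  by rewrite !mulmxBl !opprD [LHS]addrACA [X in X + _ = _]addrACA.
elim: N => [|N IH].
  rewrite !big_ord1 step /thetad subrr scale0r oppr0 mul0mx add0r.
  by rewrite -/(thetad C 1 0) thetad_itw1 twist_0.
rewrite big_ord_recr [X in _ - X]big_ord_recr /= actTmxD opprD addrACA IH step.
rewrite (thetad_itwSS N).
have e : A1 *m twist 1 (phi N.+1) - phi N.+1 *m twist N.+1 A2 + twist 2 (phi N) - phi N =
   (A1 *m twist 1 (phi N.+1) - phi N.+1 *m twist N.+1 A2) + (twist 2 (phi N) - phi N).
  by rewrite addrA.
by rewrite e [X in _ = X + _]mulmxDl mulNmx [LHS]addrACA addNKr addrA.
Qed.

Lemma vcvg_actTmx A p (u : nat -> 'M[C]_(n, p)) l :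
  vcvg u l -> vcvg (fun k => actTmx A (u k)) (actTmx A l).
Proof.
move=> h; have := vcvgD (vcvgD (vcvgZ theta h) (vcvg_mul A 1%:M (vcvg_twist hq 1 h)))
  (vcvg_twist hq 2 h).
by rewrite mulmx1; apply: eq_vcvg => k; rewrite mulmx1.
Qed.

(** For ord Y >= 1 - rho the boundary terms of [itw_trunc] tend to 0. For ord Y = - rho the
    available bounds do not give this, and [itw_boundary] exploits what remains. *)
Lemma Itw_actTmx p (Y : 'M[C]_(n, p)) : mge (1 - rho) Y -> mge (- rho) (actTmx A2 Y) ->
  Itw (actTmx A2 Y) = actTmx A1 (Itw Y).
Proof.
move=> hY hTY; have [Q3 r0 Qr0 Qr8 exi] := radius_facts R hq; have [K hK] := itw_ge_Q.
have r8 := rho_le R hq.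
have hY' : mge (- rho) Y by apply: mge_le hY; lra.
have h1 := (vcvg_shift 1 _ _).2 (vcvg_actTmx A1 (ItwP hY')).
have h2 := (vcvg_shift 1 _ _).2 (ItwP hTY).
apply: (vcvg_unique h2).
have hb : small (fun k => (thetad C k.+1 0 *: phi k.+1) *m twist k.+1 Y
  + (twist 2 (phi k) - phi k) *m twist k.+2 Y).
  apply: (small_grow (a := 1 - rho) (b := 0) (N := K)); first by lra.
  move=> k hk; have hk1 := hK k.+1 (leqW hk); have {}hk := hK k hk.
  have g1 := qrealX_ge_nat R hq k; have Qk := qrealX_ge1 R hq k.
  have e1 : Q ^+ k.+1 = Q * Q ^+ k by rewrite exprS.
  have e2 : Q ^+ k.+2 = Q * (Q * Q ^+ k) by rewrite !exprS.
  have v1 : 0 <= (1 - rho) * (Q ^+ k - k%:R) by rewrite mulr_ge0 //; lra.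
  have v2 : 0 <= (1 - rho) * ((Q - 1) * Q ^+ k) by rewrite !mulr_ge0 //; lra.
  have v3 : 0 <= (1 - rho) * ((Q * Q - 1) * Q ^+ k) by rewrite !mulr_ge0 //; nra.
  apply: mgeD.
    apply: mge_le (mge_mul (mgeZ (oge_ord (ord_thetad C hq k)) hk1) (mge_twist _ hY)).
    by rewrite e1; lra.
  have hd : mge (Q ^+ k) (twist 2 (phi k) - phi k).
    by apply: mgeB => //; apply: mge_le (mge_twist 2 hk); nra.
  by apply: mge_le (mge_mul hd (mge_twist _ hY)); rewrite e2; lra.
apply: eq_vcvg (vcvg_small h1 (smallN hb)) => k.
by rewrite -itw_trunc addn1 opprB addrC subrK.
Qed.

Lemma Itw_near p (Y : 'M[C]_(n, p)) x : m <= x -> mge x Y ->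
  mge (2 * x - 3 * m) (Itw Y - P *m Y).
Proof.
move=> hx hY; have [Q3 r0 Qr0 Qr8 exi] := radius_facts R hq.
have hY' : mge (- rho) Y by apply: mge_le hY; have := m0; lra.
rewrite /Itw msum_recl; last exact: small_itwterm.
have -> : itwterm Y 0 = P *m Y by rewrite /itwterm twist_0.
rewrite [X in mge _ X]addrC addKr; apply: msum_ge.
  apply: eq_small ((small_shift 1 (itwterm Y)).2 (small_itwterm hY')) => k.
  by rewrite addn1.
move=> k; apply: mge_le (mge_mul (itw_ge_m k.+1) (mge_twist k.+1 hY)).
have g := qrealX_ge R hq (ltn0Sn k); have m0' := m0.
have : 0 <= (Q ^+ k.+1 - 2) * (x - m) by rewrite mulr_ge0 //; lra.
by lra.
Qed.

Lemma actTmx_ge A p (Z : 'M[C]_(n, p)) r : mge 1 A -> 0 <= r -> mge r Z -> mge (r - 1) (actTmx A Z).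
Proof.
move=> hA r0 hZ; have Q3 := qreal_ge3 R hq.
have u1 : 0 <= (Q - 1) * r by rewrite mulr_ge0 //; lra.
have u2 : 0 <= (Q ^+ 2 - 1) * r by rewrite mulr_ge0 //; nra.
apply: mgeD; first apply: mgeD.
- by rewrite addrC; apply: mgeZ hZ; apply: oge_ord; apply: ord_theta.
- by apply: mge_le (mge_mul hA (mge_twist 1 hZ)); rewrite expr1; lra.
- by apply: mge_le (mge_twist 2 hZ); lra.
Qed.

(* The difference d of the two sides satisfies d (theta X) = T_(A1) (d X), and d is
   small to second order at 0; apply this to X / theta^j for large j. *)
Lemma Itw_Exp p (X : 'M[C]_(n, p)) : mge (- rho) X -> Itw (Exp A2 X) = Exp A1 (P *m X).
Proof.
have [Q3 r0 Qr0 Qr8 exi] := radius_facts R hq; have m0' := m0.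
have A10 : mge 0 A1 by apply: mge_le hA1; lra.
have A20 : mge 0 A2 by apply: mge_le hA2; lra.
pose d (X : 'M[C]_(n, p)) := Itw (Exp A2 X) - Exp A1 (P *m X).
have d_theta X' : mge (1 - rho) X' -> d (theta *: X') = actTmx A1 (d X').
  move=> h; rewrite /d (Exp_theta hq) // -scalemxAr (Exp_theta hq) // Itw_actTmx.
  - have e : Itw (Exp A2 X') = d X' + Exp A1 (P *m X') by rewrite /d subrK.
    by rewrite {1}e actTmxD addrK.
  - by apply: (Exp_ge hq) => //; lra.
  rewrite -(Exp_theta hq) //; apply: (Exp_ge hq) => //; first by lra.
  have -> : - rho = -1 + (1 - rho) by lra.
  by apply: mgeZ h; apply: oge_ord; apply: ord_theta.
have d_near X' x : m <= x -> mge x X' -> mge (2 * x - 3 * m) (d X').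
  move=> hx h; have hE : mge x (Exp A2 X') by apply: (Exp_ge hq) => //; lra.
  have hPX : mge (x - m) (P *m X') by rewrite addrC; apply: mge_mul.
  have xx : - xi <= x by lra.
  have xx' : - xi <= x - m by lra.
  apply: (mge_trans (B := P *m Exp A2 X')); first exact: Itw_near.
  apply: (mge_trans (B := P *m X')).
    by rewrite -mulmxBr; apply: mge_le (mge_mul hP (Exp_iso hq A20 xx h)); lra.
  by apply: mgeBC; apply: mge_le (Exp_iso hq A10 xx' hPX); lra.
(* Near 0 the order of d is about 2 j, while each of the j applications of T_A1 costs at most 1; the
   net bound j - 2 rho - 3 m is unbounded. *)
have d_iter j i X' : (i <= j)%N -> j%:R <= 2 * (j%:R - rho) - 3 * m -> m <= j%:R - rho ->
    mge (j%:R - i%:R - rho) X' -> mge (2 * (j%:R - rho) - 3 * m - i%:R) (d X').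
  move=> ij hj hj'; elim: i ij X' => [|i IH] ij X' hX.
    by rewrite subr0; apply: d_near => //; move: hX; rewrite subr0.
  have th0 := ord_neq0 (ord_theta C).
  have eX : X' = theta *: (theta^-1 *: X') by rewrite scalerA divff ?scale1r.
  have hX1 : mge (j%:R - i%:R - rho) (theta^-1 *: X').
    by apply: mge_le (mgeZ_div (ord_theta C) hX); rewrite -natr1; lra.
  have ij' : i.+1%:R <= j%:R :> R by rewrite ler_nat.
  rewrite -natr1 in ij'.
  rewrite eX d_theta; last by apply: mge_le hX1; lra.
  rewrite -[i.+1%:R]natr1 opprD addrA; apply: actTmx_ge => //; first by lra.
  by apply: IH => //; apply: ltnW.
move=> hX; apply/eqP; rewrite -subr_eq0; apply/eqP/mge_oo => c0; exists c0 => //.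
have [j hj] := nat_unbounded (`|c0| + 3 * m + 2 * rho); have {}hj := hj j (leqnn j).
have nc := ler_norm c0; have nc0 := normr_ge0 c0.
apply: mge_le (d_iter j j X (leqnn j) _ _ _); try by lra.
by apply: mge_le hX; lra.
Qed.

End Recursion.
End Intertwiner.

(** * Vanishing of Phi_k for large k *)

Section Vanishing.
Context (F : finFieldType) (R : realType) (C : cinf F R).
Hypothesis (hq : odd #|F|).
Local Notation q := (q_of F).
Local Notation Q := (qreal F R).
Local Notation rho := (tors_val F R).
Local Notation xi := (per_val F R).
Local Notation theta := (theta C).
Implicit Types (r s h c x : R).
Context (n : nat).

(** The rows (1, 1) and (w, - w) have determinant - 2 w, a unit. The perturbations have order at
    least 1 and are absorbed by [mge_bootstrap], applied to a and b together. *)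
Lemma two_point_bound (a b E0 E1 E0' E1' : 'M[C]_n) (w : C) c : ord w = 0%E ->
  mge 1 E0 -> mge 1 E1 -> mge 1 E0' -> mge 1 E1' ->
  mge c (a *m (1%:M + E0) + b *m (1%:M + E1)) ->
  mge c (a *m (w%:M + E0') + b *m (- w%:M + E1')) -> mge c b.
Proof.
move=> hw h0 h1 h0' h1' hu hv; have h2 := ord_2 C hq.
suff /mge_row_mx[] : mge c (row_mx a b) by [].
apply: mge_bootstrap => M /mge_row_mx[ha hb].
have wZ r (Z : 'M[C]_n) : mge r Z -> mge r (w *: Z).
  by move=> hZ; rewrite -[r]add0r; apply: mgeZ => //; apply: oge_ord.
have hMb : mge (Num.min c (M + 1)) b.
  have lec : Num.min c (M + 1) <= c by rewrite ge_min lexx.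
  have leM : Num.min c (M + 1) <= M + 1 by rewrite ge_min lexx orbT.
  have e : (2 * w) *: b = w *: (a *m (1%:M + E0) + b *m (1%:M + E1))
     - (a *m (w%:M + E0') + b *m (- w%:M + E1'))
     + (a *m (E0' - w *: E0) + b *m (E1' - w *: E1)).
    rewrite !mulmxDr !mulmx1 !mulmxN -!scalemxAr !mul_mx_scalar.
    move: (a *m _) (a *m _) (b *m _) (b *m _) => x y z t.
    by apply/matrixP=> i j; rewrite !mxE; ring.
  have h2w : ord (2 * w) = 0%E by rewrite ordM h2 hw add0e.
  have -> : b = (2 * w)^-1 *: ((2 * w) *: b).
    by rewrite scalerA mulVf ?scale1r //; apply: ord_neq0 h2w.
  rewrite -[Num.min _ _]subr0; apply: mgeZ_div h2w _; rewrite e.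
  apply: mgeD; first apply: mgeB.
  - by apply: wZ; apply: mge_le hu.
  - by apply: mge_le hv.
  by apply: mgeD; apply: mge_le leM _; apply: mge_mul => //; apply: mgeB => //; apply: wZ.
apply/mge_row_mx; split=> //.
have lec : Num.min c (M + 1) <= c by rewrite ge_min lexx.
have leM : Num.min c (M + 1) <= M + 1 by rewrite ge_min lexx orbT.
have -> : a = a *m (1%:M + E0) + b *m (1%:M + E1) - b - (a *m E0 + b *m E1).
  rewrite !mulmxDr !mulmx1.
  move: (a *m _) (b *m _) => y z.
  by apply/matrixP=> i j; rewrite !mxE; ring.
apply: mgeB; first by apply: mgeB => //; apply: mge_le hu.
by apply: mgeD; apply: mge_le leM _; apply: mge_mul.
Qed.

Context (A1 A2 P : 'M[C]_n).
Hypotheses (hA1 : mge 1 A1) (hA2 : mge 1 A2).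
Context (m : R).
Hypotheses (m0 : 0 <= m) (hP : mge (- m) P).
Local Notation phi := (itw A1 A2 P).

(* At a torsion point the partial sums of T_(A1) Phi t - Phi (T_(A2) t) telescope,
   leaving only the boundary terms. *)
Lemma itw_boundary p (t : 'M[C]_(n, p)) : mge (- rho) t -> actTmx A2 t = 0 ->
  actTmx A1 (Itw A1 A2 P t) = 0 ->
  small (fun k => phi k *m twist k.+2 t + phi k.+1 *m twist k.+3 t).
Proof.
move=> ht T2 T1; have [Q3 r0 Qr0 Qr8 exi] := radius_facts R hq.
have r8 := rho_le R hq.
have [K hK] := itw_ge_Q hq hA1 hA2 m0 hP.
have h1 := (vcvg_shift 2 _ _).2 (vcvg_actTmx hq A1 (ItwP hq hA1 hA2 m0 hP ht)).
rewrite T1 in h1.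
(* Boundary terms with a factor A or a twisted Phi are small by the bound q^k alone. The untwisted
   ones are not: at ord t = - rho it gives only q^k - q^(k+2) rho = - rho q^k. *)
have hb : small (fun k => (A1 *m twist 1 (phi k.+1) - phi k.+1 *m twist k.+1 A2
    + twist 2 (phi k)) *m twist k.+2 t + twist 2 (phi k.+1) *m twist k.+3 t).
  apply: (small_grow (a := 1 - rho) (b := 0) (N := K)); first by lra.
  move=> k hk; have hk1 := hK k.+1 (leqW hk); have {}hk := hK k hk.
  have g1 := qrealX_ge_nat R hq k; have Qk := qrealX_ge1 R hq k.
  have e1 : Q ^+ k.+1 = Q * Q ^+ k by rewrite exprS.
  have e2 : Q ^+ k.+2 = Q * (Q * Q ^+ k) by rewrite !exprS.
  have e3 : Q ^+ k.+3 = Q * (Q * (Q * Q ^+ k)) by rewrite !exprS.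
  have v1 : 0 <= (1 - rho) * (Q ^+ k - k%:R) by rewrite mulr_ge0 //; lra.
  have v3 : 0 <= (1 - rho) * ((Q * Q - 1) * Q ^+ k) by rewrite !mulr_ge0 //; nra.
  have v4 : 0 <= (1 - rho) * ((Q * Q * Q - 1) * Q ^+ k).
    by rewrite !mulr_ge0 //; [lra|have : 9 <= Q * Q by nra|]; nra.
  have v5 : 0 <= Q ^+ k * ((2 - Q * rho) * (Q - 1)) by rewrite !mulr_ge0 //; lra.
  have v6 : 0 <= Q ^+ k * (2 - Q * rho - 1) by rewrite !mulr_ge0 //; lra.
  have v7 : 0 <= rho * Q ^+ k by rewrite !mulr_ge0 //; lra.
  rewrite !mulmxDl mulNmx; apply: mgeD; first apply: mgeD; first apply: mgeB.
  - apply: mge_le (mge_mul (mge_mul hA1 (mge_twist 1 hk1)) (mge_twist _ ht)).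
    by rewrite expr1 e1 e2; lra.
  - apply: mge_le (mge_mul (mge_mul hk1 (mge_twist k.+1 hA2)) (mge_twist _ ht)).
    by rewrite e1 e2; lra.
  - apply: mge_le (mge_mul (mge_twist 2 hk) (mge_twist _ ht)).
    by rewrite e2; lra.
  - apply: mge_le (mge_mul (mge_twist 2 hk1) (mge_twist _ ht)).
    by rewrite e1 e3; lra.
have h1' : small (fun k => actTmx A1 (\sum_(i < k + 2) itwterm A1 A2 P t i)).
  by apply: eq_small h1 => k; rewrite subr0.
apply: eq_small (smallD hb (smallN h1')) => k.
have z : \sum_(i < k.+2) itwterm A1 A2 P (0 : 'M_(n, p)) i = 0.
  by rewrite big1 // => i _; rewrite /itwterm twist0 mulmx0.
have := itw_trunc hq A1 A2 P t k.+1; rewrite T2 z subr0.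
rewrite addn2 => ->; rewrite (thetad_itwSS hq).
rewrite (mulmxBl (_ + _)) (mulmxBl (twist 2 (phi k.+1))).
move: (_ *m twist k.+2 t) (_ *m twist k.+3 t) (phi k *m twist k.+2 t).
move: (phi k.+1 *m twist k.+3 t) => e a b d.
by apply/matrixP=> i j; rewrite !mxE; ring.
Qed.

Context (omega y0 : C).
Hypotheses (homega : omega ^+ (#|F| ^ 2) = omega)
  (homegaF : forall a : F, const C a != omega)
  (homega2 : exists a : F, omega ^+ 2 = const C a)
  (hy0 : is_y0 y0).
Hypotheses (hX : Exp A1 (P *m zeros_near A2 y0) = 0)
  (hX' : Exp A1 (P *m zeros_near A2 (omega * y0)) = 0).
Local Notation eta := (theta^-1 * y0).

(** t is Exp_A2 (Z / theta) for the period Z of A2 near z; Phi t = Exp_A1 (P Z / theta) is torsion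
    because P Z is a period of A1. *)
Lemma torsion_point (z : C) : exp1 z = 0 -> ord z = (- xi)%:E ->
  Exp A1 (P *m zeros_near A2 z) = 0 -> exists t : 'M[C]_n,
  mge (1 - rho) (t - (theta^-1 * z)%:M) /\
  small (fun k => phi k *m twist k.+2 t + phi k.+1 *m twist k.+3 t).
Proof.
move=> ez oz hz; have [Q3 r0 Qr0 Qr8 exi] := radius_facts R hq.
have A10 : mge 0 A1 by apply: mge_le hA1; lra.
have A20 : mge 0 A2 by apply: mge_le hA2; lra.
have [e2 d2] := zeros_nearP hq (lexx _) hA2 ez (oge_ord oz).
set Z := zeros_near A2 z in e2 d2 hz.
have th0 := ord_neq0 (ord_theta C).
have thZ : theta *: (theta^-1 *: Z) = Z by rewrite scalerA divff ?scale1r.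
have hZ : mge (2 - Q * rho) (theta^-1 *: Z - (theta^-1 * z)%:M).
  rewrite -scale_scalar_mx -scalerBr; apply: mge_le (mgeZ_div (ord_theta C) d2); lra.
have oz' : oge (- rho) (theta^-1 * z).
  by apply: oge_le (oge_div (ord_theta C) (oge_ord oz)); lra.
have hZ0 : mge (- rho) (theta^-1 *: Z).
  by apply: mge_near (mge_le _ hZ) (mge_scalar oz'); lra.
have rx : - xi <= - rho by lra.
exists (Exp A2 (theta^-1 *: Z)); split.
  apply: mge_trans (mge_le _ (Exp_iso hq A20 rx hZ0)) (mge_le _ hZ); lra.
apply: itw_boundary.
- exact: Exp_ge.
- by rewrite -(Exp_theta hq) ?thZ.
rewrite (Itw_Exp hq hA1 hA2 m0 hP) // -(Exp_theta hq) //.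
by rewrite scalemxAr thZ.
Qed.

(** The points t and t' are eta and omega eta up to a factor close to 1. As the Frobenius changes
    the sign of omega, they give two independent relations between consecutive Phi_k; dividing by
    eta^(q^(k+3)), of order - rho q^(k+3) = - xi q^(k+1), yields the rate. *)
Lemma itw_decay c : exists J, forall j, (J <= j)%N -> mge (c + xi * Q ^+ j) (phi j).
Proof.
have [Q3 r0 Qr0 Qr8 exi] := radius_facts R hq; have eQ := qreal_rho R hq.
have [t [ht st]] := torsion_point (exp1_y hq hy0) (ord_y hq hy0) hX.
have [t' [ht' st']] := torsion_point (exp1_oy hq homega hy0)
  (ord_oy hq homega homegaF hy0) hX'.
have oe := ord_eta hq hy0; have e0 := ord_neq0 oe.
pose E := eta^-1 *: t - 1%:M; pose E' := eta^-1 *: t' - omega%:M.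
have hE : mge 1 E.
  have -> : E = eta^-1 *: (t - eta%:M) by rewrite scalerBr scale_scalar_mx mulVf.
  by apply: mge_le (mgeZ_div oe ht); lra.
have hE' : mge 1 E'.
  have -> : E' = eta^-1 *: (t' - (theta^-1 * (omega * y0))%:M).
    by rewrite scalerBr scale_scalar_mx (mulrCA theta^-1) (mulrCA _ omega) mulVf ?mulr1.
  by apply: mge_le (mgeZ_div oe ht'); lra.
have et N : twist N t = eta ^+ (q ^ N) *: (1%:M + twist N E).
  by rewrite -(twist1 C n N) -twistD -twistZ addrC subrK scalerA divff ?scale1r.
have et' N : twist N t' = eta ^+ (q ^ N) *: ((omega ^+ (q ^ N))%:M + twist N E').
  by rewrite -twist_scalar -twistD -twistZ addrC subrK scalerA divff ?scale1r.
have tw N (B : 'M[C]_n) : mge 1 B -> mge 1 (twist N B).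
  move=> h; apply: mge_le (mge_twist N h); rewrite mulr1; exact: qrealX_ge1.
have wN N : omega ^+ (q ^ N.+1) = - omega ^+ (q ^ N).
  by rewrite expnS exprM (omega_frob homegaF homega2) -frobE rmorphN.
have [J1 hJ1] := st c; have [J2 hJ2] := st' c.
exists (maxn J1 J2).+1 => -[|k] //; rewrite ltnS geq_max => /andP[/hJ1 h1 /hJ2 h2].
have ow : ord (omega ^+ (q ^ k.+2)) = 0%E.
  by rewrite (ordX _ (ord_omega hq homega homegaF)) mulr0.
have hb : mge c (eta ^+ (q ^ k.+3) *: phi k.+1).
  rewrite !et -!scalemxAr !scalemxAl in h1.
  have w3 : (omega ^+ (q ^ k.+3))%:M = - (omega ^+ (q ^ k.+2))%:M :> 'M[C]_n.
    by rewrite wN raddfN.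
  rewrite !et' w3 -!scalemxAr !scalemxAl in h2.
  exact: two_point_bound ow (tw _ _ hE) (tw _ _ hE) (tw _ _ hE') (tw _ _ hE') h1 h2.
have oq : ord (eta ^+ (q ^ k.+3)) = (Q ^+ k.+3 * (- rho))%:E.
  by rewrite (ordX _ oe) natr_qk.
have -> : phi k.+1 = (eta ^+ (q ^ k.+3))^-1 *: (eta ^+ (q ^ k.+3) *: phi k.+1).
  by rewrite scalerA mulVf ?scale1r // expf_neq0.
apply: mge_le (mgeZ_div oq hb).
have -> : Q ^+ k.+3 = Q ^+ 2 * Q ^+ k.+1 by rewrite -exprD add2n.
have : Q ^+ 2 * Q ^+ k.+1 * - rho = - ((Q ^+ 2 * rho) * Q ^+ k.+1) by ring.
by move=> ->; rewrite eQ exi; lra.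
Qed.

(* While Phi_j is small, the recursion read from right to left bounds Phi_j by
   Phi_(j+1) and Phi_(j+2), so that the decay at infinity propagates back to Phi_j = 0. *)
Lemma itw_finite : exists D, forall k, (D <= k)%N -> phi k = 0.
Proof.
have [Q3 r0 Qr0 Qr8 exi] := radius_facts R hq; have eQ := qreal_rho R hq.
have [K hK] := itw_ge_Q hq hA1 hA2 m0 hP; exists K => k hk.
apply: mge_oo => c0; pose c := `|c0|.
have c00 : 0 <= c by apply: normr_ge0.
have [J hJ] := itw_decay c.
(* Backward induction from the range of [itw_decay]. The threshold K comes from the bound q^k and is
   independent of c, which is what lets c grow at a fixed k. *)
suff H d : forall j, (K <= j)%N -> (J <= j + d)%N -> mge (c + xi * Q ^+ j) (phi j).
  exists (c + xi * Q ^+ k); last by apply: (H J) => //; apply: leq_addl.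
  have h1 := ler_norm c0; rewrite -/c in h1; have h2 := qrealX_ge1 R hq k.
  have h3 : 0 <= xi * Q ^+ k by rewrite mulr_ge0; lra.
  by lra.
elim: d => [|d IH] j hj hJj; first by apply: hJ; rewrite -[j]addn0.
have g1 : mge (c + xi * Q ^+ j.+1) (phi j.+1) by apply: IH; lia.
have g2 : mge (c + xi * Q ^+ j.+2) (phi j.+2) by apply: IH; lia.
have gj := hK j hj; have Qj := qrealX_ge1 R hq j.
apply: mge_bootstrap => M0 hM0.
(* Here ord Phi_j >= q^j >= 1, and from order M >= 1 the term Phi_j^(2) has order q^2 M >= M + 1. *)
pose M := Num.max M0 1.
have M1 : 1 <= M by rewrite le_max lexx orbT.
have hM : mge M (phi j).
  by rewrite /M; have [_|_] := leP M0 1 => //; apply: mge_le gj.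
suff : mge (Num.min (c + xi * Q ^+ j) (M + 1)) (phi j).
  by apply: mge_le; rewrite le_min ge_min lexx /= ge_min lerD2r le_max lexx orbT.
have lec : Num.min (c + xi * Q ^+ j) (M + 1) <= c + xi * Q ^+ j by rewrite ge_min lexx.
have leM : Num.min (c + xi * Q ^+ j) (M + 1) <= M + 1 by rewrite ge_min lexx orbT.
have e : phi j = A1 *m twist 1 (phi j.+1) - phi j.+1 *m twist j.+1 A2 + twist 2 (phi j)
    - thetad C j.+2 0 *: phi j.+2.
  by rewrite (thetad_itwSS hq) opprB addrC subrK.
rewrite e.
have xj : 0 <= xi * Q ^+ j by rewrite mulr_ge0; lra.
have eQ1 : Q ^+ j.+1 = Q * Q ^+ j by rewrite exprS.
have eQ2 : Q ^+ j.+2 = Q ^+ 2 * Q ^+ j by rewrite -exprD.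
have u1 : 0 <= (Q - 1) * (xi * Q ^+ j) by rewrite mulr_ge0 //; lra.
have u2 : 0 <= (Q - 1) * (Q * (xi * Q ^+ j)) by rewrite !mulr_ge0 //; lra.
have u3 : 0 <= (Q - 1) * c by rewrite mulr_ge0 //; lra.
have u4 : 0 <= Q * Q ^+ j by rewrite mulr_ge0 //; lra.
apply: mgeB; first apply: mgeD; first apply: mgeB.
- apply: mge_le lec _; apply: mge_le (mge_mul hA1 (mge_twist 1 g1)).
  by rewrite expr1 eQ1; lra.
- apply: mge_le lec _; apply: mge_le (mge_mul g1 (mge_twist j.+1 hA2)).
  by rewrite eQ1; lra.
- by apply: mge_le leM _; apply: mge_le (mge_twist 2 hM); nra.
apply: mge_le lec _; apply: mge_le (mgeZ (oge_ord (ord_thetad C hq _)) g2).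
rewrite eQ2.
have -> : - (Q ^+ 2 * Q ^+ j) + (c + xi * (Q ^+ 2 * Q ^+ j)) =
   c + (Q ^+ 2 * (xi - 1)) * Q ^+ j by ring.
have -> : Q ^+ 2 * (xi - 1) = xi by rewrite exi; lra.
by [].
Qed.

End Vanishing.

Lemma zmod_shuffle (V : zmodType) (a b c d f g : V) :
  a + b + c = d + f + g -> a - d = (f - b) + (g - c).
Proof.
move=> e; have -> : a = d + (f + g) - (b + c).
  by rewrite addrA -e -[a + b + c]addrA addrK.
by rewrite addrAC [d + _]addrC addrK opprD addrACA.
Qed.

(** * Isomorphisms of t-motives *)

Section TMotiveMaps.
Context (F : finFieldType) (R : realType) (C : cinf F R).
Hypothesis (hq : odd #|F|).
Local Notation q := (q_of F).
Local Notation theta := (theta C).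
Context (n : nat).
Implicit Types (A : 'M[C]_n) (x y : taufree C n).

Definition coefrow x k : 'rV[C]_n := \row_j ((x : 'rV[{poly C}]_n) 0 j)`_k.

Lemma coefrow_inj x y : (forall k, coefrow x k = coefrow y k) -> x = y.
Proof.
move=> h; apply/rowP=> j; apply/polyP=> k.
by have /rowP/(_ j) := h k; rewrite !mxE.
Qed.

Lemma coefrowD x y k : coefrow (x + y) k = coefrow x k + coefrow y k.
Proof. by apply/rowP=> j; rewrite !mxE coefD. Qed.

Lemma coefrowZ (a : C) x k : coefrow (a *: x) k = a *: coefrow x k.
Proof. by apply/rowP=> j; rewrite !mxE coefCM. Qed.

Lemma coefrow_sum I (s : seq I) (f : I -> taufree C n) k :
  coefrow (\sum_(i <- s) f i) k = \sum_(i <- s) coefrow (f i) k.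
Proof.
apply: (big_morph (fun x => coefrow x k)) => [x y|]; first exact: coefrowD.
by apply/rowP=> j; rewrite !mxE coef0.
Qed.

Lemma coefrow_tau x k : coefrow (taufree_tau x) k =
  if k is k'.+1 then twist 1 (coefrow x k') else 0.
Proof. by apply/rowP=> j; case: k => [|k]; rewrite !mxE coef_taumul. Qed.

Lemma coefrow_T A x k : coefrow (taufree_T A x) k = theta ^+ (q ^ k) *: coefrow x k
  + (if k is k'.+1 then coefrow x k' *m twist k' A else 0)
  + (if k is k'.+2 then coefrow x k' else 0).
Proof.
apply/rowP=> j; rewrite !mxE !coefD coef_mulconst coefMX coefMXn mulrC.
congr (_ + _ + _); last by case: k => [|[|k]] //=; rewrite mxE // subn2.
case: k => [|k] /=; first by rewrite mxE.
by rewrite mxE coef_sum; apply: eq_bigr => i _; rewrite coef_mulconst !mxE.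
Qed.

(** The matrices H_k with h e = sum_k H_k tau^k e on the basis column e; for C{tau}-linear h they
    determine h. *)
Definition coefmx (h : taufree C n -> taufree C n) k : 'M[C]_n :=
  \matrix_(i, j) coefrow (h (tbasis C i)) k 0 j.

Lemma row_coefmx h k i : row i (coefmx h k) = coefrow (h (tbasis C i)) k.
Proof. by apply/rowP=> j; rewrite !mxE. Qed.

Lemma tmotive_ext A (h h' : {linear taufree C n -> taufree C n}) :
  {morph h : x / taufree_tau x} -> {morph h' : x / taufree_tau x} ->
  (forall i, h (tbasis C i) = h' (tbasis C i)) -> h =1 h'.
Proof.
move=> hh hh' e x.
pose c i k := ((x : 'rV[{poly C}]_n) 0 i)`_k.
pose N := (\max_i size ((x : 'rV[{poly C}]_n) 0%R i))%N.
have ex : x = \sum_i \sum_(k < N) c i k *: iter k (@taufree_tau _ _ C n) (tbasis C i).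
  have -> := tmotive_free A N c.
  apply/rowP=> j; rewrite mxE; apply/polyP=> k; rewrite coef_poly.
  by case: ltnP => // hk; rewrite nth_default //; apply: leq_trans hk; exact: leq_bigmax.
have itE (g : taufree C n -> taufree C n) : {morph g : x / taufree_tau x} ->
    forall k y, g (iter k (@taufree_tau _ _ C n) y) = iter k (@taufree_tau _ _ C n) (g y).
  by move=> hg; elim=> [|k IH] y //=; rewrite hg IH.
rewrite ex !linear_sum; apply: eq_bigr => i _; rewrite !linear_sum; apply: eq_bigr => k _.
by rewrite !linearZ /= (itE h) // (itE h') // e.
Qed.

(** Composition reverses products: T after h is H (theta + A tau + tau^2), whereas [coefmx_comp_T]
    describes (theta + A tau + tau^2) H. *)
Lemma coefmx_T A (h : {linear taufree C n -> taufree C n}) k :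
  coefmx (fun x => taufree_T A (h x)) k = theta ^+ (q ^ k) *: coefmx h k
  + (if k is k'.+1 then coefmx h k' *m twist k' A else 0)
  + (if k is k'.+2 then coefmx h k' else 0).
Proof.
apply/row_matrixP => i; rewrite row_coefmx coefrow_T !linearD /= linearZ /= row_coefmx.
congr (_ + _ + _); first by case: k => [|k]; rewrite ?row0 // row_mul row_coefmx.
by case: k => [|[|k]]; rewrite ?row0 // row_coefmx.
Qed.

Lemma coefmx_comp_T A (h : {linear taufree C n -> taufree C n}) k :
  {morph h : x / taufree_tau x} ->
  coefmx (fun x => h (taufree_T A x)) k = theta *: coefmx h k
  + (if k is k'.+1 then A *m twist 1 (coefmx h k') else 0)
  + (if k is k'.+2 then twist 2 (coefmx h k') else 0).
Proof.
move=> hh; apply/row_matrixP => i; rewrite row_coefmx.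
have -> : taufree_T A (tbasis C i) = theta *: tbasis C i
    + \sum_j A i j *: taufree_tau (tbasis C j) + taufree_tau (taufree_tau (tbasis C i)).
  exact: tmotive_T.
rewrite !(linearD h) (linearZ_LR h) (linear_sum h) !hh !coefrowD coefrowZ coefrow_sum.
rewrite !(linearD (row i)) (linearZ_LR (row i)) /= row_coefmx.
congr (_ + _ + _).
  case: k => [|k].
    by rewrite row0 big1 // => j _; rewrite linearZ /= hh coefrowZ coefrow_tau scaler0.
  rewrite row_mul; apply/rowP=> l; rewrite summxE !mxE; apply: eq_bigr => j _.
  by rewrite linearZ /= hh coefrowZ coefrow_tau !mxE.
rewrite coefrow_tau; case: k => [|[|k]]; rewrite ?row0 // coefrow_tau ?twist0 //.
by apply/rowP=> j; rewrite twist_twist !mxE.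
Qed.

Lemma coefmx_eq h h' : (forall k, coefmx h k = coefmx h' k) ->
  forall i, h (tbasis C i) = h' (tbasis C i).
Proof. by move=> e i; apply: coefrow_inj => k; rewrite -!row_coefmx e. Qed.

Lemma coefmx_id k : coefmx id k = (k == 0%N)%:R%:M.
Proof.
apply/matrixP=> i j; rewrite !mxE eqxx /= eq_sym.
by case: eqP => _ /=; case: k => [|k]; rewrite ?coef1 ?coef0 ?mulr1n ?mulr0n.
Qed.

(** Commuting with T determines theta_(k,0) H_k from the preceding coefficients, so H_0 fixes all of
    H. Applied to composites of two candidate inverse maps. *)
Lemma tmotive_endo_id A (h : {linear taufree C n -> taufree C n}) :
  {morph h : x / taufree_tau x} -> {morph h : x / taufree_T A x} ->
  coefmx h 0 = 1%:M -> h =1 id.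
Proof.
move=> htau hT h0.
have rec k : thetad C k 0 *: coefmx h k =
   (if k is k'.+1 then A *m twist 1 (coefmx h k') - coefmx h k' *m twist k' A else 0)
   + (if k is k'.+2 then twist 2 (coefmx h k') - coefmx h k' else 0).
  have := coefmx_comp_T A k htau.
  have -> : coefmx (fun x => h (taufree_T A x)) k = coefmx (fun x => taufree_T A (h x)) k.
    by apply/matrixP=> i j; rewrite mxE [RHS]mxE hT.
  rewrite coefmx_T /thetad expn0 expr1 scalerBl => /zmod_shuffle ->.
  by case: k => [|[|k]]; rewrite ?subr0.
have hk k : coefmx h k.+1 = 0.
  suff [] : coefmx h k.+1 = 0 /\ coefmx h k.+2 = 0 by [].
  have unscale j (B : 'M[C]_n) : thetad C j.+1 0 *: B = 0 -> B = 0.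
    by move/eqP; rewrite scaler_eq0 (negbTE (thetad_neq0 C hq j)) => /eqP.
  elim: k => [|k [IH1 IH2]].
    have h1 : coefmx h 1 = 0.
      by apply: (unscale 0%N); rewrite rec h0 twist1 twist_0 mulmx1 mul1mx subrr addr0.
    by split=> //; apply: (unscale 1%N); rewrite rec h1 h0 twist0 mulmx0 mul0mx twist1 !subrr addr0.
  split=> //; apply: (unscale k.+2); rewrite rec IH2 IH1 !twist0 mulmx0 mul0mx !subrr addr0 //.
apply: (tmotive_ext (h' := idfun) A htau) => // i.
apply: (coefmx_eq (h' := id)) => -[|k]; rewrite coefmx_id //.
by rewrite hk raddf0.
Qed.

End TMotiveMaps.

(** * The map of t-motives attached to a finite series *)

Section ItwMap.
Context (F : finFieldType) (R : realType) (C : cinf F R).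
Local Notation q := (q_of F).
Local Notation theta := (theta C).
Context (n : nat).
Implicit Types (A P : 'M[C]_n) (x y : taufree C n).

(** Right multiplication of the row x by sum_k Phi_k tau^k: [mulconst p a * 'X^k] is the product p a
    tau^k of C{tau}. *)
Definition itwmap (D : nat) (Phi : nat -> 'M[C]_n) x : taufree C n :=
  \row_j \sum_i \sum_(k < D.+1) mulconst ((x : 'rV[{poly C}]_n) 0 i) (Phi k i j) * 'X^k.

Lemma itwmap_linear D Phi : linear (itwmap D Phi).
Proof.
move=> c x y; apply/rowP=> j; rewrite !mxE mul_polyC scaler_sumr -big_split.
apply: eq_bigr => i _; rewrite scaler_sumr -big_split; apply: eq_bigr => k _ /=.
by rewrite !mxE mul_polyC mulconst_linear mulrDl scalerAl.
Qed.

HB.instance Definition _ D Phi :=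
  GRing.isLinear.Build C (taufree C n) (taufree C n) _ (itwmap D Phi) (itwmap_linear D Phi).

Lemma itwmap_tau D Phi : {morph itwmap D Phi : x / taufree_tau x}.
Proof.
move=> x; apply/rowP=> j; rewrite !mxE (big_morph _ (@taumulD F R C) (@taumul0 F R C)).
apply: eq_bigr => i _; rewrite (big_morph _ (@taumulD F R C) (@taumul0 F R C)).
apply: eq_bigr => k _; rewrite mxE -taumul_mulconst; move: (mulconst _ _) => p.
elim: (k : nat) => [|l IH]; first by rewrite !mulr1.
by rewrite exprSr !mulrA taumulMX IH.
Qed.

Lemma coefrow_itwmap0 D Phi x : coefrow (itwmap D Phi x) 0 = coefrow x 0 *m Phi 0%N.
Proof.
apply/rowP=> j; rewrite !mxE coef_sum; apply: eq_bigr => i _.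
rewrite coef_sum big_ord_recl big1 ?addr0 => [|k _]; last by rewrite coefMXn.
by rewrite mulr1 coef_mulconst mxE expr1.
Qed.

Lemma coefmx_itwmap D Phi k : (forall k, (D <= k)%N -> Phi k = 0) ->
  coefmx (itwmap D Phi) k = Phi k.
Proof.
move=> hD; apply/matrixP=> i j; rewrite !mxE coef_sum (bigD1 i) //=.
rewrite [X in _ + X]big1 ?addr0 => [|l li].
  rewrite mxE !eqxx /= coef_sum; under eq_bigr do rewrite mulconst1 coefMXn coefC.
  have [hk|hk] := ltnP k D.+1.
    rewrite (bigD1 (Ordinal hk)) //= [X in _ + X]big1 ?addr0 => [|l lk].
      by rewrite ltnn subnn eqxx.
    case: ltnP => // lk'; rewrite subn_eq0.
    by case: leqP => // lk''; move: lk; rewrite -val_eqE /= eqn_leq lk' lk''.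
  rewrite hD ?mxE; last exact: ltnW.
  rewrite big1 // => l _; case: ltnP => // lk'; rewrite subn_eq0.
  by rewrite leqNgt (leq_trans (ltn_ord l) hk).
rewrite mxE (negbTE li) andbF /= coef_sum big1 // => k' _.
by rewrite mulconst0 mul0r coef0.
Qed.

Hypothesis (hq : odd #|F|).

(** Since basis vectors are sent to Phi e, the relation Phi T_A2 = T_A1 Phi gives a map from M(A1)
    to M(A2), although P goes from the lattice of A2 to that of A1. *)
Lemma itwmap_T A1 A2 P D : (forall k, (D <= k)%N -> itw A1 A2 P k = 0) ->
  forall x, itwmap D (itw A1 A2 P) (taufree_T A1 x) = taufree_T A2 (itwmap D (itw A1 A2 P) x).
Proof.
move=> hD; pose f : {linear taufree C n -> taufree C n} := itwmap D (itw A1 A2 P).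
have ftau : {morph f : x / taufree_tau x} by apply: itwmap_tau.
apply: (tmotive_ext (h := f \o @taufree_T F R C n A1) (h' := @taufree_T F R C n A2 \o f) A1).
- by move=> x; rewrite /= taufree_T_tau ftau.
- by move=> x; rewrite /= ftau taufree_T_tau.
apply: coefmx_eq => k.
have -> : coefmx (f \o @taufree_T F R C n A1) k = _ := coefmx_comp_T A1 k ftau.
have -> : coefmx (@taufree_T F R C n A2 \o f) k = _ := coefmx_T A2 f k.
have cf j : coefmx f j = itw A1 A2 P j by apply: coefmx_itwmap.
case: k => [|[|k]]; rewrite !cf ?addr0 ?expn0 ?expr1 //.
  have := thetad_itw1 hq A1 A2 P; rewrite !twist_0 itw0 /thetad expn0 expr1 scalerBl => /eqP.
  rewrite subr_eq => /eqP ->; move: (A1 *m _) (P *m _) (_ *: _) => u v w.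
  by apply/matrixP=> i j; rewrite !mxE; ring.
have := thetad_itwSS hq A1 A2 P k; rewrite {1}/thetad expn0 expr1 scalerBl.
move: (itw _ _ _ k) (itw _ _ _ k.+1) (itw _ _ _ k.+2) => a b c.
move: (A1 *m _) (b *m _) (twist 2 a) (_ *: c) (_ *: c) => u v w s t /eqP.
rewrite subr_eq => /eqP ->.
by apply/matrixP=> i j; rewrite !mxE; ring.
Qed.

Lemma tmotive_iso_itw A1 A2 P D D' : P \in unitmx ->
  (forall k, (D <= k)%N -> itw A1 A2 P k = 0) ->
  (forall k, (D' <= k)%N -> itw A2 A1 (invmx P) k = 0) ->
  tmodule_iso (tmotive A1) (tmotive A2).
Proof.
move=> uP hD hD'.
pose f : {linear taufree C n -> taufree C n} := itwmap D (itw A1 A2 P).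
pose g : {linear taufree C n -> taufree C n} := itwmap D' (itw A2 A1 (invmx P)).
have fT := itwmap_T hD; have gT := itwmap_T hD'.
have ftau : {morph f : x / taufree_tau x} by apply: itwmap_tau.
have gtau : {morph g : x / taufree_tau x} by apply: itwmap_tau.
have gf : cancel f g.
  apply: (tmotive_endo_id hq (A := A1) (h := g \o f)).
  - by move=> x; rewrite /= ftau gtau.
  - by move=> x; rewrite /= [f _]fT [g _]gT.
  apply/row_matrixP => i; rewrite row_coefmx coefrow_itwmap0 -row_coefmx coefmx_itwmap //.
  by rewrite -row_mul mulmxV.
have fg : cancel g f.
  apply: (tmotive_endo_id hq (A := A2) (h := f \o g)).
  - by move=> x; rewrite /= gtau ftau.
  - by move=> x; rewrite /= [g _]gT [f _]fT.
  apply/row_matrixP => i; rewrite row_coefmx coefrow_itwmap0 -row_coefmx coefmx_itwmap //.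
  by rewrite -row_mul mulVmx.
by exists f; split; [exists g|exact: fT|exact: ftau].
Qed.

End ItwMap.

(** * From an equivalence of Siegel matrices to an isomorphism *)

Section Injectivity.
Context (F : finFieldType) (R : realType) (C : cinf F R).
Hypothesis (hq : odd #|F|).
Local Notation ev := (map_mx (evtheta C)).
Context (n : nat).
Implicit Types (A P : 'M[C]_n).

Context (omega y0 : C).
Hypotheses (homega : omega ^+ (#|F| ^ 2) = omega)
  (homegaF : forall a : F, const C a != omega)
  (homega2 : exists a : F, omega ^+ 2 = const C a)
  (hy0 : is_y0 y0).
Local Notation X A := (zeros_near A y0).
Local Notation X' A := (zeros_near A (omega * y0)).
Local Notation per A := (X A *m row_mx 1%:M (sigma omega y0 A)).

Lemma per_zeros A : mge 1 A -> per A = row_mx (X A) (X' A).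
Proof.
move=> hA; have [u _ _] := X_unit hq hy0 (lexx _) hA.
by rewrite mul_mx_row mulmx1 /sigma mulKVmx.
Qed.

Lemma Exp_per A p (M : 'M[{poly F}]_(n + n, p)) : mge 1 A -> Exp A (per A *m ev M) = 0.
Proof.
move=> hA; apply/(Exp_kernel hq homega homegaF hy0 _ hA); exists (usubmx M), (dsubmx M).
by rewrite per_zeros // -[in LHS](vsubmxK M) map_col_mx mul_row_col.
Qed.

(** The relation says that P maps the lattice of A2 into that of A1, in particular the two families
    of short periods needed by [itw_finite]. *)
Lemma itw_finite_per A1 A2 P (M : 'M[{poly F}]_(n + n)) : mge 1 A1 -> mge 1 A2 ->
  P *m per A2 = per A1 *m ev M -> exists D, forall k, (D <= k)%N -> itw A1 A2 P k = 0.
Proof.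
move=> hA1 hA2 e.
have [r hr] := mge_ex P.
have hm : mge (- `|r|) P by apply: mge_le hr; rewrite lerNl; have := ler_norm (- r); rewrite normrN.
have hrow : row_mx (P *m X A2) (P *m X' A2) = per A1 *m ev M.
  by rewrite -mul_mx_row -per_zeros.
have el : P *m X A2 = per A1 *m ev (lsubmx M).
  rewrite -[LHS](row_mxKl _ (P *m X' A2)) hrow -mul_mx_lsub; congr (_ *m _).
  by apply/matrixP=> i j; rewrite !mxE.
have er : P *m X' A2 = per A1 *m ev (rsubmx M).
  rewrite -[LHS](row_mxKr (P *m X A2)) hrow -mul_mx_rsub; congr (_ *m _).
  by apply/matrixP=> i j; rewrite !mxE.
apply: (itw_finite hq hA1 hA2 (normr_ge0 r) hm homega homegaF homega2 hy0).
  by rewrite el Exp_per.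
by rewrite er Exp_per.
Qed.

(** Transposed, the relation reads (1, sigma A2) Z = den^T (1, sigma A1). With P built from it, P
    carries the period matrix of A2 times Z to that of A1; Z being invertible over F_q[theta], both
    P and P^-1 preserve periods and both series are finite. *)
Lemma siegel_act_iso A1 A2 (Z : 'M[{poly F}]_(n + n)) : mge 1 A1 -> mge 1 A2 ->
  Z \in unitmx -> siegel_act Z (calS omega y0 A1) (calS omega y0 A2) ->
  tmodule_iso (tmotive A1) (tmotive A2).
Proof.
move=> hA1 hA2 uZ [uden e].
have [u1 _ _] := X_unit hq hy0 (lexx _) hA1; have [u2 _ _] := X_unit hq hy0 (lexx _) hA2.
set den := (_ + _ *m _) in uden e.
have tden : den^T = ev (ulsubmx Z) + sigma omega y0 A2 *m ev (dlsubmx Z).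
  by rewrite /den linearD /= trmx_mul calS_sigma trmxK -!map_trmx !trmxK.
have tnum : den^T *m sigma omega y0 A1 = ev (ursubmx Z) + sigma omega y0 A2 *m ev (drsubmx Z).
  have := congr1 (fun M : 'M_n => (M *m den)^T) e.
  rewrite mulmxKV // trmx_mul calS_sigma trmxK => ->.
  by rewrite linearD /= trmx_mul calS_sigma trmxK -!map_trmx !trmxK.
have eZ : row_mx 1%:M (sigma omega y0 A2) *m ev Z = den^T *m row_mx 1%:M (sigma omega y0 A1).
  rewrite mul_mx_row mulmx1 tnum tden -{1}[Z]submxK map_block_mx mul_row_block.
  by rewrite !mul1mx.
have uD : den^T \in unitmx by rewrite unitmx_tr.
pose P := X A1 *m invmx den^T *m invmx (X A2).
have uP : P \in unitmx by rewrite !unitmx_mul u1 !unitmx_inv uD u2.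
have eP : P *m per A2 *m ev Z = per A1.
  rewrite /P -!mulmxA (mulmxA (invmx (X A2))) mulVmx // mul1mx eZ.
  by rewrite (mulmxA (invmx _)) mulVmx // mul1mx.
have ZV : ev Z *m ev (invmx Z) = 1%:M by rewrite -map_mxM mulmxV // map_mx1.
have [D hD] : exists D, forall k, (D <= k)%N -> itw A1 A2 P k = 0.
  apply: (itw_finite_per (M := invmx Z)) => //.
  by rewrite -eP -(mulmxA _ (ev Z)) ZV mulmx1.
have [D' hD'] : exists D, forall k, (D <= k)%N -> itw A2 A1 (invmx P) k = 0.
  apply: (itw_finite_per (M := Z)) => //.
  by rewrite -eP -(mulmxA P) mulKmx.
exact: tmotive_iso_itw uP hD hD'.
Qed.

End Injectivity.

Theorem theorem0p9 (F : finFieldType) (R : realType) (C : cinf F R)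
    (n : nat) (omega y0 : C)
    (hq : odd #|F|) (hn : (0 < n)%N)
    (homega : omega ^+ (#|F| ^ 2) = omega)
    (homegaF : forall a : F, const C a != omega)
    (homega2 : exists a : F, omega ^+ 2 = const C a)
    (hy0 : is_y0 y0) :
  ((exists U V : set 'M[C]_n,
      [/\ mxnbhs 0 U, U `<=` @calS_dom F R C n, mxnbhs omega%:M V,
          V `<=` @siegel_matrices F R C n & set_bij U V (calS omega y0)]) /\
   (exists W : set (set 'cV[C]_n),
      [/\ lattice_open W, W (tmotive_lattice (0 : 'M[C]_n))
        & forall L, W L -> exists A : 'M[C]_n,
            uniformizable A /\ lattice_iso L (tmotive_lattice A)])) /\
  (forall m : nat, exists U : set 'M[C]_n,
     [/\ mxnbhs 0 U, U `<=` @calS_dom F R C n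
       & forall A1 A2, U A1 -> U A2 ->
           (exists gamma : 'M[{poly F}]_(n + n),
              [/\ stab_omega omega gamma,
                  forall i j, (size (gamma i j) <= m.+1)%N,
                  forall i j, (size (invmx gamma i j) <= m.+1)%N
                & siegel_act gamma (calS omega y0 A1) (calS omega y0 A2)]) ->
           tmodule_iso (tmotive A1) (tmotive A2)]).
Proof.
have dom_nbhs : mxnbhs 0 (@dom_ball F R C n) by exists 1 => B; rewrite subr0.
have dom_sub := @calS_dom_ball F R C hq n.
split; [split|move=> m].
- exists (@dom_ball F R C n), (@siegel_ball F R C n omega); split=> //.
  + by eexists => B; apply.
  + exact: siegel_ball_siegel.
  + exact: calS_bij.
- exists (@near_lattices F R C n omega); split.
  + exact: near_lattices_open.
  + have d0 := @dom_ball0 F R C n; exists (calS omega y0 0); first exact: calS_ball.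
    exact: siegel_tmotive.
  + exact: (near_lattices_tmotive hq homega homegaF homega2 hy0).
exists (@dom_ball F R C n); split=> // A1 A2 /dom_ball_mge hA1 /dom_ball_mge hA2.
case=> gamma [[ugamma _] _ _ hgamma].
exact: (siegel_act_iso hq homega homegaF homega2 hy0 hA1 hA2 ugamma hgamma).
Qed.
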